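(* Let $\mathcal{M}$ be a graded manifold and let $X$ be any vector field on $\mathcal{M}$ with $[X,X]=0$. Then $X$ is invariant under its own flow $\theta:\mathcal{D}\to\mathcal{M}$, that is, $X\otimes1\sim_\theta X$.
   Context: Graded manifolds: ''graded'' means $\mathbb{Z}$-graded and all elements are homogeneous. For a sequence $(n_j)_{j\in\mathbb{Z}}$ of non-negative integers with finite sum and $V\subseteq\mathbb{R}^{n_0}$ open, the graded domain $V^{(n_j)}$ is $V$ with the sheaf $\mathcal{C}^\infty_{(n_j)}$ assigning to an open $W\subseteq V$ the graded commutative algebra whose degree $k$ elements are formal power series in variables $\xi^\mu$ of non-zero degrees ($n_j$ of them of degree $j$ for each $j\neq0$; $\xi^\mu\xi^\nu=(-1)^{|\xi^\mu||\xi^\nu|}\xi^\nu\xi^\mu$), of total degree $k$, with coefficients in $C^\infty(W)$. A graded manifold $\mathcal{M}=(M,\mathcal{C}^\infty_{\mathcal{M}})$ is a Hausdorff second countable space $M$ with a sheaf of graded commutative associative unital algebras locally isomorphic (as locally ringed spaces) to graded domains; $M$ is then a smooth manifold. A graded smooth map $\phi=(\underline{\phi},\phi^* ):\mathcal{M}\to\mathcal{N}$ consists of a smooth map $\underline{\phi}:M\to N$ and a morphism of sheaves of graded algebras $\phi^*:\mathcal{C}^\infty_{\mathcal{N}}\to\underline{\phi}_*\mathcal{C}^\infty_{\mathcal{M}}$ inducing local morphisms on stalks. $\mathcal{M}|_U$ is the restriction to an open $U\subseteq M$. Products are categorical products. A vector field of degree $|X|$ is a degree $|X|$ graded derivation of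 $\mathcal{C}^\infty_{\mathcal{M}}(M)$; $[X,Y]=X\circ Y-(-1)^{|X||Y|}Y\circ X$. $X\sim_\phi Y$ ($\phi$-related) means $X\circ\phi^*=\phi^*\circ Y$. Flows: a flow domain on the manifold $M$ is an open $D\subseteq M\times\mathbb{R}$ such that each $\{t\mid(m,t)\in D\}$, $m\in M$, is an open interval containing $0$. $\mathbb{R}[-k]$ is the graded manifold with a single global coordinate $\mathbb{t}$ of degree $-k$ (it is $\mathbb{R}$ for $k=0$; its underlying manifold is a point $\{\ast\}$ for $k\ne0$), with addition $+$ given by $+^*(\mathbb{t})=\mathbb{t}_1+\mathbb{t}_2$ and zero $0:\{\ast\}\to\mathbb{R}[-k]$, $0^*(\mathbb{t})=0$. A flow domain of degree $k$ on $\mathcal{M}$ is $\mathcal{D}=(\mathcal{M}\times\mathbb{R})|_D$ with $D$ a flow domain on $M$ if $k=0$, and $\mathcal{D}=\mathcal{M}\times\mathbb{R}[-k]$ if $k\neq0$. A flow of degree $k$ on $\mathcal{M}$ is a graded smooth map $\theta:\mathcal{D}\to\mathcal{M}$, $\mathcal{D}$ a flow domain of degree $k$, such that $\theta\circ(1_{\mathcal{M}},0_{\mathcal{M}})=1_{\mathcal{M}}$ (with $0_{\mathcal{M}}$ the composite $\mathcal{M}\to\{\ast\}\xrightarrow{0}\mathbb{R}[-k]$) and $\theta\circ(\theta\times1_{\mathbb{R}[-k]})=\theta\circ(1_{\mathcal{M}}\times+)\circ\mathsf{a}$ on $\mathcal{D}^\bullet$, where $\mathsf{a}$ is the associator, $\mathcal{D}^\bullet=(\mathcal{M}\times\mathbb{R}[-k])\times\mathbb{R}[-k]$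 for $k\ne0$, and for $k=0$, $\mathcal{D}^\bullet$ is the restriction of $(\mathcal{M}\times\mathbb{R})\times\mathbb{R}$ to the open set of all $((m,s),t)$ with $(m,s)\in D$, $(\underline{\theta}(m,s),t)\in D$ and $(m,s+t)\in D$. The infinitesimal generator of $\theta$ is the unique degree $k$ vector field $X$ with $1\otimes\partial_{\mathbb{t}}\sim_\theta X$, where $1\otimes\partial_{\mathbb{t}}$ is the lift to $\mathcal{D}$ of the coordinate vector field on $\mathbb{R}[-k]$. Every vector field $X$ of degree $k$ with $[X,X]=0$ (automatic for $k$ even) is the infinitesimal generator of a unique maximal flow of degree $k$ (every other flow with generator $X$ is a restriction of it); it is called the flow of $X$. Lift: $X\otimes1$ denotes the canonical lift of $X$ to $\mathcal{M}\times\mathbb{R}[-k]$ ($k=|X|$), i.e. the unique vector field $p_1$-related to $X$ and $p_2$-related to $0$ ($p_1,p_2$ the projections), restricted to $\mathcal{D}$. *)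

(* Defs.v *)
From HB Require Import structures.
From mathcomp Require Import all_boot all_order all_algebra.
From mathcomp Require Import all_classical reals topology normedtype derive.
Set Implicit Arguments.
Unset Strict Implicit.
Unset Printing Implicit Defensive.
Import Order.TTheory GRing.Theory Num.Theory numFieldNormedType.Exports.
Local Open Scope classical_set_scope.
Local Open Scope ring_scope.

Fixpoint partials (R : realType) (n : nat) (js : seq 'I_n)
    (f : 'rV[R]_n -> R^o) : 'rV[R]_n -> R^o :=
  if js is j :: js' then partials js' ('D_(delta_mx 0 j) f) else f.

(* For W not open this is smoothness on the interior of W. *)
Definition smooth_on (R : realType) (n : nat) (W : set 'rV[R]_n)
    (f : 'rV[R]_n -> R^o) : Prop :=
  forall (js : seq 'I_n) x, W° x -> {for x, continuous (partials js f)} /\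
    forall j, derivable (partials js f) x (delta_mx 0 j).

Section SmoothOn.
Variables (R : realType) (n : nat) (W : set 'rV[R]_n).
Implicit Types (f g : 'rV[R]_n -> R^o) (js : seq 'I_n).

Let near_int f g x : (forall y, W° y -> f y = g y) -> W° x ->
  {near x, f =1 g}.
Proof.
move=> fg Wx; have : \near x, W° x by exact: open_nbhs_nbhs (conj (open_interior W) Wx).
by apply: filterS => y /fg.
Qed.

Let partials_eq f g js : (forall x, W° x -> f x = g x) ->
  forall x, W° x -> partials js f x = partials js g x.
Proof.
elim: js f g => [|j js IH] f g fg x Wx /=; first exact: fg.
apply: IH Wx => y Wy; apply: near_eq_derive; exact: near_int fg Wy.
Qed.

Let upto (k : nat) f := forall js, (size js <= k)%N -> forall x, W° x ->
  {for x, continuous (partials js f)} /\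
    forall j, derivable (partials js f) x (delta_mx 0 j).

Let upto_eq k f g : (forall x, W° x -> f x = g x) -> upto k f -> upto k g.
Proof.
move=> fg sf js jsk x Wx; have [cf df] := sf js jsk x Wx.
have e := near_int (partials_eq js fg) Wx.
split=> [|j]; last exact: near_eq_derivable e (df j).
rewrite /prop_for /continuous_at -(partials_eq js fg Wx); apply: cvg_trans cf.
exact: (@near_eq_cvg _ _ (nbhs x) _ _ _ e).
Qed.

Let upto0 k f : upto k f -> forall x, W° x -> {for x, continuous f} /\
    forall j, derivable f x (delta_mx 0 j).
Proof. by move=> sf; exact: sf [::] _. Qed.

Let uptoS k f : (forall x, W° x -> {for x, continuous f} /\
    forall j, derivable f x (delta_mx 0 j)) ->
  (forall j, upto k ('D_(delta_mx 0 j) f)) -> upto k.+1 f.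
Proof. by move=> f0 f1 [|j js] //= jsk; exact: f1. Qed.

Let upto_partial k f j : upto k.+1 f -> upto k ('D_(delta_mx 0 j) f).
Proof. by move=> sf js jsk; exact: (sf (j :: js)). Qed.

Let upto_le k f : upto k.+1 f -> upto k f.
Proof. by move=> sf js jsk; apply: sf; exact: leqW. Qed.

Let uptoD k f g : upto k f -> upto k g -> upto k (f \+ g).
Proof.
elim: k f g => [|k IH] f g sf sg.
  move=> [|//] _ x Wx /=; have [cf df] := upto0 sf Wx; have [cg dg] := upto0 sg Wx.
  by split => [|j]; [exact: continuousD | exact: derivableD].
apply: uptoS => [x Wx|j].
  have [cf df] := upto0 sf Wx; have [cg dg] := upto0 sg Wx.
  by split => [|j]; [exact: continuousD | exact: derivableD].
apply: upto_eq (IH _ _ (upto_partial j sf) (upto_partial j sg)) => x Wx /=.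
have [cf df] := upto0 sf Wx; have [cg dg] := upto0 sg Wx.
by rewrite deriveD.
Qed.

Let uptoM k f g : upto k f -> upto k g -> upto k (f \* g).
Proof.
elim: k f g => [|k IH] f g sf sg.
  move=> [|//] _ x Wx /=; have [cf df] := upto0 sf Wx; have [cg dg] := upto0 sg Wx.
  by split => [|j]; [exact: continuousM | exact: derivableM].
apply: uptoS => [x Wx|j].
  have [cf df] := upto0 sf Wx; have [cg dg] := upto0 sg Wx.
  by split => [|j]; [exact: continuousM | exact: derivableM].
apply: upto_eq (uptoD (IH _ _ (upto_le sf) (upto_partial j sg))
                      (IH _ _ (upto_le sg) (upto_partial j sf))) => x Wx /=.
have [cf df] := upto0 sf Wx; have [cg dg] := upto0 sg Wx.
by rewrite deriveM.
Qed.

Let smooth_upto f : smooth_on W f <-> forall k, upto k f.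
Proof.
split=> [sf k js _|sf js]; first exact: sf.
exact: (sf (size js) js (leqnn _)).
Qed.

Lemma eq_smooth_on f g : (forall x, W° x -> f x = g x) ->
  smooth_on W f -> smooth_on W g.
Proof. by move=> fg /smooth_upto sf; apply/smooth_upto => k; exact: upto_eq (sf k). Qed.

Lemma smooth_onD f g : smooth_on W f -> smooth_on W g -> smooth_on W (f \+ g).
Proof. by move=> /smooth_upto ? /smooth_upto ?; apply/smooth_upto => k; exact: uptoD. Qed.

Lemma smooth_onM f g : smooth_on W f -> smooth_on W g -> smooth_on W (f \* g).
Proof. by move=> /smooth_upto ? /smooth_upto ?; apply/smooth_upto => k; exact: uptoM. Qed.

Lemma smooth_on_cst (c : R) : smooth_on W (cst c : _ -> R^o).
Proof.
have H js : exists c', partials js (cst c : _ -> R^o) = cst c'.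
  elim: js c => [|j js IH] c' /=; first by exists c'.
  suff -> : 'D_(delta_mx 0 j) (cst c' : 'rV[R]_n -> R^o) = cst 0 by exact: IH.
  by apply/funext => y; rewrite derive_cst.
move=> js x _; have [c' ->] := H js.
by split => [|j]; [exact: cst_continuous | exact: derivable_cst].
Qed.

Lemma smooth_on_sum (I : finType) (F : I -> 'rV[R]_n -> R^o) :
  (forall i, smooth_on W (F i)) -> smooth_on W (fun x => \sum_i F i x).
Proof.
move=> sF; elim: (index_enum I) => [|i s IH].
  by apply: eq_smooth_on (smooth_on_cst 0) => x _; rewrite big_nil.
by apply: eq_smooth_on (smooth_onD (sF i) IH) => x _; rewrite big_cons.
Qed.

Lemma smooth_on_coord (i : 'I_n) : smooth_on W (fun x => x 0 i).
Proof.
move=> [|j js] x Wx /=.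
  split => [|j]; first exact: coord_continuous.
  exact/diff_derivable/differentiable_coord.
apply: (@eq_smooth_on (cst ((delta_mx 0 j : 'rV[R]_n) 0 i)) _ _ (smooth_on_cst _)) => // y _ /=.
apply/esym/cvg_lim => //; apply: cvg_near_cst.
near=> h; rewrite /= !mxE addrK /GRing.scale /= mulrA mulVf ?mul1r //.
by near: h; exact: nbhs_dnbhs_neq.
Unshelve. all: by end_near.
Qed.

End SmoothOn.

Lemma smooth_on_sub (R : realType) n (V W : set 'rV[R]_n) f :
  V `<=` W -> smooth_on W f -> smooth_on V f.
Proof. by move=> VW sf js x Vx; apply: sf; exact: interiorS Vx. Qed.

(* The Koszul sign (-1)^(i j). *)
Definition ksign (R : realType) (i j : int) : R :=
  (-1) ^+ (odd `|i|%N && odd `|j|%N).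

(* The graded domain on R^n with variables xi_a of degree d`_a, a < size d; the
   number n_j of variables of degree j is the multiplicity of j in d. A section
   of degree k over W is the family of coefficients of the xi^m, where
   xi^m = xi_0^(m 0) * xi_1^(m 1) * ..., each extended by 0 outside W. *)
Section GradedDomain.
Variables (R : realType) (n : nat) (d : seq int).

Definition monomial := {ffun 'I_(size d) -> nat}.

Definition mdeg (m : monomial) : int := \sum_(a < size d) d`_a *+ m a.

(* xi_a ^ 2 = 0 for xi_a of odd degree. *)
Definition madm (m : monomial) : bool :=
  [forall a : 'I_(size d), odd `|(d`_a)%R|%N ==> (m a <= 1)%N].

(* xi^l * xi^m = msign l m * xi^(l + m): each xi_b ^ (m b) moves to the left past
   the xi_a ^ (l a) with b < a. *)
Definition msign (l m : monomial) : R :=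
  \prod_(a < size d) \prod_(b < size d | (b < a)%N) ksign R (d`_a *+ l a) (d`_b *+ m b).

Definition gdom_pred (W : set 'rV[R]_n) (k : int) :
    {pred monomial -> 'rV[R]_n -> R^o} :=
  fun c => `[< [/\ forall m, smooth_on W (c m),
                   forall m x, ~ W x -> c m x = 0
                 & forall m, ~~ (madm m && (mdeg m == k)) -> c m = cst 0] >].

Fact gdom_pred_submod W k : submod_closed (gdom_pred W k).
Proof.
split=> [|a f g /asboolP [f1 f2 f3] /asboolP [g1 g2 g3]]; apply/asboolP; split.
- by move=> m; exact: smooth_on_cst.
- by [].
- by [].
- move=> m.
  exact: smooth_onD (smooth_onM (@smooth_on_cst _ _ W a) (f1 m)) (g1 m).
- move=> m x Wx; change (a * f m x + g m x = 0).
  by rewrite f2 // g2 // mulr0 addr0.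
- move=> m hm; apply/funext => x; change (a * f m x + g m x = 0).
  by rewrite f3 // g3 //= mulr0 addr0.
Qed.

HB.instance Definition _ W k := GRing.isSubmodClosed.Build R _ (gdom_pred W k)
  (gdom_pred_submod W k).

Record gdom_sec (W : set 'rV[R]_n) (k : int) := GDomSec {
  gcoef :> monomial -> 'rV[R]_n -> R^o;
  gcoefP : gcoef \in gdom_pred W k }.

HB.instance Definition _ W k := [isSub of gdom_sec W k for @gcoef W k].
HB.instance Definition _ W k := [Choice of gdom_sec W k by <:].
HB.instance Definition _ W k := [SubChoice_isSubLmodule of gdom_sec W k by <:].

Fact gdom_mul_subproof W (i j k : int) (s : gdom_sec W i) (t : gdom_sec W j) :
  (fun m x => if madm m && (mdeg m == k) then
     \sum_(l : {dffun forall a, 'I_(m a).+1})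
        let l1 : monomial := [ffun a => l a : nat] in
        let l2 : monomial := [ffun a => (m a - l a)%N] in
        msign l1 l2 * (s l1 x * t l2 x)
   else 0) \in gdom_pred W k.
Proof.
have /asboolP[s1 s2 s3] := gcoefP s; have /asboolP[t1 t2 t3] := gcoefP t.
apply/asboolP; split => [m|m x Wx|m hm].
- have [_|_] := boolP (madm m && (mdeg m == k)); last exact: smooth_on_cst.
  apply: smooth_on_sum => l.
  exact: (smooth_onM (@smooth_on_cst _ _ W _) (smooth_onM (s1 _) (t1 _))).
- case: ifP => _ //; apply: big1 => l _ /=.
  by rewrite s2 // mul0r mulr0.
- by apply/funext => x; rewrite (negbTE hm).
Qed.

Definition gdom_mul W i j k s t := GDomSec (@gdom_mul_subproof W i j k s t).

Fact gdom_one_subproof (W : set 'rV[R]_n) :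
  (fun (m : monomial) x => ((m == [ffun => 0%N]) && (x \in W))%:R)
    \in gdom_pred W 0.
Proof.
apply/asboolP; split => [m|m x Wx|m].
- apply: (eq_smooth_on _ (@smooth_on_cst _ _ W (m == [ffun => 0%N])%:R)) => x Wx.
  by rewrite mem_set ?andbT //; exact: interior_subset Wx.
- by rewrite memNset ?andbF.
- case: (m =P [ffun => 0%N]) => [->|_ _]; last by apply/funext.
  suff -> : madm [ffun => 0%N] && (mdeg [ffun => 0%N] == 0) by [].
  apply/andP; split; first by apply/forallP => a; rewrite ffunE implybT.
  by rewrite /mdeg big1 // => a _; rewrite ffunE mulr0n.
Qed.

Definition gdom_one W := GDomSec (gdom_one_subproof W).

Fact gdom_res_subproof (W V : set 'rV[R]_n) k (VW : V `<=` W) (s : gdom_sec W k) :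
  (fun m x => if x \in V then s m x else 0) \in gdom_pred V k.
Proof.
have /asboolP[s1 s2 s3] := gcoefP s.
apply/asboolP; split => [m|m x Vx|m hm].
- apply: (eq_smooth_on _ (smooth_on_sub VW (s1 m))) => x Vx.
  by rewrite mem_set //; exact: interior_subset Vx.
- by rewrite memNset.
- by apply/funext => x; rewrite s3 // if_same.
Qed.

Definition gdom_res W V k VW s := GDomSec (@gdom_res_subproof W V k VW s).

End GradedDomain.

(* The data of a space with a presheaf of Z-graded R-algebras: [gsec U i] is the
   module of sections of degree i over U, and [gmul i j k] the component of the
   product from degrees i and j to degree k, which vanishes unless k = i + j.
   The values at sets that are not open carry no information. *)
Record grspace (R : realType) := GrSpace {
  gpt :> topologicalType;
  gsec : set gpt -> int -> lmodType R;
  gmul : forall (U : set gpt) (i j k : int), gsec U i -> gsec U j -> gsec U k;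
  gone : forall U : set gpt, gsec U 0;
  gres : forall (U V : set gpt) (i : int), V `<=` U -> gsec U i -> gsec V i }.

Arguments gmul {R g U i j} k.
Arguments gone {R g} U.
Arguments gres {R g U V i}.

Definition gdom (R : realType) (n : nat) (d : seq int) : grspace R :=
  @GrSpace R 'rV[R]_n (fun W k => gdom_sec d W k) (@gdom_mul R n d)
    (@gdom_one R n d) (@gdom_res R n d).

Record is_gsheaf (R : realType) (M : grspace R) : Prop := IsGSheaf {
  gmulDl : forall U i j k (c : R) (a b : gsec U i) (s : gsec U j), open U ->
    gmul k (c *: a + b) s = c *: gmul k a s + gmul k b s :> @gsec R M U k;
  gmul_deg : forall U i j k (a : @gsec R M U i) (b : gsec U j), open U ->
    k != i + j -> gmul k a b = 0;
  gmulC : forall U i j k (a : @gsec R M U i) (b : gsec U j), open U ->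
    gmul k a b = ksign R i j *: gmul k b a;
  gmulA : forall U i j l k (a : @gsec R M U i) (b : gsec U j) (c : gsec U l),
    open U -> gmul k a (gmul (j + l) b c) = gmul k (gmul (i + j) a b) c;
  gmul1 : forall U i (a : @gsec R M U i), open U -> gmul i (gone U) a = a;
  gresL : forall U V i (VU : V `<=` U) (c : R) (a b : @gsec R M U i),
    open U -> open V -> gres VU (c *: a + b) = c *: gres VU a + gres VU b;
  gresM : forall U V i j k (VU : V `<=` U) (a : @gsec R M U i) (b : gsec U j),
    open U -> open V -> gres VU (gmul k a b) = gmul k (gres VU a) (gres VU b);
  gres1 : forall U V (VU : V `<=` U), open U -> open V ->
    gres VU (gone U) = gone V :> @gsec R M V 0;
  gres_id : forall U i (UU : U `<=` U) (a : @gsec R M U i), open U ->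
    gres UU a = a;
  gres_comp : forall U V W i (VU : V `<=` U) (WV : W `<=` V) (WU : W `<=` U)
      (a : @gsec R M U i), open U -> open V -> open W ->
    gres WV (gres VU a) = gres WU a;
  gglue : forall (I : Type) (U : I -> set M) (V : set M) i
      (UV : forall x, U x `<=` V) (s : forall x, gsec (U x) i),
    (forall x, open (U x)) -> V = \bigcup_x U x ->
    (forall x y, gres (@subIsetl _ (U x) (U y)) (s x) =
                 gres (@subIsetr _ (U x) (U y)) (s y)) ->
    exists! t : gsec V i, forall x, gres (UV x) t = s x }.

(* The germ at x of s is a unit of the stalk at x. As stalks are local rings, a
   morphism is local on stalks when it reflects units. *)
Definition germ_unit (R : realType) (M : grspace R) (x : M) (U : set M) (i : int)
    (s : gsec U i) : Prop :=
  exists (W : set M) (WU : W `<=` U) (t : gsec W (- i)),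
    [/\ open W, W x & gmul 0 (gres WU s) t = gone W].

(* h is smooth on U when near each point it is the function of values of a
   section t of degree 0, the value of t at y being the scalar c for which the
   germ of t - c at y is not a unit. *)
Definition smooth_fun (R : realType) (M : grspace R) (U : set M) (h : M -> R) :
    Prop :=
  forall x, U x -> exists (W : set M) (t : gsec W 0),
    [/\ open W, W x, W `<=` U &
        forall y, W y -> ~ germ_unit y (t - h y *: gone W)].

Record gmap (R : realType) (M N : grspace R) := GMap {
  gfun :> M -> N;
  gpull : forall (W : set N) (i : int), gsec W i -> gsec (gfun @^-1` W) i }.

Arguments gpull {R M N} g {W i}.

Record is_lrmap (R : realType) (M N : grspace R) (phi : gmap M N) : Prop :=
  IsLRMap {
  gfun_cont : continuous phi;
  gpullL : forall (W : set N) i (c : R) (a b : gsec W i), open W ->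
    gpull phi (c *: a + b) = c *: gpull phi a + gpull phi b;
  gpullM : forall (W : set N) i j k (a : gsec W i) (b : gsec W j), open W ->
    gpull phi (gmul k a b) = gmul k (gpull phi a) (gpull phi b);
  gpull1 : forall W : set N, open W -> gpull phi (gone W) = gone (phi @^-1` W);
  gpull_res : forall (V W : set N) i (VW : V `<=` W) (a : gsec W i),
    open W -> open V ->
    gpull phi (gres VW a) = gres (preimage_subset VW) (gpull phi a);
  gpull_local : forall (W : set N) i (a : gsec W i) x, open W -> W (phi x) ->
    germ_unit x (gpull phi a) -> germ_unit (phi x) a }.

(* The second condition is the smoothness of the underlying map. *)
Definition gsmooth (R : realType) (M N : grspace R) (phi : gmap M N) : Prop :=
  is_lrmap phi /\ forall (W : set N) (h : N -> R), open W ->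
    smooth_fun W h -> smooth_fun (phi @^-1` W) (h \o phi).

(* Equality of graded maps: the restriction along [sub] only identifies the two
   equal preimages of W. *)
Definition geq (R : realType) (M N : grspace R) (phi psi : gmap M N) : Prop :=
  phi =1 psi /\ forall (W : set N) i (a : gsec W i)
    (sub : psi @^-1` W `<=` phi @^-1` W), open W ->
    gres sub (gpull phi a) = gpull psi a.

Definition gid (R : realType) (M : grspace R) : gmap M M :=
  @GMap R M M id (fun W i a => a).

Definition gcomp (R : realType) (L M N : grspace R) (psi : gmap M N)
    (phi : gmap L M) : gmap L N :=
  @GMap R L N (psi \o phi) (fun W i a => gpull phi (gpull psi a)).

Definition grestr (R : realType) (M : grspace R) (U : set M) : grspace R :=
  @GrSpace R (set_type U) (fun W i => gsec (set_val @` W) i)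
    (fun W i j k => gmul k) (fun W => gone (set_val @` W))
    (fun W V i VW => gres (@image_subset _ _ set_val _ _ VW)).

Definition gincl (R : realType) (M : grspace R) (U : set M) :
    gmap (grestr U) M :=
  @GMap R (grestr U) M set_val
    (fun W i => gres (@image_preimage_subset _ _ set_val W)).

Definition giso (R : realType) (M N : grspace R) : Prop :=
  exists (phi : gmap M N) (psi : gmap N M),
    [/\ is_lrmap phi, is_lrmap psi, geq (gcomp psi phi) (gid M) &
        geq (gcomp phi psi) (gid N)].

Record gmanifold (R : realType) (M : grspace R) : Prop := GManifold {
  gman_sheaf : is_gsheaf M;
  gman_hausdorff : hausdorff_space M;
  gman_countable : @second_countable M;
  gman_chart : forall x : M, exists (U : set M) (n : nat) (d : seq int)
      (V : set (gdom R n d)),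
    [/\ open U, U x, 0 \notin d, open V & giso (grestr U) (grestr V)] }.

Definition is_gprod (R : realType) (M N P : grspace R) (p1 : gmap P M)
    (p2 : gmap P N) : Prop :=
  [/\ gmanifold P, gsmooth p1, gsmooth p2 &
    forall (Q : grspace R) (f : gmap Q M) (g : gmap Q N),
      gmanifold Q -> gsmooth f -> gsmooth g ->
      exists h : gmap Q P,
        [/\ gsmooth h, geq (gcomp p1 h) f, geq (gcomp p2 h) g &
          forall h' : gmap Q P, gsmooth h' -> geq (gcomp p1 h') f ->
            geq (gcomp p2 h') g -> geq h' h]].

Record gprod (R : realType) (M N : grspace R) := GProd {
  pobj :> grspace R;
  pfst : gmap pobj M;
  psnd : gmap pobj N;
  pobjP : is_gprod pfst psnd }.

Arguments pfst {R M N} g.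
Arguments psnd {R M N} g.

(* Vector fields, on global sections: X i j is the component of X from degree i to
   degree j, which vanishes unless j = i + |X|. *)
Definition gfield (R : realType) (M : grspace R) :=
  forall i j : int, @gsec R M setT i -> @gsec R M setT j.

Record is_gfield (R : realType) (M : grspace R) (d : int) (X : gfield M) : Prop :=
  IsGField {
  gfieldL : forall i j (c : R) (a b : gsec setT i),
    X i j (c *: a + b) = c *: X i j a + X i j b;
  gfield_deg : forall i j (a : gsec setT i), j != i + d -> X i j a = 0;
  gfieldM : forall i j k (a : gsec setT i) (b : gsec setT j),
    X (i + j) k (gmul (i + j) a b) =
    gmul k (X i (i + d) a) b + ksign R d i *: gmul k a (X j (j + d) b) }.

Definition gbracket (R : realType) (M : grspace R) (d e : int) (X Y : gfield M) :
    gfield M :=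
  fun i j a => X (i + e) j (Y i (i + e) a) -
    ksign R d e *: Y (i + d) j (X i (i + d) a).

Definition gfield0 (R : realType) (M : grspace R) : gfield M := fun i j a => 0.

Arguments gfield0 {R} M i j a.

Definition grelated (R : realType) (M N : grspace R) (phi : gmap M N)
    (X : gfield M) (Y : gfield N) : Prop :=
  forall i j (a : @gsec R N setT i),
    X i j (@gpull R M N phi setT i a) = @gpull R M N phi setT j (Y i j a).

Definition gpoint (R : realType) : grspace R := gdom R 0 [::].

(* R[-k]: one coordinate of degree -k, on the line when k = 0 and on the point
   'rV_0 otherwise. *)
Definition gline (R : realType) (k : int) : grspace R :=
  gdom R (k == 0) (if k == 0 then [::] else [:: - k]).

Fact gline_coord_subproof (R : realType) (k : int) :
  (fun m (x : 'rV[R]_(k == 0)) =>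
     if k == 0 then \sum_i x 0 i else (m == [ffun => 1%N])%:R)
    \in @gdom_pred R (k == 0) (if k == 0 then [::] else [:: - k]) setT (- k).
Proof.
have := erefl (k == 0); case: {-1}(k == 0) => k0; apply/asboolP.
  split=> [m|m x /(_ I)//|m /negP[]].
    by apply: smooth_on_sum => i; exact: smooth_on_coord.
  apply/andP; split; first by apply/forallP => -[].
  by rewrite /mdeg big_ord0 (eqP k0) oppr0.
split=> [m|m x /(_ I)//|m]; first exact: smooth_on_cst.
case: (m =P [ffun => 1%N]) => [->|_ _]; last by apply/funext.
move=> /negP[]; apply/andP; split.
  by apply/forallP => a; rewrite ffunE implybT.
by rewrite /mdeg big_ord1 ffunE.
Qed.

(* The global coordinate. *)
Definition gline_coord (R : realType) (k : int) :
    @gsec R (gline R k) setT (- k) :=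
  GDomSec (gline_coord_subproof R k).

Definition is_zero_map (R : realType) (M : grspace R) (k : int)
    (z : gmap M (gline R k)) : Prop :=
  exists (b : gmap M (gpoint R)) (o : gmap (gpoint R) (gline R k)),
    [/\ gsmooth b, gsmooth o,
        @gpull R _ _ o setT _ (gline_coord R k) = 0 & geq z (gcomp o b)].

Definition is_plus (R : realType) (k : int) (TT : gprod (gline R k) (gline R k))
    (p : gmap TT (gline R k)) : Prop :=
  gsmooth p /\ @gpull R _ _ p setT _ (gline_coord R k) =
    @gpull R _ _ (pfst TT) setT _ (gline_coord R k) +
    @gpull R _ _ (psnd TT) setT _ (gline_coord R k).

(* For k <> 0 the only t is the origin of 'rV_0, and D is all of M x {0}. *)
Definition flow_domain (R : realType) (M : grspace R) (k : int)
    (D : set (M * gline R k)) : Prop :=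
  if k == 0 then
    open D /\ forall m : M,
      let I := [set t : R | D (m, const_mx t)] in
      [/\ open I, is_interval I & I 0]
  else D = setT.

(* P is M x R[-k], P2 is (M x R[-k]) x R[-k] and TT is R[-k] x R[-k]. *)
Section Flow.
Variables (R : realType) (M : grspace R) (k : int).
Let T := gline R k.
Variables (P : gprod M T) (P2 : gprod P T) (TT : gprod T T).

Definition gflow_dom (D : set (M * T)) : set P :=
  [set z | D (pfst P z, psnd P z)].

Definition gflow_dom2 (D : set (M * T)) (theta : gmap (grestr (gflow_dom D)) M) :
    set P2 :=
  [set z | exists w : gflow_dom D, [/\ set_val w = pfst P2 z,
      D (theta w, psnd P2 z) &
      D (pfst P (pfst P2 z), (psnd P (pfst P2 z) + psnd P2 z : 'rV[R]_(k == 0)))]].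

(* h = (f, g) as a map to the restriction of M x R[-k] to U. *)
Definition gpair_of (Q : grspace R) (U : set P) (h : gmap Q (grestr U))
    (f : gmap Q M) (g : gmap Q T) : Prop :=
  [/\ gsmooth h, geq (gcomp (pfst P) (gcomp (gincl U) h)) f &
      geq (gcomp (psnd P) (gcomp (gincl U) h)) g].

(* In gflowD, a is the first projection of the domain of the composites, b is
   theta x 1, that is (theta o a, t_2), and c is (1 x +) o associator, that is
   (m, t_1 + t_2), where m, t_1, t_2 denote the three projections. *)
Record is_gflow (D : set (M * T)) (theta : gmap (grestr (gflow_dom D)) M) :
    Prop := IsGFlow {
  gflow_domP : flow_domain D;
  gflow_smooth : gsmooth theta;
  gflow0 : exists (z : gmap M T) (e : gmap M (grestr (gflow_dom D))),
    [/\ is_zero_map z, gpair_of e (gid M) z & geq (gcomp theta e) (gid M)];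
  gflowD : let i2 := gincl (gflow_dom2 theta) in
    exists (a b c : gmap (grestr (gflow_dom2 theta)) (grestr (gflow_dom D)))
      (s : gmap P2 TT) (p : gmap TT T),
    [/\ gsmooth a /\ geq (gcomp (gincl (gflow_dom D)) a) (gcomp (pfst P2) i2),
        gpair_of b (gcomp theta a) (gcomp (psnd P2) i2),
        [/\ gsmooth s, geq (gcomp (pfst TT) s) (gcomp (psnd P) (pfst P2)) &
            geq (gcomp (psnd TT) s) (psnd P2)] /\ is_plus p,
        gpair_of c (gcomp (pfst P) (gcomp (pfst P2) i2)) (gcomp p (gcomp s i2)) &
        geq (gcomp theta b) (gcomp theta c)] }.

(* The coordinate vector field of R[-k]. *)
Definition is_coord_field (dt : gfield T) : Prop :=
  is_gfield k dt /\ dt (- k) 0 (gline_coord R k) = gone setT.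

(* Z = X (x) 1 when Y = 0, and Z = 1 (x) Y when X = 0. *)
Definition is_gfield_lift (X : gfield M) (Y : gfield T) (Z : gfield P) : Prop :=
  [/\ is_gfield k Z, grelated (pfst P) Z X & grelated (psnd P) Z Y].

Definition is_gfield_restr (U : set P) (Z : gfield P) (Z' : gfield (grestr U)) :
    Prop :=
  is_gfield k Z' /\ grelated (gincl U) Z' Z.

Definition is_generator (D : set (M * T)) (theta : gmap (grestr (gflow_dom D)) M)
    (X : gfield M) : Prop :=
  is_gfield k X /\
  exists (dt : gfield T) (Z : gfield P) (Z' : gfield (grestr (gflow_dom D))),
    [/\ is_coord_field dt, is_gfield_lift (gfield0 M) dt Z,
        is_gfield_restr Z Z' & grelated theta Z' X].

(* The last clause is maximality: theta' is the restriction of theta. *)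
Definition is_flow_of (X : gfield M) (D : set (M * T))
    (theta : gmap (grestr (gflow_dom D)) M) : Prop :=
  [/\ is_gflow theta, is_generator theta X &
    forall (D' : set (M * T)) (theta' : gmap (grestr (gflow_dom D')) M),
      is_gflow theta' -> is_generator theta' X ->
      exists j : gmap (grestr (gflow_dom D')) (grestr (gflow_dom D)),
        [/\ gsmooth j,
            geq (gcomp (gincl (gflow_dom D)) j) (gincl (gflow_dom D')) &
            geq theta' (gcomp theta j)]].

End Flow.

Arguments gflow_dom {R M k} P D.

(* Main.v *)
Require Import Defs.
From HB Require Import structures.
From mathcomp Require Import all_boot all_order all_algebra.
From mathcomp Require Import zify ring lra.
From mathcomp Require Import all_classical reals topology normedtype derive.
From mathcomp Require Import sequences realfun exp.
Set Implicit Arguments.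
Unset Strict Implicit.
Unset Printing Implicit Defensive.
Import Order.TTheory GRing.Theory Num.Theory numFieldNormedType.Exports.
Local Open Scope classical_set_scope.
Local Open Scope ring_scope.

(** Write [|X| = k].  Let [Q[eta]] be the thickening of a graded manifold [Q] by
    one variable [eta] of odd degree [- (k + w)], and let [om] be a section of
    degree [w] on [Q], so that [eps = eta om] has degree [- k] and square zero.
    For [phi : Q -> N] and a field [Y] of degree [k] on [N], the map
    [f |-> phi^* f + eps phi^* (Y f)] is a graded map [Q[eta] -> N], denoted
    [phi + eps Y] below.  Let [N] be the flow domain and [pi : Q -> N].

    Composing the group law [theta o (theta x 1) = theta o (1 x +)] with the map
    [(m, t) |-> ((m, eps), t)], the argument [(theta (m, eps), t)] on the left
    has the components of [pi + eps (X (x) 1)], since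
    [theta (m, eps) = m + eps X] by the generator condition; the argument
    [(m, eps + t)] on the right has the components of [pi + eps (1 (x) d/dt)].
    By the uniqueness in the universal property of the product the arguments are
    equal to these maps, whence
    [eps pi^* (X (x) 1) theta^* = eps pi^* (1 (x) d/dt) theta^* = eps pi^* theta^* X].
    Multiplication by [eps] can be cancelled: for odd [k] take [Q = N] and
    [om = 1], for even [k] take [Q = N[eta']] with [om = eta'].

    This needs that vector fields localise (bump functions), that [Q[eta]] is a
    graded manifold, and that a map to [R[-k]] is determined by the pullback of
    the coordinate.  The last point follows from Hadamard's lemma
    [f = c + (t - c0) r] by induction on the order of vanishing of the
    difference of two pullbacks. *)

(* [geq] of ssrnat shadows the equality of graded maps. *)
Local Notation geq := Defs.geq.

#[local] Hint Extern 0 (open setT) => exact: openT : core.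
#[local] Hint Extern 0 (open (_ `&` _)) => apply: openI : core.

(** * Restrictions, presheaves and maps *)

(** The product is known only by its universal property, which tests against graded manifolds. This
    shapes the proof in two ways. For even [k], the dual numbers that would differentiate the group
    law at time [0] are not a graded manifold, because a free even variable is not nilpotent. On a
    graded manifold, a square-zero element of even degree is available as the product [eta om] of
    two odd ones; for odd [k] the single odd variable [eta] already does. Secondly, there is no
    formula for the sections of the product: the lifts [X (x) 1] and [1 (x) d/dt] are accessible
    only through their relations along the two projections, so each map into the flow domain has to
    be recognised from its two components.

    The generator condition is used at two places: along the section [t = 0], to evaluate [theta] at
    [(m, eps)], and along [pi], to evaluate it at [(m, eps + t)]. The infinitesimal time is the
    inner one in the group law, so that the outer time can remain arbitrary. *)

Definition rs (R : realType) (M : grspace R) (V U : set M) i (s : gsec U i) :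
    gsec V i :=
  if pselect (V `<=` U) is left h then gres h s else 0.
Arguments rs {R M} V {U i} s.

(** The inclusion is a proof argument of [gres], so restrictions along different proofs do not match
    syntactically. [rs] decides the inclusion instead, with the junk value [0] when it fails. *)
Lemma gresE (R : realType) (M : grspace R) (U V : set M) i (VU : V `<=` U)
  (s : gsec U i) : gres VU s = rs V s.
Proof.
by rewrite /rs; case: pselect => // h; rewrite (Prop_irrelevance VU h).
Qed.

Lemma open_pre (S T : topologicalType) (f : S -> T) (W : set T) :
  continuous f -> open W -> open (f @^-1` W).
Proof. by move=> /continuousP; exact. Qed.

Lemma ksignDl (R : realType) (i j l : int) :
  ksign R (i + j) l = ksign R i l * ksign R j l.
Proof.
rewrite /ksign -signr_addb; congr (_ ^+ _); congr nat_of_bool.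
have -> : odd (absz (i + j)) = odd (absz i) (+) odd (absz j).
  by case: i j => m [] n; lia.
by case: (odd (absz i)); case: (odd (absz j)); case: (odd (absz l)).
Qed.

Lemma ksignC (R : realType) (i j : int) : ksign R i j = ksign R j i.
Proof. by rewrite /ksign andbC. Qed.

Lemma ksignDr (R : realType) (i j l : int) :
  ksign R l (i + j) = ksign R l i * ksign R l j.
Proof. by rewrite ksignC ksignDl !(ksignC _ _ l). Qed.

Lemma ksign_sqr (R : realType) (i j : int) : ksign R i j * ksign R i j = 1.
Proof. by rewrite /ksign -signr_addb addbb. Qed.

(* Graded domains are only used as presheaves, which dispenses with proving
   the associativity and the commutativity of their products. *)
Record is_gpre (R : realType) (M : grspace R) : Prop := IsGPre {
  preL : forall U V i (VU : V `<=` U) (c : R) (a b : @gsec R M U i),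
    open U -> open V -> gres VU (c *: a + b) = c *: gres VU a + gres VU b;
  preM : forall U V i j k (VU : V `<=` U) (a : @gsec R M U i) (b : gsec U j),
    open U -> open V -> gres VU (gmul k a b) = gmul k (gres VU a) (gres VU b);
  pre1 : forall U V (VU : V `<=` U), open U -> open V ->
    gres VU (gone U) = gone V :> @gsec R M V 0;
  pre_id : forall U i (UU : U `<=` U) (a : @gsec R M U i), open U ->
    gres UU a = a;
  pre_comp : forall U V W i (VU : V `<=` U) (WV : W `<=` V) (WU : W `<=` U)
      (a : @gsec R M U i), open U -> open V -> open W ->
    gres WV (gres VU a) = gres WU a }.

Lemma gsheaf_pre (R : realType) (M : grspace R) : is_gsheaf M -> is_gpre M.
Proof.
move=> h; split; [exact: gresL|exact: gresM|exact: gres1|exact: gres_id|].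
exact: gres_comp.
Qed.
Coercion gsheaf_pre : is_gsheaf >-> is_gpre.
#[local] Hint Extern 0 (is_gpre _) => (apply: gsheaf_pre; assumption) : core.

Section Presheaf.
Variables (R : realType) (M : grspace R).
Hypothesis hM : is_gpre M.
Implicit Types U V W : set M.

Lemma rs_id U i (s : @gsec R M U i) : open U -> rs U s = s.
Proof. by move=> oU; rewrite -(gresE (@subset_refl _ U)); exact: pre_id. Qed.

Lemma rs_rs U V W i (s : @gsec R M U i) : open U -> open V -> open W ->
  W `<=` V -> V `<=` U -> rs W (rs V s) = rs W s.
Proof.
move=> oU oV oW WV VU; rewrite -(gresE VU) -(gresE WV).
by rewrite -(gresE (subset_trans WV VU)); exact: pre_comp.
Qed.

Lemma rsL U V i (c : R) (a b : @gsec R M U i) : open U -> open V -> V `<=` U ->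
  rs V (c *: a + b) = c *: rs V a + rs V b.
Proof. by move=> oU oV VU; rewrite -!(gresE VU); exact: preL. Qed.

Lemma rsD U V i (a b : @gsec R M U i) : open U -> open V -> V `<=` U ->
  rs V (a + b) = rs V a + rs V b.
Proof. by move=> oU oV VU; rewrite -[a]scale1r rsL // !scale1r. Qed.

Lemma rs0 U V i : open U -> open V -> V `<=` U -> rs V (0 : @gsec R M U i) = 0.
Proof.
move=> oU oV VU; have := rsD (0 : @gsec R M U i) 0 oU oV VU; rewrite addr0 => /eqP.
by rewrite -subr_eq subrr => /eqP <-.
Qed.

Lemma rsZ U V i (c : R) (a : @gsec R M U i) : open U -> open V -> V `<=` U ->
  rs V (c *: a) = c *: rs V a.
Proof. by move=> oU oV VU; rewrite -[c *: a]addr0 rsL // rs0 // addr0. Qed.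

Lemma rsB U V i (a b : @gsec R M U i) : open U -> open V -> V `<=` U ->
  rs V (a - b) = rs V a - rs V b.
Proof. by move=> oU oV VU; rewrite -scaleN1r rsD // rsZ // scaleN1r. Qed.

Lemma rsM U V i j k (a : @gsec R M U i) (b : gsec U j) : open U -> open V ->
  V `<=` U -> rs V (gmul k a b) = gmul k (rs V a) (rs V b).
Proof. by move=> oU oV VU; rewrite -!(gresE VU); exact: preM. Qed.

Lemma rs1 U V : open U -> open V -> V `<=` U -> rs V (gone U) = gone V :> @gsec R M V 0.
Proof. by move=> oU oV VU; rewrite -!(gresE VU); exact: pre1. Qed.

End Presheaf.

Section Sheaf.
Variables (R : realType) (M : grspace R).
Hypothesis hM : is_gsheaf M.
Implicit Types U V W : set M.

Lemma gmulD_l U i j k (a b : @gsec R M U i) (s : gsec U j) : open U ->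
  gmul k (a + b) s = gmul k a s + gmul k b s.
Proof. by move=> oU; rewrite -[a]scale1r gmulDl // !scale1r. Qed.

Lemma gmul0l U i j k (s : @gsec R M U j) : open U ->
  gmul k (0 : @gsec R M U i) s = 0.
Proof.
move=> oU; have := gmulD_l k (0 : @gsec R M U i) 0 s oU.
by rewrite addr0 => /eqP; rewrite -subr_eq subrr => /eqP <-.
Qed.

Lemma gmulZ_l U i j k c (a : @gsec R M U i) (s : gsec U j) : open U ->
  gmul k (c *: a) s = c *: gmul k a s.
Proof. by move=> oU; rewrite -[c *: a]addr0 gmulDl // gmul0l // addr0. Qed.

Lemma gmulD_r U i j k (a b : @gsec R M U i) (s : gsec U j) : open U ->
  gmul k s (a + b) = gmul k s a + gmul k s b.
Proof.
by move=> oU; rewrite (gmulC hM) // gmulD_l // scalerDr -!(gmulC hM).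
Qed.

Lemma gmul0r U i j k (s : @gsec R M U j) : open U ->
  gmul k s (0 : @gsec R M U i) = 0.
Proof. by move=> oU; rewrite (gmulC hM) // gmul0l // scaler0. Qed.

Lemma gmulZ_r U i j k c (a : @gsec R M U i) (s : gsec U j) : open U ->
  gmul k s (c *: a) = c *: gmul k s a.
Proof.
by move=> oU; rewrite (gmulC hM) // gmulZ_l // scalerA mulrC -scalerA -(gmulC hM).
Qed.

(* With the intermediate degrees free, as [j + l] and [i + j] are in general
   only propositionally equal to the degrees at hand. *)
Lemma gmulA' U i j l p q k (a : @gsec R M U i) (b : gsec U j) (c : gsec U l) :
  open U -> p = j + l -> q = i + j ->
  gmul k a (gmul p b c) = gmul k (gmul q a b) c.
Proof. by move=> oU -> ->; exact: gmulA. Qed.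

Lemma gmul1l U i (a : @gsec R M U i) : open U -> gmul i (gone U) a = a.
Proof. exact: gmul1. Qed.

Lemma gmul1r U i (a : @gsec R M U i) : open U -> gmul i a (gone U) = a.
Proof. by move=> oU; rewrite (gmulC hM) // gmul1l // /ksign andbF scale1r. Qed.

Lemma glue (I : Type) (U : I -> set M) V i (s : forall x, @gsec R M (U x) i) :
  (forall x, open (U x)) -> V = \bigcup_x U x ->
  (forall x y, rs (U x `&` U y) (s x) = rs (U x `&` U y) (s y)) ->
  exists t : gsec V i, forall x, rs (U x) t = s x.
Proof.
move=> oU VE h; have UV x : U x `<=` V by rewrite VE => y Uy; exists x.
case: (@gglue R M hM I U V i UV s oU VE).
  by move=> x y; rewrite !gresE.
by move=> t [ht _]; exists t => x; rewrite -(gresE (UV x)).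
Qed.

(** Both sections glue the family of restrictions of [s] to the chosen neighbourhoods, so the
    uniqueness clause of gluing identifies them. *)
Lemma gsec_eq U i (s t : @gsec R M U i) : open U ->
  (forall x, U x -> exists V, [/\ open V, V x, V `<=` U & rs V s = rs V t]) ->
  s = t.
Proof.
move=> oU h.
have [V hV] : exists V : {x | U x} -> set M, forall x, [/\ open (V x),
    V x (sval x), V x `<=` U & rs (V x) s = rs (V x) t].
  have /choice[V hV] : forall x : {x | U x}, exists V, [/\ open V, V (sval x),
      V `<=` U & rs V s = rs V t] by case=> x Ux; exact: h.
  by exists V.
have VU x : V x `<=` U by have [] := hV x.
have oV x : open (V x) by have [] := hV x.
have UE : U = \bigcup_x V x.
  rewrite eqEsubset; split=> [y Uy|y [x _ /VU//]].
  by exists (exist _ y Uy) => //; have [] := hV (exist _ y Uy).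
case: (@gglue R M hM _ V U i VU (fun x => rs (V x) s) oV UE).
  by move=> x y; rewrite !gresE !rs_rs //;
    do ?[exact: openI|exact: subIsetl|exact: subIsetr].
move=> r [_ hr]; rewrite -(hr s) ?(hr t) // => x; rewrite gresE //.
by have [] := hV x.
Qed.

End Sheaf.

(** A morphism without locality on stalks. Locality is kept apart because isomorphisms have it for
    free and maps out of a thickening get it from their reduction. *)
Record is_premap (R : realType) (M N : grspace R) (phi : gmap M N) : Prop :=
  IsPreMap {
  pre_cont : continuous phi;
  prepullL : forall (W : set N) i (c : R) (a b : gsec W i), open W ->
    gpull phi (c *: a + b) = c *: gpull phi a + gpull phi b;
  prepullM : forall (W : set N) i j k (a : gsec W i) (b : gsec W j), open W ->
    gpull phi (gmul k a b) = gmul k (gpull phi a) (gpull phi b);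
  prepull1 : forall W : set N, open W -> gpull phi (gone W) = gone (phi @^-1` W);
  prepull_rs : forall (V W : set N) i (a : gsec W i),
    open W -> open V -> V `<=` W ->
    gpull phi (rs V a) = rs (phi @^-1` V) (gpull phi a) }.

Section Maps.
Variable R : realType.
Implicit Types L M N Q : grspace R.

Lemma lrmap_premap M N (phi : gmap M N) : is_lrmap phi -> is_premap phi.
Proof.
case=> h1 h2 h3 h4 h5 _; split=> // V W i a oW oV VW.
by rewrite -(gresE VW) h5 // gresE.
Qed.

Lemma premap_lrmap M N (phi : gmap M N) : is_premap phi ->
  (forall (W : set N) i (a : gsec W i) x, open W -> W (phi x) ->
    germ_unit x (gpull phi a) -> germ_unit (phi x) a) -> is_lrmap phi.
Proof.
case=> h1 h2 h3 h4 h5 h6; split=> // V W i VW a oW oV.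
by rewrite !gresE h5.
Qed.

Section Pull.
Variables (M N : grspace R) (phi : gmap M N).
Hypothesis hp : is_premap phi.

Lemma pre_open (W : set N) : open W -> open (phi @^-1` W).
Proof. exact/open_pre/pre_cont. Qed.

Lemma pullD (W : set N) i (a b : gsec W i) : open W ->
  gpull phi (a + b) = gpull phi a + gpull phi b.
Proof. by move=> oW; rewrite -[a]scale1r prepullL // !scale1r. Qed.

Lemma pull0 (W : set N) i : open W -> gpull phi (0 : gsec W i) = 0.
Proof.
move=> oW; have := pullD 0 (0 : gsec W i) oW; rewrite addr0 => /eqP.
by rewrite -subr_eq subrr => /eqP <-.
Qed.

Lemma pullZ (W : set N) i c (a : gsec W i) : open W ->
  gpull phi (c *: a) = c *: gpull phi a.
Proof. by move=> oW; rewrite -[c *: a]addr0 prepullL // pull0 // addr0. Qed.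

Lemma pullB (W : set N) i (a b : gsec W i) : open W ->
  gpull phi (a - b) = gpull phi a - gpull phi b.
Proof. by move=> oW; rewrite -scaleN1r pullD // pullZ // scaleN1r. Qed.

End Pull.

Lemma geqP M N (phi psi : gmap M N) : geq phi psi <-> phi =1 psi /\
  forall (W : set N) i (a : gsec W i), open W ->
    rs (psi @^-1` W) (gpull phi a) = gpull psi a.
Proof.
split=> -[h1 h2]; split=> // W i a.
  move=> oW.
  have sub : psi @^-1` W `<=` phi @^-1` W by move=> x; rewrite /preimage /= h1.
  by rewrite -(gresE sub); exact: h2.
by move=> sub oW; rewrite gresE; exact: h2.
Qed.

Lemma eq_pre M N (phi psi : gmap M N) (W : set N) : phi =1 psi ->
  phi @^-1` W = psi @^-1` W.
Proof. by move=> h; apply/funext => x; rewrite /preimage /= h. Qed.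

Lemma geq_rfl M N (phi : gmap M N) : is_gpre M -> is_premap phi ->
  geq phi phi.
Proof.
by move=> hM hp; apply/geqP; split=> // W i a oW; rewrite rs_id //; exact: pre_open.
Qed.

Lemma geq_s M N (phi psi : gmap M N) : is_gpre M -> is_premap phi ->
  geq phi psi -> geq psi phi.
Proof.
move=> hM hp /geqP[h1 h2]; apply/geqP; split=> [x //|W i a oW].
have o1 := pre_open hp oW.
have o2 : open (psi @^-1` W) by rewrite -(eq_pre W h1).
rewrite -h2 // rs_rs ?rs_id // (eq_pre W h1); exact: subset_refl.
Qed.

Lemma geq_t M N (phi psi chi : gmap M N) : is_gpre M -> is_premap phi ->
  geq phi psi -> geq psi chi -> geq phi chi.
Proof.
move=> hM hp /geqP[h1 h2] /geqP[h3 h4]; apply/geqP.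
split=> [x|W i a oW]; first by rewrite h1.
have o1 := pre_open hp oW.
have o2 : open (psi @^-1` W) by rewrite -(eq_pre W h1).
have o3 : open (chi @^-1` W) by rewrite -(eq_pre W h3).
rewrite -h4 // -h2 // rs_rs // ?(eq_pre W h1) ?(eq_pre W h3); exact: subset_refl.
Qed.

Lemma comp_premap L M N (psi : gmap M N) (phi : gmap L M) :
  is_premap phi -> is_premap psi -> is_premap (gcomp psi phi).
Proof.
move=> hp hq; have cq := pre_open hq.
split=> /=.
- by move=> x; apply: continuous_comp; [exact: (pre_cont hp)|exact: (pre_cont hq)].
- by move=> W i c a b oW; rewrite (prepullL hq) // (prepullL hp) //; exact: cq.
- by move=> W i j k a b oW; rewrite (prepullM hq) // (prepullM hp) //; exact: cq.
- by move=> W oW; rewrite (prepull1 hq) // (prepull1 hp) //; exact: cq.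
- move=> V W i a oW oV VW; rewrite (prepull_rs hq) // (prepull_rs hp) //.
  + exact: cq.
  + exact: cq.
  + exact: preimage_subset.
Qed.

Lemma comp_lrmap L M N (psi : gmap M N) (phi : gmap L M) :
  is_lrmap phi -> is_lrmap psi -> is_lrmap (gcomp psi phi).
Proof.
move=> hp hq; have pq := lrmap_premap hq.
apply: premap_lrmap; first exact/comp_premap/pq/lrmap_premap.
move=> W i a x oW Wx /= u; apply: (gpull_local hq) => //.
by apply: (gpull_local hp) => //; exact: pre_open.
Qed.

(** If [h] takes the values of [t], then [h \o phi] takes those of the pullback of [t]: by locality
    a unit germ of the pullback of [t - h y] would come from a unit germ of [t - h y] itself. *)
Lemma lrmap_gsmooth M N (phi : gmap M N) : is_lrmap phi -> gsmooth phi.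
Proof.
move=> hp; split=> // W h oW hh x Wx; have pp := lrmap_premap hp.
have [V [t [oV Vx VW ht]]] := hh _ Wx.
exists (phi @^-1` V), (gpull phi t); split=> //.
- exact: pre_open.
- exact: preimage_subset.
move=> y Vy u; apply: (ht _ Vy); apply: (gpull_local hp) => //.
by rewrite pullB // pullZ // prepull1.
Qed.

Lemma geq_compr L M N (psi : gmap M N) (phi chi : gmap L M) :
  is_premap psi -> geq phi chi -> geq (gcomp psi phi) (gcomp psi chi).
Proof.
move=> hp /geqP[h1 h2]; apply/geqP; split=> [x|W i a oW] /=; first by rewrite h1.
by rewrite -h2 //; exact: pre_open.
Qed.

Lemma geq_compl L M N (psi chi : gmap M N) (phi : gmap L M) :
  is_premap phi -> is_premap psi -> geq psi chi ->
  geq (gcomp psi phi) (gcomp chi phi).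
Proof.
move=> hp hq /geqP[h1 h2]; apply/geqP; split=> [x|W i a oW] /=; first by rewrite h1.
have o1 := pre_open hq oW.
have o2 : open (chi @^-1` W) by rewrite -(eq_pre W h1).
rewrite -h2 // (prepull_rs hp) //  (eq_pre W h1); exact: subset_refl.
Qed.

Lemma gid_lrmap M : is_gpre M -> is_lrmap (gid M).
Proof.
move=> hM; apply: premap_lrmap => //; split=> //=.
by move=> x; exact: cvg_id.
Qed.

(** Pulling an inverse of the germ of [gpull phi a] back along [psi] gives an inverse of the germ of
    [a], so locality is automatic. *)
Lemma iso_lrmap M N (phi : gmap M N) (psi : gmap N M) :
  is_gpre M -> is_gpre N ->
  is_premap phi -> is_premap psi -> geq (gcomp psi phi) (gid M) ->
  geq (gcomp phi psi) (gid N) -> is_lrmap phi.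
Proof.
move=> hM hN hp hq /geqP[h1 h2] /geqP[h3 h4].
apply: premap_lrmap => // W i a x oW Wx [V [VW [t [oV Vx e]]]].
have oV' := pre_open hq oV; have oW' := pre_open hp oW.
have VW' : psi @^-1` V `<=` W by move=> y /VW; rewrite /preimage /= [phi _](h3 y).
exists (psi @^-1` V), VW', (gpull psi t); split=> //.
  by rewrite /preimage /= [psi _]h1.
rewrite -(prepull1 hq) // -e (prepullM hq) // !gresE (prepull_rs hq) //.
have e2 : rs W (gpull psi (gpull phi a)) = a := h4 _ _ a oW.
congr gmul; rewrite -[in LHS]e2 rs_rs //; first exact: (pre_open hq oW').
by move=> y Wy; rewrite /preimage /= [phi _](h3 y).
Qed.

End Maps.

(** * Open subspaces *)

Section Restrict.
Variables (R : realType) (M : grspace R) (U : set M).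
Hypothesis oU : open U.

Local Notation im W := ((set_val : set_type U -> M) @` W).
Local Notation pim W := ((set_val : set_type U -> M) @^-1` W).

Lemma val_inj_set : injective (set_val : set_type U -> M).
Proof. exact: val_inj. Qed.

Lemma set_val_mem (x : set_type U) : U (set_val x).
Proof. by case: x => x h; exact: set_mem h. Qed.

Lemma im_pim (W : set M) : im (pim W) = U `&` W.
Proof.
rewrite eqEsubset; split=> [x [y Wy <-]|x [Ux Wx]].
  by split=> //; exact: set_val_mem.
by exists (exist _ x (mem_set Ux)).
Qed.

Lemma pim_im (W : set (set_type U)) : pim (im W) = W.
Proof.
rewrite eqEsubset; split=> [x [y Wy /val_inj_set <-]//|x Wx]; by exists x.
Qed.

Lemma open_im (W : set (set_type U)) : open W -> open (im W).
Proof. by move=> [A oA <-]; rewrite im_pim; exact: openI. Qed.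

Lemma open_pim (W : set M) : open W -> open (pim W).
Proof. by move=> oW; exists W. Qed.

Lemma im_sub (V W : set (set_type U)) : V `<=` W -> im V `<=` im W.
Proof. exact: image_subset. Qed.

Lemma imI (V W : set (set_type U)) : im (V `&` W) = im V `&` im W.
Proof.
rewrite eqEsubset; split=> [x [y [Vy Wy] <-]|]; first by split; exists y.
by move=> _ [[y Vy <-] [z Wz /val_inj_set zy]]; exists y => //; split=> //; rewrite -zy.
Qed.

Lemma rs_grestr (V W : set (grestr U)) i (s : @gsec R (grestr U) W i) :
  V `<=` W -> rs V s = rs (im V) (s : @gsec R M (im W) i).
Proof. by move=> VW; rewrite -(gresE VW) /= gresE. Qed.

Lemma grestr_sheaf : is_gsheaf M -> is_gsheaf (grestr U).
Proof.
move=> hM; split=> /=.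
- by move=> W i j k c a b s /open_im oW; exact: gmulDl.
- by move=> W i j k a b /open_im oW; exact: gmul_deg.
- by move=> W i j k a b /open_im oW; exact: gmulC.
- by move=> W i j l k a b c /open_im oW; exact: gmulA.
- by move=> W i a /open_im oW; exact: gmul1.
- by move=> W V i VW c a b /open_im oW /open_im oV; exact: gresL.
- by move=> W V i j k VW a b /open_im oW /open_im oV; exact: gresM.
- by move=> W V VW /open_im oW /open_im oV; exact: gres1.
- by move=> W i WW a /open_im oW; exact: gres_id.
- move=> W V V' i VW V'V V'W a /open_im oW /open_im oV /open_im oV'.
  exact: gres_comp.
move=> I W V i WV s oW VE h.
have VE' : im V = \bigcup_x im (W x) by rewrite VE image_bigcup.
have [|x y|t ht] := @glue R M hM I (fun x => im (W x)) _ i s _ VE'.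
- by move=> x; apply/open_im/oW.
- by have := h x y; rewrite !gresE imI.
have oV : open V by rewrite VE; exact: bigcup_open.
exists t; split=> [x|t' ht']; first by rewrite gresE ht.
apply: (gsec_eq hM) => [|x]; first exact: open_im.
move=> Vx; have [y _ Wx] : (\bigcup_x im (W x)) x by rewrite -VE'.
exists (im (W y)); split=> //.
- exact/open_im/oW.
- exact/im_sub/WV.
by rewrite ht -(ht' y) gresE.
Qed.

Lemma grestr_pre : is_gpre M -> is_gpre (grestr U).
Proof.
move=> hM; split=> /=.
- by move=> W V i VW c a b /open_im oW /open_im oV; exact: preL.
- by move=> W V i j k VW a b /open_im oW /open_im oV; exact: preM.
- by move=> W V VW /open_im oW /open_im oV; exact: pre1.
- by move=> W i WW a /open_im oW; exact: pre_id.
move=> W V V' i VW V'V V'W a /open_im oW /open_im oV /open_im oV'.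
exact: pre_comp.
Qed.

Hypothesis hM : is_gpre M.

Lemma gincl_lrmap : is_lrmap (gincl U).
Proof.
have hs (W : set M) : im (pim W) `<=` W by rewrite im_pim; exact: subIsetr.
have ho (W : set M) : open W -> open (im (pim W)).
  by move=> oW; exact/open_im/open_pim.
apply: premap_lrmap; first split=> /=.
- exact: initial_continuous.
- by move=> W i c a b oW; rewrite !gresE rsL //; exact: ho.
- by move=> W i j k a b oW; rewrite !gresE rsM //; exact: ho.
- by move=> W oW; rewrite !gresE rs1 //; exact: ho.
- move=> V W i a oW oV VW.
  have VW' : pim V `<=` pim W by exact: preimage_subset.
  rewrite rs_grestr // !gresE !rs_rs //; by [exact: ho|exact: im_sub].
move=> W i a x oW Wx [V [VW [t [oV Vx e]]]].
have VW' : im V `<=` W by apply: subset_trans (hs W); exact: im_sub.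
exists (im V), VW', t; split; [exact: open_im|by exists x|].
rewrite -[gone _]/(@gone R (grestr U) V) -e /= !gresE; congr gmul.
by rewrite rs_rs //; [exact: ho|exact: open_im|exact: im_sub].
Qed.

Section Lift.
Variables (Q : grspace R) (f : gmap Q M).
Hypothesis hU : forall q, U (f q).

Definition glift_fun (q : Q) : set_type U := exist _ (f q) (mem_set (hU q)).

Lemma glift_pre (W : set (set_type U)) : f @^-1` (im W) = glift_fun @^-1` W.
Proof.
rewrite eqEsubset; split=> [q [y Wy e]|q Wq]; last by exists (glift_fun q).
by rewrite /preimage /= (_ : glift_fun q = y) //; exact: val_inj_set.
Qed.

(** The preimages of [W] and of its image in [M] agree only up to a proof of equality, whence the
    outer restriction. *)
Definition glift : gmap Q (grestr U) :=
  @GMap R Q (grestr U) glift_fun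
    (fun W i a => rs (glift_fun @^-1` W) (gpull f (a : @gsec R M (im W) i))).

Hypotheses (hQ : is_gpre Q) (hf : is_lrmap f).

Lemma glift_premap : is_premap glift.
Proof.
have pf := lrmap_premap hf.
have ho (W : set (set_type U)) : open W -> open (glift_fun @^-1` W).
  by rewrite -glift_pre => /open_im; exact: pre_open.
have ho' (W : set (set_type U)) : open W -> open (f @^-1` im W).
  by move=> /open_im; exact: pre_open.
have hs (W : set (set_type U)) : glift_fun @^-1` W `<=` f @^-1` im W.
  by rewrite glift_pre.
split=> /=.
- apply: continuous_comp_initial => x; exact: (pre_cont pf).
- move=> W i c a b oW; rewrite (prepullL pf) ?rsL //; by [exact: open_im|exact: ho|exact: ho'].
- move=> W i j k a b oW; rewrite (prepullM pf) ?rsM //;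
    by [exact: open_im|exact: ho|exact: ho'].
- move=> W oW; rewrite (prepull1 pf) ?rs1 //; by [exact: open_im|exact: ho|exact: ho'].
- move=> V W i a oW oV VW.
  have VW' : glift_fun @^-1` V `<=` glift_fun @^-1` W by exact: preimage_subset.
  have iVW := im_sub VW.
  rewrite rs_grestr // (prepull_rs pf) //; [|exact: open_im..].
  rewrite !rs_rs //; try by [exact: ho|exact: ho'].
  exact: preimage_subset.
Qed.

(** The unit germ supplied by the locality of [f] lives on an open set [B] of [M] inside the image
    of [W]; it is moved to the corresponding open set of the subspace, whose image is [B] again. *)
Lemma glift_lrmap : is_lrmap glift.
Proof.
have pf := lrmap_premap hf.
apply: premap_lrmap; first exact: glift_premap.
move=> W i a x oW Wx [V [VW [t [oV Vx e]]]].
have VW' : V `<=` f @^-1` im W by rewrite glift_pre.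
have : germ_unit x (gpull f (a : @gsec R M (im W) i)).
  exists V, VW', t; split=> //; rewrite -e /= !gresE; congr gmul.
  rewrite rs_rs //; [exact/pre_open/open_im| |by rewrite glift_pre].
  by rewrite -glift_pre; exact/pre_open/open_im.
move=> unit_fa.
have iWx : (im W) (f x) by exists (glift_fun x).
have [B [BW [u [oB Bx e']]]] := gpull_local hf (open_im oW) iWx unit_fa.
have BE : im (pim B) = B.
  rewrite im_pim; apply/setIidPr => y /BW[z _ <-]; exact: set_val_mem.
have BW' : pim B `<=` W by rewrite -[W]pim_im; exact: preimage_subset.
exists (pim B), BW', (rs (im (pim B)) u); split=> //=; first exact: open_pim.
have iBB : im (pim B) `<=` B by rewrite BE.
have oiB : open (im (pim B)) by rewrite BE.
rewrite -(rs1 hM oB oiB) // -e' rsM // !gresE rs_rs //.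
exact: open_im.
Qed.

Lemma glift_incl : geq (gcomp (gincl U) glift) f.
Proof.
have pf := lrmap_premap hf.
apply/geqP; split=> // W i a oW /=.
have oW' : open (f @^-1` W) by exact: pre_open.
have hs : im (pim W) `<=` W by rewrite im_pim; exact: subIsetr.
rewrite gresE (prepull_rs pf) //; last exact/open_im/open_pim.
have e : f @^-1` (im (pim W)) = f @^-1` W.
  by rewrite im_pim preimage_setI; apply/setIidPr => q _; exact: hU.
have o1 : open (f @^-1` (im (pim W))) by rewrite e.
transitivity (rs (f @^-1` W) (rs (f @^-1` W)
  (rs (f @^-1` im (pim W)) (gpull f a)))) => //.
have s1 : f @^-1` W `<=` f @^-1` im (pim W) by rewrite e.
have s2 : f @^-1` im (pim W) `<=` f @^-1` W by rewrite e.
by rewrite !(rs_rs hQ) ?(rs_id hQ).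
Qed.

End Lift.

(** A section over [W] in the subspace is a section of [M] over the image of [W], hence itself a
    pullback along the inclusion, and on pullbacks the two maps agree. *)
Lemma gincl_mono (Q : grspace R) (f g : gmap Q (grestr U)) : is_gpre Q ->
  is_premap f -> is_premap g ->
  geq (gcomp (gincl U) f) (gcomp (gincl U) g) -> geq f g.
Proof.
move=> hQ hf hg /geqP[h1 h2].
have fg : f =1 g by move=> q; apply: val_inj_set; exact: h1.
apply/geqP; split=> // W i a oW; have oiW := open_im oW.
have := h2 _ i (a : @gsec R M (im W) i) oiW; rewrite /= !gresE.
have sW : pim (im W) `<=` W by rewrite pim_im.
have opW : open (pim (im W)) by rewrite pim_im.
rewrite -(rs_grestr a sW).
rewrite (prepull_rs hf) // (prepull_rs hg) //.
have ofW := pre_open hf oW; have ogW := pre_open hg oW.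
have oif := pre_open hf opW; have oig := pre_open hg opW.
have e1 : f @^-1` W = g @^-1` W by exact: eq_pre.
have e2 : f @^-1` (pim (im W)) = f @^-1` W by rewrite pim_im.
have e3 : g @^-1` (pim (im W)) = g @^-1` W by rewrite pim_im.
have e4 : (set_val \o g) @^-1` (im W) = g @^-1` W by exact: e3.
have e5 : (set_val \o f) @^-1` (im W) = g @^-1` W by rewrite -e1 -[RHS]e2.
move=> /(congr1 (rs (g @^-1` W))).
by rewrite !(rs_rs hQ) ?(rs_id hQ) // ?e4 ?e5 ?e1 ?e2 ?e3 ?e4.
Qed.

End Restrict.

Section LRCat.
Variable R : realType.
Implicit Types L M N Q : grspace R.

Lemma geqR M N (phi : gmap M N) : is_gpre M -> is_lrmap phi -> geq phi phi.
Proof. by move=> hM hp; apply: geq_rfl (lrmap_premap hp). Qed.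

Lemma geqS M N (phi psi : gmap M N) : is_gpre M -> is_lrmap phi ->
  geq phi psi -> geq psi phi.
Proof. by move=> hM hp; apply: geq_s (lrmap_premap hp). Qed.

Lemma geqT M N (phi psi chi : gmap M N) : is_gpre M -> is_lrmap phi ->
  geq phi psi -> geq psi chi -> geq phi chi.
Proof. by move=> hM hp; apply: geq_t (lrmap_premap hp). Qed.

Lemma geqCr L M N (psi : gmap M N) (phi chi : gmap L M) :
  is_lrmap psi -> geq phi chi -> geq (gcomp psi phi) (gcomp psi chi).
Proof. by move=> hp; apply: geq_compr (lrmap_premap hp). Qed.

Lemma geqCl L M N (psi chi : gmap M N) (phi : gmap L M) :
  is_lrmap phi -> is_lrmap psi -> geq psi chi ->
  geq (gcomp psi phi) (gcomp chi phi).
Proof. by move=> hp hq; apply: geq_compl (lrmap_premap hp) (lrmap_premap hq). Qed.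

Lemma geq_mono (M Q : grspace R) (U : set M) (f g : gmap Q (grestr U)) :
  open U -> is_gpre M -> is_gpre Q -> is_lrmap f -> is_lrmap g ->
  geq (gcomp (gincl U) f) (gcomp (gincl U) g) -> geq f g.
Proof.
by move=> oU hM hQ hf hg; apply: gincl_mono => //; exact: lrmap_premap.
Qed.

Lemma giso_trans L M N : is_gpre L -> is_gpre N ->
  giso L M -> giso M N -> giso L N.
Proof.
move=> hL hN [f [g [hf hg fg gf]]] [f' [g' [hf' hg' fg' gf']]].
have hff : is_lrmap (gcomp f' f) by exact: comp_lrmap.
have hgg : is_lrmap (gcomp g g') by exact: comp_lrmap.
exists (gcomp f' f), (gcomp g g'); split=> //.
- apply: geqT _ fg => //; first exact: comp_lrmap.
  apply: (@geqCr L M L g (gcomp (gcomp g' f') f) f) => //.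
  apply: (@geqCl _ _ _ (gcomp g' f') (gid M)) => //; exact: comp_lrmap.
- apply: geqT _ gf' => //; first exact: comp_lrmap.
  apply: (@geqCr _ _ _ f' (gcomp (gcomp f g) g') g') => //.
  apply: (@geqCl _ _ _ (gcomp f g) (gid M)) => //; exact: comp_lrmap.
Qed.

(** Both restricted maps are lifts through open inclusions; as these are monomorphisms, the two
    inverse laws can be checked after composing with them. *)
Lemma giso_restr M N (phi : gmap M N) (psi : gmap N M) (V : set N) :
  is_gpre M -> is_gpre N -> is_lrmap phi -> is_lrmap psi ->
  geq (gcomp psi phi) (gid M) -> geq (gcomp phi psi) (gid N) -> open V ->
  giso (grestr (phi @^-1` V)) (grestr V).
Proof.
move=> hM hN hp hq e1 e2 oV; set U := phi @^-1` V.
have oU : open U by exact: (pre_open (lrmap_premap hp) oV).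
have hU := grestr_pre oU hM; have hV := grestr_pre oV hN.
have iU := gincl_lrmap oU hM; have iV := gincl_lrmap oV hN.
have lf : is_lrmap (gcomp phi (gincl U)) by exact: comp_lrmap.
have lg : is_lrmap (gcomp psi (gincl V)) by exact: comp_lrmap.
have pf q : V (gcomp phi (gincl U) q) by exact: (set_val_mem q).
have pg q : U (gcomp psi (gincl V) q).
  have /= e := e2.1 (set_val q).
  by rewrite /U /preimage /= [phi _]e; exact: set_val_mem.
have lF := glift_lrmap oV hN pf hU lf; have eF := glift_incl oV pf hU lf.
have lG := glift_lrmap oU hM pg hV lg; have eG := glift_incl oU pg hV lg.
set F := glift pf in lF eF; set G := glift pg in lG eG.
exists F, G; split=> //.
- apply: (geq_mono oU hM) => //; [exact: comp_lrmap|exact: gid_lrmap|].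
  apply: (@geqT _ _ _ (gcomp (gcomp psi (gincl V)) F)) => //.
  + by do ?apply: comp_lrmap.
  + apply: (@geqCl _ _ _ (gcomp (gincl U) G)) => //; exact: comp_lrmap.
  apply: (@geqT _ _ _ (gcomp psi (gcomp phi (gincl U)))) => //.
  + by do ?apply: comp_lrmap.
  + exact: (@geqCr _ _ _ psi (gcomp (gincl V) F)).
  apply: (@geqCl _ _ _ (gcomp psi phi) (gid M)) => //; exact: comp_lrmap.
- apply: (geq_mono oV hN) => //; [exact: comp_lrmap|exact: gid_lrmap|].
  apply: (@geqT _ _ _ (gcomp (gcomp phi (gincl U)) G)) => //.
  + by do ?apply: comp_lrmap.
  + apply: (@geqCl _ _ _ (gcomp (gincl V) F)) => //; exact: comp_lrmap.
  apply: (@geqT _ _ _ (gcomp phi (gcomp psi (gincl V)))) => //.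
  + by do ?apply: comp_lrmap.
  + exact: (@geqCr _ _ _ phi (gcomp (gincl U) G)).
  apply: (@geqCl _ _ _ (gcomp phi psi) (gid N)) => //; exact: comp_lrmap.
Qed.

End LRCat.

(** * Charts of an open subspace *)

Section RestrictManifold.
Variables (R : realType) (N : grspace R) (U : set N).
Hypotheses (oU : open U) (hN : is_gpre N).

Section Chart.
Variables (G : grspace R) (U0 : set N) (V0 : set G).
Hypotheses (hG : is_gpre G) (oU0 : open U0) (oV0 : open V0).
Variables (phi : gmap (grestr U0) (grestr V0)) (psi : gmap (grestr V0) (grestr U0)).
Hypotheses (hp : is_lrmap phi) (hq : is_lrmap psi)
  (e1 : geq (gcomp psi phi) (gid _)) (e2 : geq (gcomp phi psi) (gid _)).

Let U0' : set (grestr U) := set_val @^-1` U0.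
Let V' : set G := set_val @` (gcomp (gincl U0) psi @^-1` U).

(** [V'] is the part of the chart image that [psi] sends into [U]. The new chart maps are lifts of
    [phi] and [psi] through the inclusions at hand, and their inverse laws are verified in [N] and
    in [G]. *)
Lemma chart_restr : open V' /\ giso (grestr U0') (grestr V').
Proof.
have iU := gincl_lrmap oU hN; have pU := grestr_pre oU hN.
have iU0 := gincl_lrmap oU0 hN; have pU0 := grestr_pre oU0 hN.
have iV0 := gincl_lrmap oV0 hG; have pV0 := grestr_pre oV0 hG.
have oU0' : open U0' by exact: open_pim.
have iU0' := gincl_lrmap oU0' pU; have pU0' := grestr_pre oU0' pU.
have oV' : open V'.
  have lc : is_lrmap (gcomp (gincl U0) psi) by exact: comp_lrmap.
  exact: (open_im oV0 (pre_open (lrmap_premap lc) oU)).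
have iV' := gincl_lrmap oV' hG; have pV' := grestr_pre oV' hG.
split=> //; set A := grestr U0'; set B := grestr V'.
pose al : gmap A N := gcomp (gincl U) (gincl U0').
have lal : is_lrmap al by exact: comp_lrmap.
(* [aA] and, below, [bB] are the inclusions of the small chart domains into the original ones. *)
have aU0 (a : A) : U0 (al a) by exact: (set_val_mem a).
have lA := glift_lrmap oU0 hN aU0 pU0' lal; have eA := glift_incl oU0 aU0 pU0' lal.
set aA := glift aU0 in lA eA.
have VV0 (b : B) : V0 (gincl V' b).
  by have [v _ vb] := set_val_mem b; rewrite /= -vb; exact: set_val_mem.
have lB := glift_lrmap oV0 hG VV0 pV' iV'; have eB := glift_incl oV0 VV0 pV' iV'.
set bB := glift VV0 in lB eB.
pose F0 : gmap A G := gcomp (gincl V0) (gcomp phi aA).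
have lF0 : is_lrmap F0 by do ?apply: comp_lrmap.
have F0V (a : A) : V' (F0 a).
  exists (phi (aA a)) => //; rewrite /preimage /=.
  rewrite [psi _](e1.1 (aA a)) [set_val _](eA.1 a); exact: (set_val_mem (set_val a)).
have lF := glift_lrmap oV' hG F0V pU0' lF0; have eF := glift_incl oV' F0V pU0' lF0.
set F := glift F0V in lF eF.
pose G0 : gmap B N := gcomp (gincl U0) (gcomp psi bB).
have lG0 : is_lrmap G0 by do ?apply: comp_lrmap.
have G0U (b : B) : U (G0 b).
  have [v Uv vb] := set_val_mem b.
  have e : bB b = v by apply: val_inj_set; rewrite vb.
  by rewrite -[G0 b]/(set_val (psi (bB b))) e.
have lG1 := glift_lrmap oU hN G0U pV' lG0; have eG1 := glift_incl oU G0U pV' lG0.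
set G1 := glift G0U in lG1 eG1.
have G1U (b : B) : U0' (G1 b) by exact: (set_val_mem (psi (bB b))).
have lG := glift_lrmap oU0' pU G1U pV' lG1; have eG := glift_incl oU0' G1U pV' lG1.
set G2 := glift G1U in lG eG.
have eG0 : geq (gcomp al G2) G0.
  apply: (@geqT _ _ _ _ (gcomp (gincl U) G1)) eG1 => //; first exact: comp_lrmap.
  exact: (@geqCr _ _ _ _ (gincl U) (gcomp (gincl U0') G2)).
have lGF : is_lrmap (gcomp G2 F) by exact: comp_lrmap.
have lFG : is_lrmap (gcomp F G2) by exact: comp_lrmap.
exists F, G2; split=> //.
- apply: (geq_mono oU0' pU) => //; first exact: gid_lrmap.
  have lid : is_lrmap (gcomp (gincl U0') (gid A)).
    by apply: comp_lrmap iU0'; exact: gid_lrmap.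
  have lGF' : is_lrmap (gcomp (gincl U0') (gcomp G2 F)) by exact: comp_lrmap.
  apply: (geq_mono oU hN) => //.
  apply: (@geqT _ _ _ _ (gcomp G0 F)) => //; first by do ?apply: comp_lrmap.
    exact: (@geqCl _ _ _ _ (gcomp al G2) G0 F (lF) (comp_lrmap lG lal)).
  have eBF : geq (gcomp bB F) (gcomp phi aA).
    apply: (geq_mono oV0 hG) => //; [exact: comp_lrmap|exact: comp_lrmap|].
    apply: (@geqT _ _ _ _ (gcomp (gincl V') F)) eF => //; first by do ?apply: comp_lrmap.
    apply: (@geqCl _ _ _ _ (gcomp (gincl V0) bB) (gincl V') F) => //; exact: comp_lrmap.
  apply: (@geqT _ _ _ _ (gcomp (gincl U0) (gcomp psi (gcomp phi aA)))) => //.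
  + by do ?apply: comp_lrmap.
  + apply: (@geqCr _ _ _ _ (gcomp (gincl U0) psi) (gcomp bB F) (gcomp phi aA)) => //.
    exact: comp_lrmap.
  apply: (@geqT _ _ _ _ (gcomp (gincl U0) aA)) eA => //; first by do ?apply: comp_lrmap.
  apply: (@geqCr _ _ _ _ (gincl U0) (gcomp (gcomp psi phi) aA) aA) => //.
  apply: (@geqCl _ _ _ _ (gcomp psi phi) (gid _) aA) => //; exact: comp_lrmap.
apply: (geq_mono oV' hG) => //; first exact: gid_lrmap.
apply: (@geqT _ _ _ _ (gcomp F0 G2)) => //; first by do ?apply: comp_lrmap.
  apply: (@geqCl _ _ _ _ (gcomp (gincl V') F) F0 G2) => //; exact: comp_lrmap.
have eAG : geq (gcomp aA G2) (gcomp psi bB).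
  apply: (geq_mono oU0 hN) => //; [exact: comp_lrmap|exact: comp_lrmap|].
  apply: (@geqT _ _ _ _ (gcomp al G2)) eG0 => //; first by do ?apply: comp_lrmap.
  apply: (@geqCl _ _ _ _ (gcomp (gincl U0) aA) al G2) => //; exact: comp_lrmap.
apply: (@geqT _ _ _ _ (gcomp (gincl V0) (gcomp phi (gcomp psi bB)))) => //.
- by do ?apply: comp_lrmap.
- apply: (@geqCr _ _ _ _ (gcomp (gincl V0) phi) (gcomp aA G2) (gcomp psi bB)) => //.
  exact: comp_lrmap.
apply: (@geqT _ _ _ _ (gcomp (gincl V0) bB)) eB => //; first by do ?apply: comp_lrmap.
apply: (@geqCr _ _ _ _ (gincl V0) (gcomp (gcomp phi psi) bB) bB) => //.
apply: (@geqCl _ _ _ _ (gcomp phi psi) (gid _) bB) => //; exact: comp_lrmap.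
Qed.

End Chart.

End RestrictManifold.

Lemma set_type_second_countable (T : topologicalType) (U : set T) :
  @second_countable T -> @second_countable (set_type U).
Proof.
case=> B cB [Bo Bb].
exists [set (set_val : set_type U -> T) @^-1` b | b in B].
  exact: card_le_trans (card_image_le _ _) cB.
split=> [_ [b /Bo ob <-]|x W /= [A [[C oC <-] Cx] CA]]; first by exists b.
have [b [Bb' bx] bC] : filter_from [set U | B U /\ U (set_val x)] id C.
  by apply: Bb; exact: open_nbhs_nbhs.
exists ((set_val : set_type U -> T) @^-1` b).
  by split=> //; exists b.
by apply: subset_trans CA => y; exact: bC.
Qed.

Lemma set_type_hausdorff (T : topologicalType) (U : set T) :
  hausdorff_space T -> hausdorff_space (set_type U).
Proof.
move=> hT x y cxy; apply: val_inj; apply: hT => A B nA nB.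
have cv := @initial_continuous (set_type U) T set_val.
have [z [Az Bz]] := cxy _ _ (cv _ _ nA) (cv _ _ nB).
by exists (set_val z).
Qed.

Lemma gdom_pre (R : realType) n (d : seq int) : is_gpre (gdom R n d).
Proof.
have eqs (W : set 'rV[R]_n) i (s t : gdom_sec d W i) :
    (forall m x, s m x = t m x) -> s = t.
  by move=> h; apply: val_inj; apply/funext => m; apply/funext => x; exact: h.
have e0 (W : set 'rV[R]_n) i (s : gdom_sec d W i) m x : ~ W x -> s m x = 0.
  by have /asboolP[_ + _] := gcoefP s; exact.
split=> /=.
- move=> U V i VU c a b _ _; apply: eqs => m x /=.
  rewrite -![(_ + _) m x]/(_ m x + _ m x) /=.
  rewrite -![(_ *: _) m x]/(c * (_ m x)) /=.
  by case: ifP; rewrite ?mulr0 ?addr0.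
- move=> U V i j k VU a b _ _; apply: eqs => m x /=.
  case: ifPn => _; last by case: ifP => // _; rewrite big1 // => l _; rewrite mul0r mulr0.
  by case: ifP.
- move=> U V VU _ _; apply: eqs => m x /=.
  have [Vx|] := boolP (x \in V); last by rewrite andbF.
  by rewrite (mem_set (VU _ (set_mem Vx))).
- move=> U i UU a _; apply: eqs => m x /=.
  by case: ifPn => // /negP Ux; rewrite e0 // => /mem_set.
- move=> U V W i VU WV WU a _ _ _; apply: eqs => m x /=.
  by case: ifPn => // Wx; rewrite (mem_set (WV _ (set_mem Wx))).
Qed.

Lemma grestr_gmanifold (R : realType) (N : grspace R) (U : set N) : open U ->
  gmanifold N -> gmanifold (grestr U).
Proof.
move=> oU [hN hT cN ch]; split.
- exact: grestr_sheaf.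
- exact: set_type_hausdorff.
- exact: set_type_second_countable.
move=> x; have [U0 [n [d [V0 [oU0 U0x d0 oV0 [phi [psi [hp hq e1 e2]]]]]]]] := ch (set_val x).
have [oV' iso] := chart_restr oU (hN : is_gpre N) (@gdom_pre R n d) oU0 oV0 hp hq e1 e2.
exists (set_val @^-1` U0), n, d, (set_val @` (gcomp (gincl U0) psi @^-1` U)).
by split=> //; exact: open_pim.
Qed.

(** * Thickening by an odd variable *)

Section Thick.
Variables (R : realType) (M : grspace R) (d : int).

(* [(a0, a1)] stands for [a0 + eta a1], with [eta] a new variable of degree [- d]
   and square zero. *)
Definition thick : grspace R :=
  @GrSpace R (gpt M)
    (fun U i => ((@gsec R M U i * @gsec R M U (i + d))%type : lmodType R))
    (fun U i j k a b => (gmul k a.1 b.1,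
       gmul (k + d) a.2 b.1 + ksign R d i *: gmul (k + d) a.1 b.2))
    (fun U => (gone U, 0))
    (fun U V i VU a => (gres VU a.1, gres VU a.2)).

Lemma rs_thick (U V : set thick) i (a : @gsec R thick U i) : V `<=` U ->
  rs V a = (@rs R M V U i a.1, @rs R M V U (i + d) a.2).
Proof.
move=> VU; rewrite -(gresE VU) -(@gresE R M U V _ VU a.1).
by rewrite -(@gresE R M U V _ VU a.2).
Qed.

Lemma thick_pre : is_gpre M -> is_gpre thick.
Proof.
move=> hM; split=> /=.
- by move=> U V i VU c [a1 a2] [b1 b2] oU oV; congr pair; exact: preL.
- move=> U V i j k VU [a1 a2] [b1 b2] oU oV /=; congr pair; first exact: preM.
  by rewrite !gresE rsD // rsZ // !rsM.
- by move=> U V VU oU oV; congr pair; [exact: pre1|rewrite gresE rs0].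
- by move=> U i UU [a1 a2] oU; congr pair; exact: pre_id.
- by move=> U V W i VU WV WU [a1 a2] oU oV oW; congr pair; exact: pre_comp.
Qed.

(** All signs come from moving [eta] past homogeneous factors. The terms in [eta ^ 2] are dropped,
    so the algebra laws hold for [eta] of either parity. *)
Lemma thick_sheaf : is_gsheaf M -> is_gsheaf thick.
Proof.
move=> hM; have [pL pM p1 pid pc] := thick_pre hM; split=> //=.
- move=> U i j k c [a1 a2] [b1 b2] [s1 s2] oU /=; congr pair; first exact: gmulDl.
  rewrite !gmulDl //=.
  by rewrite !scalerDr !scalerA (mulrC c) addrACA.
- move=> U i j k [a1 a2] [b1 b2] oU kij /=.
  congr pair; first exact: gmul_deg.
  rewrite !(gmul_deg hM) ?scaler0 ?addr0 //; apply: contra kij => /eqP h; lia.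
- move=> U i j k [a1 a2] [b1 b2] oU /=; congr pair; first exact: gmulC.
  rewrite (gmulC hM _ a2) // (gmulC hM _ a1 b2) // scalerDr !scalerA [LHS]addrC.
  congr (_ *: _ + _ *: _); last by rewrite ksignDl.
  by rewrite ksignDr (ksignC R d i) mulrCA ksign_sqr mulr1.
- move=> U i j l k [a1 a2] [b1 b2] [c1 c2] oU /=; congr pair; first exact: gmulA.
  rewrite gmulD_r // gmulD_l // !gmulZ_r // gmulZ_l // scalerDr scalerA addrA.
  rewrite ksignDr.
  congr (_ + _ + _ *: _).
  + by apply: gmulA' => //; lia.
  + by congr (_ *: _); apply: gmulA' => //; lia.
  + by apply: gmulA' => //; lia.
- move=> U i [a1 a2] oU /=; congr pair; first exact: gmul1.
  by rewrite gmul0l // add0r /ksign andbF scale1r gmul1.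
move=> I U V i UV s oU VE h.
have oV : open V by rewrite VE; exact: bigcup_open.
have gl1 j (f : forall x, @gsec R M (U x) i * @gsec R M (U x) (i + d) -> @gsec R M (U x) j) :
    (forall x y, rs (U x `&` U y) (f x (s x)) = rs (U x `&` U y) (f y (s y))) ->
    exists t : @gsec R M V j, forall x, rs (U x) t = f x (s x).
  by move=> h1; apply: (glue hM) => //; exact: oU.
have [t1 ht1] : exists t : @gsec R M V i, forall x, rs (U x) t = (s x).1.
  apply: (gl1 i (fun x => fst)) => x y.
  by have := h x y; rewrite -!(gresE (@subIsetl _ _ _)) -!(gresE (@subIsetr _ _ _)) => -[].
have [t2 ht2] : exists t : @gsec R M V (i + d), forall x, rs (U x) t = (s x).2.
  apply: (gl1 (i + d) (fun x => snd)) => x y.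
  by have := h x y; rewrite -!(gresE (@subIsetl _ _ _)) -!(gresE (@subIsetr _ _ _)) => -[].
exists (t1, t2); split=> [x|[u1 u2] hu]; first by rewrite /= !gresE ht1 ht2; case: (s x).
have hV x : V x -> exists y, U y x by rewrite VE => -[y _ ?]; exists y.
congr pair; apply: (gsec_eq hM) => // x /hV[y Uy]; exists (U y); split=> //.
- by rewrite ht1 -(hu y) /= !gresE.
- by rewrite ht2 -(hu y) /= !gresE.
Qed.

End Thick.

Section ThickMap.
Variables (R : realType) (M N : grspace R) (d : int) (phi : gmap M N).

Definition thick_map : gmap (thick M d) (thick N d) :=
  @GMap R (thick M d) (thick N d) phi
    (fun W i a => (gpull phi a.1, gpull phi a.2)).

Lemma thick_map_premap : is_premap phi -> is_premap thick_map.
Proof.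
move=> hp; split=> /=.
- exact: (pre_cont hp).
- by move=> W i c [a1 a2] [b1 b2] oW; congr pair; exact: prepullL.
- move=> W i j k [a1 a2] [b1 b2] oW /=; congr pair; first exact: prepullM.
  by rewrite pullD // pullZ // !(prepullM hp).
- by move=> W oW; congr pair; [exact: prepull1|exact: pull0].
- move=> V W i [a1 a2] oW oV VW.
  have VW' : phi @^-1` V `<=` phi @^-1` W by exact: preimage_subset.
  by rewrite !rs_thick //=; congr pair; exact: prepull_rs.
Qed.

End ThickMap.

Lemma thick_giso (R : realType) (M N : grspace R) (d : int) :
  is_gpre M -> is_gpre N -> giso M N -> giso (thick M d) (thick N d).
Proof.
move=> hM hN [f [g [hf hg e1 e2]]].
have pf := thick_map_premap d (lrmap_premap hf).
have pg := thick_map_premap d (lrmap_premap hg).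
have tM := thick_pre d hM; have tN := thick_pre d hN.
have geq_thick (A B : grspace R) (u : gmap A B) (v : gmap B A) :
    is_premap u -> is_premap v -> geq (gcomp v u) (gid A) ->
    geq (gcomp (thick_map d v) (thick_map d u)) (gid (thick A d)).
  move=> pu pv /geqP[h1 h2]; apply/geqP; split=> // W i [a1 a2] oW /=.
  rewrite rs_thick; last by move=> x; rewrite /preimage /= [v _](h1 x).
  by congr pair; exact: h2.
have E1 := geq_thick _ _ f g (lrmap_premap hf) (lrmap_premap hg) e1.
have E2 := geq_thick _ _ g f (lrmap_premap hg) (lrmap_premap hf) e2.
by exists (thick_map d f), (thick_map d g); split=> //;
  [exact: iso_lrmap pf pg E1 E2|exact: iso_lrmap pg pf E2 E1].
Qed.

(** * Splitting off the first variable of a graded domain *)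

Section SumDffun.
Variable n : nat.
Implicit Types (m : {ffun 'I_n -> nat}).

Definition fcons (p : nat) m : {ffun 'I_n.+1 -> nat} :=
  [ffun a => if unlift ord0 a is Some b then m b else p].
Definition ftail (m : {ffun 'I_n.+1 -> nat}) : {ffun 'I_n -> nat} :=
  [ffun b => m (lift ord0 b)].

Lemma fcons0 p m : fcons p m ord0 = p.
Proof. by rewrite ffunE unlift_none. Qed.

Lemma fconsS p m b : fcons p m (lift ord0 b) = m b.
Proof. by rewrite ffunE liftK. Qed.

Lemma ftailK (m : {ffun 'I_n.+1 -> nat}) : fcons (m ord0) (ftail m) = m.
Proof.
apply/ffunP => a; rewrite ffunE; case: unliftP => [b ->|-> //].
by rewrite ffunE.
Qed.

Lemma fconsK p m : ftail (fcons p m) = m.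
Proof. by apply/ffunP => b; rewrite ffunE fconsS. Qed.

(** The exponents dividing a given one form a dependent function type; as [F] is taken on plain
    functions, the first exponent splits off without casts. *)
Lemma sum_dffun_cons (V : nmodType) p m (F : {ffun 'I_n.+1 -> nat} -> V) :
  \sum_(l : {dffun forall a, 'I_(fcons p m a).+1}) F [ffun a => l a : nat] =
  \sum_(q < p.+1) \sum_(l : {dffun forall b, 'I_(m b).+1})
    F (fcons q [ffun b => l b : nat]).
Proof.
rewrite pair_bigA /=.
(* [inord] supplies the dependent bound; [hv] shows that it truncates nothing. *)
pose h (u : 'I_p.+1 * {dffun forall b, 'I_(m b).+1}) :
    {dffun forall a, 'I_(fcons p m a).+1} :=
  [ffun a => inord (fcons u.1 [ffun b => u.2 b : nat] a)].
pose g (l : {dffun forall a, 'I_(fcons p m a).+1}) :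
    'I_p.+1 * {dffun forall b, 'I_(m b).+1} :=
  (inord (l ord0), [ffun b => inord (l (lift ord0 b))]).
have hv u a : h u a = fcons u.1 [ffun b => u.2 b : nat] a :> nat.
  have lt : (fcons u.1 [ffun b => u.2 b : nat] a < (fcons p m a).+1)%N.
    case: (unliftP ord0 a) => [b ->|->]; last by rewrite !fcons0 ltn_ord.
    by rewrite !fconsS ffunE ltn_ord.
  by rewrite /h [X in nat_of_ord X]ffunE inordK.
have hK : cancel h g.
  move=> [q l]; rewrite /g; congr pair.
    by apply: val_inj; rewrite /= hv fcons0 inordK.
  apply/ffunP => b; apply: val_inj.
  by rewrite ffunE /= hv fconsS ffunE inordK.
have gK : cancel g h.
  move=> l; apply/ffunP => a; apply: val_inj; rewrite /= hv.
  case: (unliftP ord0 a) => [b|] ea; subst a.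
    by rewrite fconsS ffunE /= ffunE inordK // -(fconsS p m) ltn_ord.
  by rewrite fcons0 inordK // -[X in (_ < X.+1)%N](fcons0 p m) ltn_ord.
rewrite (reindex h) /=; last by exists g => ? _; [exact: hK|exact: gK].
apply: eq_bigr => u _; congr F; apply/ffunP => a; rewrite ffunE; exact: hv.
Qed.

End SumDffun.

Section GdomCoef.
Variables (R : realType) (n : nat) (dd : seq int) (W : set 'rV[R]_n).

Lemma gcoefD k (s t : gdom_sec dd W k) m x : (s + t) m x = s m x + t m x.
Proof. by []. Qed.

Lemma gcoefZ k c (s : gdom_sec dd W k) m x : (c *: s) m x = c * s m x.
Proof. by []. Qed.

Lemma gcoef_eq k (s t : gdom_sec dd W k) : (forall m x, s m x = t m x) -> s = t.
Proof.
by move=> h; apply: val_inj; apply/funext => m; apply/funext => x; exact: h.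
Qed.

Lemma gcoef_out k (s : gdom_sec dd W k) m x : ~ W x -> s m x = 0.
Proof. by have /asboolP[_ + _] := gcoefP s; exact. Qed.

Lemma gcoef_adm k (s : gdom_sec dd W k) m x :
  ~~ (madm m && (mdeg m == k)) -> s m x = 0.
Proof. by have /asboolP[_ _ h] := gcoefP s => /h ->. Qed.

Lemma gcoef_smooth k (s : gdom_sec dd W k) m : smooth_on W (s m).
Proof. by have /asboolP[+ _ _] := gcoefP s; exact. Qed.

Definition fsub (m l : monomial dd) : monomial dd := [ffun a => (m a - l a)%N].

Lemma gdom_mulE i j k (s : gdom_sec dd W i) (t : gdom_sec dd W j) m x :
  gdom_mul k s t m x = if madm m && (mdeg m == k) then
     \sum_(l : {dffun forall a, 'I_(m a).+1})
       (fun l1 => msign R l1 (fsub m l1) * (s l1 x * t (fsub m l1) x))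
         [ffun a => l a : nat]
   else 0.
Proof.
rewrite /=; case: ifP => // _; apply: eq_bigr => l _.
suff -> : [ffun a => (m a - l a)%N] = fsub m [ffun a => l a : nat] by [].
by apply/ffunP => a; rewrite !ffunE.
Qed.

End GdomCoef.

Section Split.
Variables (R : realType) (n : nat) (dd : seq int) (d : int).
Hypothesis odd_d : odd (absz d).

Local Notation ed := (- d :: dd).
Local Notation mcons := (@fcons (size dd) : nat -> monomial dd -> monomial ed).
Local Notation mtail := (@ftail (size dd) : monomial ed -> monomial dd).

Lemma mdeg_cons p (m : monomial dd) : mdeg (mcons p m) = - d *+ p + mdeg m.
Proof.
rewrite /mdeg big_ord_recl fcons0; congr (_ + _).
by apply: eq_bigr => b _; rewrite fconsS.
Qed.

Lemma madm_cons p (m : monomial dd) :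
  madm (mcons p m) = (p <= 1)%N && madm m.
Proof.
apply/forallP/andP => [h|[p1 /forallP h] a].
  split; last by apply/forallP => b; have := h (lift ord0 b); rewrite fconsS.
  by have := h ord0; rewrite fcons0 /= abszN odd_d.
case: (unliftP ord0 a) => [b ->|->]; last by rewrite fcons0 p1 implybT.
by rewrite fconsS; exact: h.
Qed.

Lemma ksign_mdeg (m : monomial dd) j :
  ksign R (mdeg m) j = \prod_(a < size dd) ksign R (dd`_a *+ m a) j.
Proof.
rewrite /mdeg; elim/big_ind2: _ => [|x1 x2 y1 y2 <- <-|//].
  by rewrite /ksign.
by rewrite ksignDl.
Qed.

(** The new variable has index [0] and stands leftmost, so the only new move is that of [eta ^ q] in
    the second factor past all of [l]. *)
Lemma msign_cons p q (l m : monomial dd) :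
  msign R (mcons p l) (mcons q m) = ksign R (mdeg l) (- d *+ q) * msign R l m.
Proof.
rewrite /msign big_ord_recl big_pred0 ?mul1r; last by [].
rewrite ksign_mdeg -big_split /=; apply: eq_bigr => a _.
rewrite big_mkcond big_ord_recl /= !fcons0 fconsS [X in _ = _ * X]big_mkcond.
by congr (_ * _); apply: eq_bigr => b _; rewrite fconsS.
Qed.

Lemma fsub_cons p q (m l : monomial dd) :
  fsub (mcons p m) (mcons q l) = mcons (p - q)%N (fsub m l).
Proof.
apply/ffunP => a; rewrite [LHS]ffunE.
case: (unliftP ord0 a) => [b ->|->]; last by rewrite !fcons0.
by rewrite !fconsS ffunE.
Qed.

Section Sec.
Variables (W : set 'rV[R]_n) (i : int).

(** The equation on [j] is a hypothesis so that the two components get the degrees [i] and [i + d]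
    literally. *)
Fact split_subproof (p : bool) j (s : gdom_sec ed W i) : j = i + d *+ p ->
  (fun m : monomial dd => s (mcons p m)) \in gdom_pred W j.
Proof.
move=> ->; apply/asboolP; split=> [m|m x|m hm].
- exact: gcoef_smooth.
- exact: gcoef_out.
apply/funext => x; apply: gcoef_adm; apply: contra hm.
rewrite madm_cons mdeg_cons => /andP[/andP[_ ->] /eqP <-] /=.
by apply/eqP; case: p; rewrite ?mulr1n ?mulr0n; ring.
Qed.

Definition gsplit0 (s : gdom_sec ed W i) : gdom_sec dd W i :=
  GDomSec (@split_subproof false i s (esym (addr0 i))).
Definition gsplit1 (s : gdom_sec ed W i) : gdom_sec dd W (i + d) :=
  GDomSec (@split_subproof true (i + d) s erefl).

Fact join_subproof (s : gdom_sec dd W i) (t : gdom_sec dd W (i + d)) :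
  (fun (m : monomial ed) x => if m ord0 == 0%N then s (mtail m) x
     else if m ord0 == 1%N then t (mtail m) x else 0) \in gdom_pred W i.
Proof.
apply/asboolP; split=> [m|m x Wx|m hm].
- case: (m ord0 == 0%N); first exact: gcoef_smooth.
  by case: (m ord0 == 1%N); [exact: gcoef_smooth|exact: smooth_on_cst].
- by rewrite !gcoef_out ?if_same.
apply/funext => x; move: hm; rewrite -(ftailK m) madm_cons mdeg_cons fcons0 fconsK.
case: (m ord0 =P 0%N) => [->|_].
  by rewrite mulr0n add0r => hm; rewrite gcoef_adm.
case: (m ord0 =P 1%N) => [->|_ //]; rewrite mulr1n => hm; apply: gcoef_adm.
by apply: contra hm => /andP[-> /eqP ->] /=; apply/eqP; ring.
Qed.

Definition gjoin s t : gdom_sec ed W i := GDomSec (join_subproof s t).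

Lemma gsplitK (s : gdom_sec ed W i) : gjoin (gsplit0 s) (gsplit1 s) = s.
Proof.
apply: gcoef_eq => m x /=.
have [m0|m0] := eqVneq (m ord0) 0%N; first by rewrite -[in RHS](ftailK m) m0.
have [m1|m1] := eqVneq (m ord0) 1%N; first by rewrite -[in RHS](ftailK m) m1.
rewrite gcoef_adm // -(ftailK m) madm_cons.
by case: (m ord0) m0 m1 => [|[|]].
Qed.

Lemma gjoinK s t : (gsplit0 (gjoin s t), gsplit1 (gjoin s t)) = (s, t).
Proof.
by congr pair; apply: gcoef_eq => m x /=; rewrite fcons0 fconsK.
Qed.

End Sec.

Definition split_map : gmap (thick (gdom R n dd) d) (gdom R n ed) :=
  @GMap R (thick (gdom R n dd) d) (gdom R n ed) id
    (fun W i s => (gsplit0 s, gsplit1 s)).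

Definition join_map : gmap (gdom R n ed) (thick (gdom R n dd) d) :=
  @GMap R (gdom R n ed) (thick (gdom R n dd) d) id
    (fun W i s => gjoin s.1 s.2).

(** The exponent [1] of [eta] splits as [1 + 0] or [0 + 1], which gives the two terms of the second
    component; in the latter [eta] moves past the first factor, whence the sign. *)
Lemma split_mul (W : set 'rV[R]_n) i j k (a : gdom_sec ed W i)
    (b : gdom_sec ed W j) :
  (gsplit0 (gdom_mul k a b), gsplit1 (gdom_mul k a b)) =
  @gmul R (thick (gdom R n dd) d) W i j k (gsplit0 a, gsplit1 a)
    (gsplit0 b, gsplit1 b).
Proof.
congr pair; apply: gcoef_eq => m x.
  rewrite -[LHS]/(gdom_mul k a b (mcons 0 m) x) !gdom_mulE.
  rewrite madm_cons mdeg_cons mulr0n add0r; case: ifP => // _.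
  rewrite (sum_dffun_cons 0 m (fun l1 : monomial ed => msign R l1 (fsub (mcons 0 m) l1) *
    (a l1 x * b (fsub (mcons 0 m) l1) x))) big_ord1.
  apply: eq_bigr => l _; rewrite fsub_cons msign_cons mulr0n /=.
  by rewrite /ksign andbF mul1r.
rewrite -[LHS]/(gdom_mul k a b (mcons 1 m) x) 
  -[RHS]/((gdom_mul (k + d) (gsplit1 a) (gsplit0 b) +
    ksign R d i *: gdom_mul (k + d) (gsplit0 a) (gsplit1 b)) m x).
rewrite gcoefD gcoefZ !gdom_mulE.
rewrite madm_cons mdeg_cons mulr1n /=.
have -> : (- d + mdeg m == k) = (mdeg m == k + d).
  by apply/eqP/eqP => [<-|->]; ring.
case: ifP => [_|_]; last by rewrite mulr0 addr0.
rewrite (sum_dffun_cons 1 m (fun l1 : monomial ed => msign R l1 (fsub (mcons 1 m) l1) *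
    (a l1 x * b (fsub (mcons 1 m) l1) x))) big_ord_recl big_ord1 [LHS]addrC.
congr (_ + _).
  apply: eq_bigr => l _; rewrite fsub_cons msign_cons mulr0n /=.
  by rewrite /ksign andbF mul1r.
rewrite mulr_sumr; apply: eq_bigr => l _; rewrite fsub_cons msign_cons mulr1n /=.
set l1 := [ffun b => _].
(* The sign depends on the degree of the exponent [l1], which is [i] wherever the coefficient of [a]
   is non-zero; elsewhere both terms vanish. *)
have [/andP[_ /eqP hd]|hl] := boolP (madm l1 && (mdeg l1 == i)).
  by rewrite hd ksignC /ksign abszN -mulrA.
by rewrite [a (mcons 0 l1) x]gcoef_adm ?(mul0r, mulr0) // madm_cons mdeg_cons mulr0n add0r.
Qed.

End Split.

Section SplitIso.
Variables (R : realType) (n : nat) (dd : seq int) (d : int).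
Hypothesis odd_d : odd (absz d).

Lemma split_premap : is_premap (split_map R n dd odd_d).
Proof.
split=> /=.
- by move=> x; exact: cvg_id.
- by move=> W i c a b oW; congr pair; apply: gcoef_eq.
- by move=> W i j k a b oW; exact: split_mul.
- move=> W oW; congr pair; apply: gcoef_eq => m x /=.
    suff -> : (fcons 0 m == [ffun=> 0%N]) = (m == [ffun=> 0%N]) by [].
    apply/eqP/eqP => [/ffunP h|->]; apply/ffunP => a.
      by have := h (lift ord0 a); rewrite fconsS !ffunE.
    by rewrite !ffunE; case: unlift => // b; rewrite ffunE.
  suff -> : (fcons 1 m == [ffun=> 0%N]) = false by [].
  by apply/eqP => /ffunP/(_ ord0); rewrite fcons0 ffunE.
- move=> V W i a oW oV VW; rewrite rs_thick // -(@gresE R (gdom R n (- d :: dd)) W V i VW a).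
  by rewrite -!(@gresE R (gdom R n dd) W V _ VW); congr pair; apply: gcoef_eq.
Qed.

Lemma join_premap : is_premap (join_map R n dd odd_d).
Proof.
have [hc hL hM h1 hr] := split_premap.
have K W i (s : @gsec R (gdom R n (- d :: dd)) W i) :
  gpull (join_map R n dd odd_d) (gpull (split_map R n dd odd_d) s) = s.
  by exact: gsplitK.
have K' W i (s : @gsec R (thick (gdom R n dd) d) W i) :
  gpull (split_map R n dd odd_d) (gpull (join_map R n dd odd_d) s) = s.
  by case: s => s t; exact: gjoinK.
split.
- by move=> x; exact: cvg_id.
- by move=> W i c a b oW; rewrite -[RHS]K hL // !K'.
- by move=> W i j k a b oW; rewrite -[RHS]K hM // !K'.
- by move=> W oW; rewrite -[RHS]K h1.
- by move=> V W i a oW oV VW; rewrite -[RHS]K hr // !K'.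
Qed.

Lemma split_iso (V : set (gdom R n (- d :: dd))) : open V ->
  giso (@grestr R (thick (gdom R n dd) d) V) (grestr V).
Proof.
have pt := thick_pre d (@gdom_pre R n dd); have pg := @gdom_pre R n (- d :: dd).
have e1 : geq (gcomp (join_map R n dd odd_d) (split_map R n dd odd_d)) (gid _).
  apply/geqP; split=> // W i a oW; rewrite /= gjoinK [RHS]surjective_pairing.
  exact: (rs_id pt).
have e2 : geq (gcomp (split_map R n dd odd_d) (join_map R n dd odd_d)) (gid _).
  apply/geqP; split=> // W i a oW; rewrite /= gsplitK; exact: (rs_id pg).
move=> oV; apply: (giso_restr pt pg _ _ e1 e2 oV).
- exact: iso_lrmap split_premap join_premap e1 e2.
- exact: iso_lrmap join_premap split_premap e2 e1.
Qed.

End SplitIso.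

(** For odd [d] the relation [eta ^ 2 = 0] is the one that graded commutativity imposes on a free
    variable, so thickening a graded domain only adds a coordinate of degree [- d], which is
    non-zero because it is odd. *)
Lemma thick_gmanifold (R : realType) (N : grspace R) (d : int) :
  odd (absz d) -> gmanifold N -> gmanifold (thick N d).
Proof.
move=> od [hN hT cN ch]; split=> //; first exact: thick_sheaf.
move=> x; have [U [n [dd [V [oU Ux d0 oV iso]]]]] := ch x.
exists U, n, (- d :: dd), V; split=> //.
  by rewrite inE negb_or d0 andbT eq_sym oppr_eq0; apply: contraL od => /eqP ->.
have pN := grestr_pre oU hN; have pG := grestr_pre oV (@gdom_pre R n dd).
have tG := @grestr_pre R (gdom R n (- d :: dd)) V oV (@gdom_pre R n (- d :: dd)).
have ti := thick_giso d pN pG iso.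
apply: giso_trans ti _ => //; first exact: (thick_pre d pN).
exact: split_iso.
Qed.

(** * Calculus on the line and smooth composition *)

Section OneVariable.
Variable R : realType.
Implicit Types (F G f g : R -> R) (c e t x : R).

Lemma derive_cont F x l : is_derive x (1 : R) F l -> {for x, continuous F}.
Proof. by case=> dF _; apply/differentiable_continuous/derivable1_diffP. Qed.

Lemma MVT_pt F G c e z : (forall x, x != c -> `|x - c| < e -> is_derive x 1 F (G x)) ->
  {for c, continuous F} -> z != c -> `|z - c| < e ->
  exists2 xi, xi != c /\ `|xi - c| < `|z - c| & F z - F c = G xi * (z - c).
Proof.
move=> dF cF zc ze.
have cont x : `|x - c| < e -> {for x, continuous F}.
  by move=> xe; have [->//|xc] := eqVneq x c; exact: derive_cont (dF _ xc xe).
have [cz|zc'|/eqP] := ltgtP c z; last by rewrite eq_sym (negPf zc).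
- have zce : z - c < e by rewrite -(gtr0_norm (x := z - c)) // subr_gt0.
  have lt x : c < x -> x <= z -> x != c /\ `|x - c| < e.
    move=> cx xz; split; first by rewrite gt_eqF.
    by rewrite gtr0_norm ?subr_gt0 //; apply: le_lt_trans zce; rewrite lerB.
  have [x|x|xi] := @MVT R F G c z cz.
  + by rewrite in_itv /= => /andP[cx xz]; have [? ?] := lt x cx (ltW xz); exact: dF.
  + move: x; apply: continuous_in_subspaceT => x.
    rewrite inE /= in_itv /= le_eqVlt => /andP[/orP[/eqP <-//|cx] xz].
    by apply: cont; have [] := lt x cx xz.
  rewrite in_itv /= => /andP[cxi xiz] ->; exists xi => //.
  by rewrite gt_eqF // !gtr0_norm ?subr_gt0 // ltrD2r.
- have zce : c - z < e by rewrite -(gtr0_norm (x := c - z)) ?subr_gt0 // distrC.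
  have lt x : x < c -> z <= x -> x != c /\ `|x - c| < e.
    move=> cx xz; split; first by rewrite lt_eqF.
    by rewrite ltr0_norm ?subr_lt0 // opprB; apply: le_lt_trans zce; rewrite lerB.
  have [x|x|xi] := @MVT R F G z c zc'.
  + by rewrite in_itv /= => /andP[cx xz]; have [? ?] := lt x xz (ltW cx); exact: dF.
  + move: x; apply: continuous_in_subspaceT => x.
    rewrite inE /= in_itv /= [(x <= c)]le_eqVlt => /andP[xz /orP[/eqP ->//|cx]].
    by apply: cont; have [] := lt x cx xz.
  rewrite in_itv /= => /andP[cxi xiz] h; exists xi; last by rewrite -opprB h; ring.
  by rewrite lt_eqF // !ltr0_norm ?subr_lt0 // ltrN2 ltrD2r.
Qed.

(** By the mean value theorem the difference quotients of [F] at [c] are values of [G] at points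
    closer to [c], and [G] is continuous at [c]. This serves where a formula for a derivative breaks
    down at one point. *)
Lemma is_derive_punctured F G c e : 0 < e ->
  (forall x, x != c -> `|x - c| < e -> is_derive x 1 F (G x)) ->
  {for c, continuous F} -> {for c, continuous G} -> is_derive c 1 F (G c).
Proof.
move=> e0 dF cF cG; apply/is_derive1_caratheodory.
exists (fun z => if z == c then G c else (F z - F c) / (z - c)); split.
- move=> z; case: eqVneq => [->|zc]; first by rewrite !subrr mulr0.
  by rewrite divfK // subr_eq0.
- rewrite /prop_for /continuous_at eqxx; apply/cvgrPdist_lt => eps eps0.
  have /cvgrPdist_lt/(_ eps eps0) nG := cG.
  have [d /= d0 hd] := nG.
  exists (Num.min d e) => /=; first by rewrite lt_min d0.
  move=> z /=; rewrite lt_min => /andP[zd ze].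
  case: eqVneq => [_|zc]; first by rewrite subrr normr0.
  have [|xi [_ xid] ->] := MVT_pt dF cF zc; first by rewrite distrC.
  rewrite mulfK ?subr_eq0 //; apply: hd => /=.
  by rewrite distrC; apply: lt_trans xid _; rewrite distrC.
- by rewrite eqxx.
Qed.

End OneVariable.

(** * The flat function exp(-1/t) *)

Section FlatExp.
Variable R : realType.
Implicit Types (P : {poly R}) (t : R).

(** The polynomial factor makes the family stable under differentiation, which replaces [P] by
    [X^2 (P - P')]. *)
Definition flat_exp P t : R := if 0 < t then P.[t^-1] * expR (- t^-1) else 0.

(** With [u = 1 / t >= 1], the polynomial is at most a constant times [u^n] and the exponential at
    most [(n+1)! / u^(n+1)], which leaves one factor [1 / u = t]. *)
Lemma flat_exp_bound P : exists2 C, 0 <= C &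
  forall t, `|t| <= 1 -> `|flat_exp P t| <= C * `|t|.
Proof.
pose n := size P; pose C := (\sum_(i < n) `|P`_i|) * n.+1`!%:R.
have S0 : 0 <= \sum_(i < n) `|P`_i| by exact: sumr_ge0.
exists C => [|t t1]; first by rewrite mulr_ge0.
rewrite /flat_exp; case: ifP => [t0|_]; last by rewrite normr0 !mulr_ge0.
rewrite (gtr0_norm t0) in t1 *; set u := t^-1.
have u1 : 1 <= u by rewrite /u invf_ge1.
have u0 : 0 < u by exact: lt_le_trans u1.
have Pu : `|P.[u]| <= (\sum_(i < n) `|P`_i|) * u ^+ n.
  rewrite horner_coef; apply: le_trans (ler_norm_sum _ _ _) _.
  rewrite mulr_suml; apply: ler_sum => i _.
  rewrite normrM ler_wpM2l // normrX (gtr0_norm u0).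
  by apply: ler_weXn2l => //; exact: ltnW.
have Eu : expR (- u) <= n.+1`!%:R / u ^+ n.+1.
  have f0 : 0 < n.+1`!%:R :> R by rewrite ltr0n fact_gt0.
  have := expR_ge1Dxn n (ltW u0); rewrite expRN => h.
  rewrite -[leRHS]invrK lef_pV2 ?posrE ?expR_gt0 ?invr_gt0 ?divr_gt0 ?exprn_gt0 //.
  by rewrite invf_div; apply: le_trans h; rewrite lerDr.
rewrite normrM (gtr0_norm (expR_gt0 _)).
apply: le_trans (ler_pM _ _ Pu Eu) _ => //; first exact: expR_ge0.
rewrite exprS invfM /u !invrK -/u /C.
have un0 : u ^+ n != 0 by rewrite expf_neq0 // gt_eqF.
by rewrite le_eqVlt; apply/orP; left; apply/eqP; field.
Qed.

Lemma flat_exp_cont0 P : {for 0, continuous (flat_exp P)}.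
Proof.
have [C C0 hC] := flat_exp_bound P.
have f0 : flat_exp P 0 = 0 by rewrite /flat_exp ltxx.
rewrite /prop_for /continuous_at f0; apply/cvgrPdist_lt => e e0.
have C1 : 0 < C + 1 by rewrite ltr_wpDl.
exists (Num.min 1 (e / (C + 1))) => /=; first by rewrite lt_min ltr01 divr_gt0.
move=> t /=; rewrite !sub0r !normrN lt_min => /andP[t1 te].
apply: le_lt_trans (hC _ (ltW t1)) _.
apply: (@le_lt_trans _ _ ((C + 1) * `|t|)); first by rewrite ler_wpM2r // lerDl.
by rewrite mulrC -ltr_pdivlMr.
Qed.

(** Away from [0] this is the chain rule; at [0] both functions are continuous, so
    [is_derive_punctured] applies. *)
Lemma is_derive_flat_exp P t :
  is_derive t (1 : R) (flat_exp P) (flat_exp ('X^2 * (P - P^`())) t).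
Proof.
set Q := 'X^2 * _.
have pt x : x != 0 -> is_derive x (1 : R) (flat_exp P) (flat_exp Q x).
  rewrite neq_lt => /orP[x0|x0].
    have e0 : {near x, cst 0 =1 flat_exp P}.
      near=> y; rewrite /flat_exp ifN // -leNgt; apply: ltW.
      by near: y; exact: lt_nbhsl.
    apply: near_eq_is_derive e0 _.
    by rewrite /flat_exp ltNge (ltW x0) /=; exact: is_derive_cst.
  have e0 : {near x, (fun y => P.[y^-1] * expR (- y^-1)) =1 flat_exp P}.
    near=> y; rewrite /flat_exp ifT //.
    by near: y; exact: lt_nbhsr.
  apply: near_eq_is_derive e0 _.
  rewrite /flat_exp x0 /Q; have xn0 := lt0r_neq0 x0.
  have dP : is_derive x^-1 1 (horner P) P^`().[x^-1].
    by apply: DeriveDef; [exact: derivable_horner|rewrite -derive1E -derivE].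
  have dV : is_derive x (1 : R) (fun y : R => y^-1) (- x ^- 2 *: 1).
    exact: is_deriveV.
  have dN : is_derive x (1 : R) (fun y : R => - y^-1) (- (- x ^- 2 *: 1)).
    exact: is_deriveN.
  have dc := is_derive1_comp dP dV.
  have de := @is_derive1_comp R (@expR R) (fun y : R => - y^-1) x _ _
    (is_derive_expR (- x^-1)) dN.
  apply: is_derive_eq (is_deriveM dc de) _.
  rewrite /= !hornerE /GRing.scale /=; by field; rewrite xn0.
have [t0|t0] := eqVneq t 0; last exact: pt.
rewrite t0.
apply: (@is_derive_punctured R _ _ 0 1 ltr01) => [x x0 _||].
- exact: pt.
- exact: flat_exp_cont0.
- exact: flat_exp_cont0.
Unshelve. all: by end_near. Qed.

End FlatExp.

(** * Hadamard's lemma in one variable *)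

Section Hadamard.
Variables (R : realType) (f : nat -> R -> R) (c e : R).
Hypotheses (e0 : 0 < e)
  (df : forall n x, `|x - c| < e -> is_derive x 1 (f n) (f n.+1 x)).

(* The quotient [r] of [f 0 - f 0 c] by [x - c] has the derivatives
   [r^(n) = hadamard_num n / (x - c)^(n + 1)] away from [c]. *)
Fixpoint hadamard_num n (x : R) : R :=
  if n is n'.+1 then (x - c) ^+ n * f n x - n%:R * hadamard_num n' x
  else f 0 x - f 0 c.

(** The value at [c] is the one forced by Taylor expansion of the quotient. *)
Definition hadamard_quo n (x : R) : R :=
  if x == c then f n.+1 c / n.+1%:R else hadamard_num n x / (x - c) ^+ n.+1.

Lemma is_derive_Xc n (x : R) :
  is_derive x 1 (fun y : R => (y - c) ^+ n) (n%:R * (x - c) ^+ n.-1).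
Proof.
case: n => [|n]; first by rewrite mul0r; exact: is_derive_cst.
have d : is_derive x (1 : R) (fun y : R => y - c) 1.
  apply: is_derive_eq (is_deriveB (is_derive_id x 1) (is_derive_cst c x 1)) _.
  by rewrite subr0.
have -> : (fun y : R => (y - c) ^+ n.+1) = (fun y : R => y - c : R^o) ^+ n.+1.
  by apply/funext => y; rewrite exprfctE.
apply: is_derive_eq (@is_deriveX R R _ n.+1 x 1 _ d) _.
by rewrite /= /GRing.scale /= mulr1.
Qed.

(** The recursion telescopes: the derivative of the factor [(x - c) ^+ n.+1] cancels against the
    derivative of the subtracted multiple of the preceding numerator. *)
Lemma is_derive_num n x : `|x - c| < e ->
  is_derive x 1 (hadamard_num n) ((x - c) ^+ n * f n.+1 x).
Proof.
move=> xe; elim: n => [|n IH].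
  rewrite -[hadamard_num 0]/(f 0 - (cst (f 0 c) : R -> R^o)).
  apply: is_derive_eq (is_deriveB (df 0 xe) (is_derive_cst (f 0 c) x 1)) _.
  by rewrite subr0 mul1r.
have d1 := is_deriveM (is_derive_Xc n.+1 x) (df n.+1 xe).
have d2 := is_deriveZ n.+1%:R IH.
rewrite -[hadamard_num n.+1]/((fun y => (y - c) ^+ n.+1) * f n.+1 -
  n.+1%:R *: (hadamard_num n : R -> R^o)).
apply: is_derive_eq (is_deriveB d1 d2) _.
by rewrite /GRing.scale /=; ring.
Qed.

Lemma num_c n : hadamard_num n c = 0.
Proof.
elim: n => [|n IH] /=; first by rewrite subrr.
by rewrite IH subrr expr0n mul0r mulr0 subr0.
Qed.

(** Cauchy's mean value theorem for the numerator and [(x - c) ^+ n.+1]: the powers of [xi - c]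
    cancel in the quotient of the two derivatives. *)
Lemma quo_MVT n z : z != c -> `|z - c| < e ->
  exists2 xi, `|xi - c| < `|z - c| & hadamard_quo n z = f n.+1 xi / n.+1%:R.
Proof.
move=> zc ze.
(* Cauchy's auxiliary function, which vanishes at both [c] and [z]. *)
pose h x := hadamard_num n x * (z - c) ^+ n.+1 - hadamard_num n z * (x - c) ^+ n.+1.
pose dh x := (x - c) ^+ n * f n.+1 x * (z - c) ^+ n.+1 -
  hadamard_num n z * (n.+1%:R * (x - c) ^+ n).
have hd x : `|x - c| < e -> is_derive x 1 h (dh x).
  move=> xe.
  have d1 := is_deriveM (is_derive_num n xe) (is_derive_cst ((z - c) ^+ n.+1) x 1).
  have d2 := is_deriveZ (hadamard_num n z) (is_derive_Xc n.+1 x).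
  apply: is_derive_eq (is_deriveB d1 d2) _.
  by rewrite /GRing.scale /= /dh /cst; ring.
have hc : {for c, continuous h}.
  by apply: derive_cont (hd c _); rewrite subrr normr0.
have [xi [xic xiz] hxi] := MVT_pt (fun x _ xe => hd x xe) hc zc ze.
exists xi => //; rewrite /hadamard_quo (negPf zc).
have zc0 : z - c != 0 by rewrite subr_eq0.
have xc0 : xi - c != 0 by rewrite subr_eq0.
move: hxi; rewrite /h num_c (subrr c) expr0n mulr0 mul0r !subr0 subrr => /esym/eqP.
rewrite mulf_eq0 (negPf zc0) orbF subr_eq0 => /eqP hxi.
have n0 : n.+1%:R != 0 :> R by rewrite pnatr_eq0.
have zcn : (z - c) ^+ n.+1 != 0 by rewrite expf_neq0.
have xcn : (xi - c) ^+ n != 0 by rewrite expf_neq0.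
apply/eqP; rewrite eqr_div //; apply/eqP; apply: (mulfI xcn).
by rewrite mulrA [RHS]mulrA hxi; ring.
Qed.

Lemma quo_cont n : {for c, continuous (hadamard_quo n)}.
Proof.
have cf : {for c, continuous (f n.+1)}.
  by apply: derive_cont (df n.+1 _); rewrite subrr normr0.
have qc : hadamard_quo n c = f n.+1 c / n.+1%:R by rewrite /hadamard_quo eqxx.
rewrite /prop_for /continuous_at qc.
apply/cvgrPdist_lt => eps eps0.
have /cvgrPdist_lt/(_ (eps * n.+1%:R)) := cf.
case=> [|d /= d0 hd]; first by rewrite mulr_gt0 // ltr0n.
exists (Num.min d e) => /=; first by rewrite lt_min d0.
move=> z /=; rewrite lt_min => /andP[zd ze].
have [->|zc] := eqVneq z c.
  by rewrite qc subrr normr0.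
have [|xi xiz ->] := quo_MVT n zc; first by rewrite distrC.
rewrite -mulrBl normrM normfV (ger0_norm (ler0n R n.+1)) ltr_pdivrMr ?ltr0n //.
by apply: hd => /=; rewrite distrC; apply: lt_trans xiz _; rewrite distrC.
Qed.

Lemma is_derive_quo n x : `|x - c| < e ->
  is_derive x 1 (hadamard_quo n) (hadamard_quo n.+1 x).
Proof.
have pt y : y != c -> `|y - c| < e ->
    is_derive y 1 (hadamard_quo n) (hadamard_quo n.+1 y).
  move=> yc ye.
  have yc0 : y - c != 0 by rewrite subr_eq0.
  have ycn : (y - c) ^+ n.+1 != 0 by rewrite expf_neq0.
  have nr : {near y, (fun x => hadamard_num n x * ((x - c) ^+ n.+1)^-1) =1 hadamard_quo n}.
    exists `|y - c| => /=; first by rewrite normr_gt0.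
    move=> z /= zy; rewrite /hadamard_quo ifN //.
    by apply: contraTneq zy => ->; rewrite ltxx.
  apply: near_eq_is_derive nr _.
  have d1 := @is_deriveV R (fun x => (x - c) ^+ n.+1) y _ 1 ycn (is_derive_Xc n.+1 y).
  apply: is_derive_eq (is_deriveM (is_derive_num n ye) d1) _.
  rewrite /hadamard_quo (negPf yc) /GRing.scale /= !exprS.
  have ycn' : (y - c) ^+ n != 0 by rewrite expf_neq0.
  by field; rewrite yc0 ycn'.
move=> xe; have [xc|xc] := eqVneq x c; last exact: pt.
rewrite xc; apply: (is_derive_punctured e0 pt); exact: quo_cont.
Qed.

Lemma hadamard_quo0 x : f 0 x = f 0 c + (x - c) * hadamard_quo 0 x.
Proof.
rewrite /hadamard_quo; case: eqVneq => [->|xc]; first by rewrite subrr mul0r addr0.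
by rewrite /= expr1 mulrC divfK ?subr_eq0 // addrC subrK.
Qed.

End Hadamard.

(** * Smoothness of composites *)

Section SmoothComp.
Variables (R : realType) (n : nat) (W : set 'rV[R]_n).
Implicit Types (f g : 'rV[R]_n -> R^o) (js : seq 'I_n).

Lemma near_interior f g x : (forall y, W° y -> f y = g y) -> W° x ->
  {near x, f =1 g}.
Proof.
move=> fg Wx.
have : \near x, W° x by exact: open_nbhs_nbhs (conj (open_interior W) Wx).
by apply: filterS => y /fg.
Qed.

Lemma eq_partials f g js : (forall x, W° x -> f x = g x) ->
  forall x, W° x -> partials js f x = partials js g x.
Proof.
elim: js f g => [|j js IH] f g fg x Wx /=; first exact: fg.
by apply: IH Wx => y Wy; apply: near_eq_derive; exact: near_interior fg Wy.
Qed.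

(** Iterating partials never leaves the class [C], up to equality on the interior, so each iterated
    partial inherits continuity and derivability from a member of [C]. *)
Lemma smooth_coind (C : ('rV[R]_n -> R^o) -> Prop) :
  (forall g, C g -> forall x, W° x ->
     {for x, continuous g} /\ forall j, derivable g x (delta_mx 0 j)) ->
  (forall g j, C g -> exists2 g', C g' &
     forall x, W° x -> 'D_(delta_mx 0 j) g x = g' x) ->
  forall g, C g -> smooth_on W g.
Proof.
move=> C1 CD g Cg js.
suff [g' Cg' e] : exists2 g', C g' & forall x, W° x -> partials js g x = g' x.
  move=> x Wx; have [cg dg] := C1 _ Cg' _ Wx.
  have e' := near_interior (fun y Wy => esym (e y Wy)) Wx.
  split=> [|j]; last exact: near_eq_derivable e' (dg j).
  rewrite /prop_for /continuous_at (e _ Wx); apply: cvg_trans cg.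
  exact: (@near_eq_cvg _ _ (nbhs x) _ _ _ e').
elim: js g Cg => [|j js IH] g Cg; first by exists g.
have [g1 Cg1 e1] := CD _ j Cg; have [g2 Cg2 e2] := IH _ Cg1.
by exists g2 => // x Wx /=; rewrite (eq_partials _ e1) ?e2.
Qed.

Variables (f : 'rV[R]_n -> R^o) (r : nat -> R -> R).
Hypotheses (sf : smooth_on W f)
  (dr : forall k x, W° x -> is_derive (f x : R) 1 (r k) (r k.+1 (f x))).

(** By the chain rule a partial of [r k \o f] is [r k.+1 \o f] times a partial of [f]; closing under
    sums and products makes the class stable under partials. *)
Inductive comp_class : ('rV[R]_n -> R^o) -> Prop :=
| CompSmooth g of smooth_on W g : comp_class g
| CompDer k : comp_class (r k \o f)
| CompAdd g h of comp_class g & comp_class h : comp_class (g \+ h)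
| CompMul g h of comp_class g & comp_class h : comp_class (g \* h).

Lemma smooth0 g : smooth_on W g -> forall x, W° x ->
  {for x, continuous g} /\ forall j, derivable g x (delta_mx 0 j).
Proof. by move=> sg x Wx; exact: sg [::] x Wx. Qed.

Lemma is_derive_comp k x j : W° x ->
  is_derive x (delta_mx 0 j) (r k \o f : 'rV[R]_n -> R^o)
    (r k.+1 (f x) * 'D_(delta_mx 0 j) f x).
Proof.
move=> Wx; have [_ /(_ j) dfx] := smooth0 sf Wx; set v := delta_mx 0 j in dfx *.
(* On the line through [x] in direction [v] the partial derivative becomes an ordinary one, to which
   the one-variable chain rule applies. *)
pose F h : R := f (h *: v + x).
have F0 : F 0 = f x by rewrite /F scale0r add0r.
have e G : 'D_v G x = 'D_1 (fun h : R => G (h *: v + x) : R^o) 0.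
  rewrite /derive; set g1 := fun h => h^-1 *: _; set g2 := fun h => h^-1 *: _.
  suff -> : g1 = g2 by [].
  by apply/funext => h; rewrite /g1 /g2 /= addr0 scale0r add0r [_%:A]mulr1.
have dF : is_derive (0 : R) 1 F ('D_v f x).
  by rewrite e; apply: derivableP; exact: (derivable1P _ _ _).1.
have dr0 : is_derive (F 0) 1 (r k) (r k.+1 (f x)) by rewrite F0; exact: dr.
have dc := is_derive1_comp dr0 dF.
have [dc1 dc2] := dc.
by apply: DeriveDef; [exact/derivable1P|rewrite e -dc2].
Qed.

Lemma smooth_comp k : smooth_on W (r k \o f).
Proof.
apply: (@smooth_coind comp_class); last exact: CompDer.
- move=> g; elim=> {g} [g sg|l|g h _ IHg _ IHh|g h _ IHg _ IHh] x Wx.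
  + exact: smooth0.
  + have [cf _] := smooth0 sf Wx; split=> [|j].
      apply: continuous_comp => //; apply: (derive_cont (dr l Wx)).
    by case: (is_derive_comp l j Wx).
  + have [cg dg] := IHg x Wx; have [ch dh] := IHh x Wx.
    by split=> [|j]; [exact: continuousD|exact: derivableD].
  + have [cg dg] := IHg x Wx; have [ch dh] := IHh x Wx.
    by split=> [|j]; [exact: continuousM|exact: derivableM].
move=> g j Cg; suff: exists2 g', comp_class g' & forall x, W° x ->
  is_derive x (delta_mx 0 j) g (g' x).
  by case=> g' Cg' e; exists g' => // x /e; case.
elim: Cg => {g} [g sg|l|g h Cg [g' Cg' eg] Ch [h' Ch' eh]|
    g h Cg [g' Cg' eg] Ch [h' Ch' eh]].
- exists ('D_(delta_mx 0 j) g); first by apply: CompSmooth => js; exact: (sg (j :: js)).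
  by move=> x Wx; apply: derivableP; have [_] := smooth0 sg Wx; exact.
- exists ((r l.+1 \o f) \* ('D_(delta_mx 0 j) f)).
    apply: CompMul; first exact: CompDer.
    by apply: CompSmooth => js; exact: (sf (j :: js)).
  by move=> x Wx; exact: is_derive_comp.
- exists (g' \+ h'); first exact: CompAdd.
  by move=> x Wx; apply: is_deriveD; [exact: eg|exact: eh].
- exists ((g \* h') \+ (h \* g')); first by apply: CompAdd; exact: CompMul.
  by move=> x Wx; apply: is_deriveM; [exact: eg|exact: eh].
Qed.

End SmoothComp.

(** * Bump functions on Euclidean space *)

Section Bump.
Variables (R : realType) (n : nat).

Lemma smooth_inv (W : set 'rV[R]_n) (f : 'rV[R]_n -> R^o) :
  smooth_on W f -> (forall x, W° x -> f x != 0) ->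
  smooth_on W (fun x => (f x)^-1 : R^o).
Proof.
move=> sf f0.
(* [r k] is the [k]-th derivative of [1 / t]. *)
pose r k (t : R) := (-1) ^+ k * k`!%:R * (t ^+ k.+1)^-1.
suff dr k x : W° x -> is_derive (f x : R) 1 (r k) (r k.+1 (f x)).
  apply: eq_smooth_on (smooth_comp sf dr 0) => x _.
  by rewrite /r /= expr0 fact0 !mul1r expr1.
move=> /f0; move: (f x : R) => t t0.
have tk m : t ^+ m != 0 by rewrite expf_neq0.
have dX : is_derive t 1 (fun y : R => y ^+ k.+1) (k.+1%:R * t ^+ k).
  have := is_derive_Xc 0 k.+1 t.
  by under eq_fun do rewrite subr0; rewrite subr0.
have d1 := @is_deriveV R (fun y => y ^+ k.+1) t _ 1 (tk k.+1) dX.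
have d2 := is_deriveZ ((-1) ^+ k * k`!%:R) d1.
apply: is_derive_eq d2 _.
rewrite /GRing.scale /r /= factS natrM !exprS.
by field; rewrite t0 tk.
Qed.

Lemma smooth_flat_exp (f : 'rV[R]_n -> R^o) :
  smooth_on setT f -> smooth_on setT (flat_exp 1 \o f : _ -> R^o).
Proof.
move=> sf.
pose P k := iter k (fun P : {poly R} => 'X^2 * (P - P^`())) 1.
have dr k x : (setT : set 'rV[R]_n)° x ->
    is_derive (f x : R) 1 (flat_exp (P k)) (flat_exp (P k.+1) (f x)).
  by move=> _; exact: is_derive_flat_exp.
exact: (smooth_comp (r := fun k => flat_exp (P k)) sf dr 0).
Qed.

Lemma flat_exp_ge0 (t : R) : 0 <= flat_exp 1 t.
Proof. by rewrite /flat_exp hornerC mul1r; case: ifP => // _; exact: expR_ge0. Qed.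

Lemma flat_exp_gt0 (t : R) : (0 < flat_exp 1 t) = (0 < t).
Proof.
by rewrite /flat_exp hornerC mul1r; case: ifP => // _; rewrite ?expR_gt0 ?ltxx.
Qed.

Lemma flat_exp0 (t : R) : t <= 0 -> flat_exp 1 t = 0.
Proof. by rewrite /flat_exp leNgt => /negPf ->. Qed.

(** The function is [u / (u + v)], where [u] is the flat exponential of [dl^2 - s], [v] that of
    [s - (dl/2)^2], and [s] the squared Euclidean distance to [c]: [u] vanishes from radius [dl] on,
    [v] within radius [dl/2], and never both. The cube [K] is compact as a product of segments. *)
Lemma bump_rV (c : 'rV[R]_n) (W : set 'rV[R]_n) : open W -> W c ->
  exists (b : 'rV[R]_n -> R^o) (K N : set 'rV[R]_n),
    [/\ smooth_on setT b, compact K, K `<=` W, open N /\ N c &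
        N `<=` K /\ forall x, (N x -> b x = 1) /\ (~ K x -> b x = 0)].
Proof.
move=> oW Wc.
have [e /= e0 eW] : nbhs_ball c W by apply/nbhs_ballP; exact: open_nbhs_nbhs.
(* The radius is halved so that the closed cube [K] of half side [dl] lies in the open sup-norm ball
   of radius [e]. *)
pose dl := e / 2; have dl0 : 0 < dl by rewrite divr_gt0.
pose s (x : 'rV[R]_n) : R^o := \sum_i (x 0 i - c 0 i) ^+ 2.
have ss : smooth_on setT s.
  apply: smooth_on_sum => i.
  have sd : smooth_on setT (fun x : 'rV[R]_n => x 0 i - c 0 i : R^o).
    by apply: smooth_onD; [exact: smooth_on_coord|exact: smooth_on_cst].
  exact: (smooth_onM sd sd).
have s0 (x : 'rV[R]_n) : 0 <= s x by apply: sumr_ge0 => i _; exact: sqr_ge0.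
have sle (x : 'rV[R]_n) i : (x 0 i - c 0 i) ^+ 2 <= s x.
  by rewrite /s (bigD1 i) //= lerDl sumr_ge0 // => j _; exact: sqr_ge0.
have sn : smooth_on setT (fun x => - s x : R^o).
  apply: eq_smooth_on (smooth_onM (@smooth_on_cst R n setT (-1)) ss) => x _.
  by rewrite /= mulN1r.
have su : smooth_on setT (fun x => dl ^+ 2 - s x : R^o).
  by apply: smooth_onD sn; exact: smooth_on_cst.
have sv : smooth_on setT (fun x => s x - (dl / 2) ^+ 2 : R^o).
  by apply: smooth_onD ss _; exact: smooth_on_cst.
have gu := smooth_flat_exp su; have gv := smooth_flat_exp sv.
set u := _ \o _ in gu; set v := _ \o _ in gv.
have lt2 : (dl / 2) ^+ 2 < dl ^+ 2.
  by rewrite ltr_pXn2r // ?nnegrE ?divr_ge0 ?ltW // ltr_pdivrMr // ltr_pMr // ltr1n.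
have uv0 (x : 'rV[R]_n) : u x + v x != 0.
  rewrite gt_eqF //; have [h|h] := ltP (s x) (dl ^+ 2).
    by rewrite ltr_pwDl ?flat_exp_ge0 // flat_exp_gt0 subr_gt0.
  by rewrite ltr_wpDl ?flat_exp_ge0 // flat_exp_gt0 subr_gt0 (lt_le_trans lt2).
have cs : continuous s.
  by move=> x; have [] := ss [::] x; rewrite ?interiorT.
pose K : set 'rV[R]_n := [set x | forall i, `[c 0 i - dl, c 0 i + dl]%classic (x 0 i)].
pose N : set 'rV[R]_n := [set x | s x < (dl / 2) ^+ 2].
have sK (x : 'rV[R]_n) : s x <= dl ^+ 2 -> K x.
  move=> h i; rewrite /= in_itv /=.
  have h2 := le_trans (sle x i) h.
  have : `|x 0 i - c 0 i| <= dl.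
    by rewrite -(@ler_pXn2r _ 2) ?nnegrE ?normr_ge0 ?(ltW dl0) // real_normK ?num_real.
  by rewrite ler_norml => /andP[? ?]; apply/andP; split; lra.
exists (u \* (fun x => (u x + v x)^-1)), K, N; split.
- exact: (smooth_onM gu (smooth_inv (smooth_onD gu gv) (fun x _ => uv0 x))).
- apply: (@rV_compact R n (fun i => `[c 0 i - dl, c 0 i + dl]%classic)) => i.
  exact: segment_compact.
- move=> x Kx; apply: eW; split=> // i j; rewrite ord1.
  have := Kx j; rewrite /= in_itv /= /ball /= => /andP[h1 h2].
  rewrite ltr_norml; apply/andP; split; rewrite /dl in h1 h2; lra.
- split; last first.
    rewrite /N /= /s big1 ?exprn_gt0 ?divr_gt0 // => i _; first by rewrite subrr expr0n.
  by move/continuousP : cs => /(_ _ (lray_open _)); apply.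
split=> [x Nx|x]; first by apply: sK; apply: ltW; apply: lt_trans lt2.
split=> [Nx|Kx] /=.
  have -> : v x = 0 by rewrite /v /= flat_exp0 // subr_le0 ltW.
  rewrite addr0 mulfV // gt_eqF // /u /= flat_exp_gt0 subr_gt0.
  exact: lt_trans lt2.
rewrite /u /= flat_exp0 ?mul0r // subr_le0; apply/ltW; rewrite ltNge.
by apply/negP => /sK.
Qed.

End Bump.

(** * Charts and bump functions *)

Section GFunc.
Variables (R : realType) (n : nat) (dd : seq int).

Fact gfunc_subproof (W : set 'rV[R]_n) (f : 'rV[R]_n -> R^o) (sf : smooth_on W f) :
  (fun (m : monomial dd) x =>
     if (m == [ffun => 0%N]) && (x \in W) then f x else 0) \in gdom_pred W 0.
Proof.
have /asboolP[h1 h2 h3] := gdom_one_subproof dd W.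
apply/asboolP; split=> [m|m x Wx|m /h3 hm].
- apply: (eq_smooth_on _ (smooth_onM (h1 m) sf)) => x _ /=.
  by case: ifP; rewrite (mul1r, mul0r).
- by rewrite memNset ?andbF.
- apply/funext => x; case: ifP => // h.
  by have := congr1 (fun g => g x) hm; rewrite h => /eqP; rewrite oner_eq0.
Qed.

Definition gfunc W f sf : gdom_sec dd W 0 := GDomSec (@gfunc_subproof W f sf).

End GFunc.

Lemma compact_preim_val (T : topologicalType) (V K : set T) :
  compact K -> K `<=` V -> compact ((set_val : set_type V -> T) @^-1` K).
Proof.
move=> cK KV F FF FK.
have [y [Ky cy]] := cK _ (fmap_proper_filter set_val FF) FK.
exists (exist _ y (mem_set (KV _ Ky))); split=> // A B FA [B0 [[B1 oB1 <-] B1y] B0B].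
have [z [[a Aa <-] B1z]] : (set_val @` A) `&` B1 !=set0.
  apply: cy; last exact: open_nbhs_nbhs.
  rewrite nbhs_filterE /fmap /=.
  by apply: (filterS _ FA) => a Aa; exists a.
by exists a; split=> //; exact: B0B.
Qed.

Section Chart.
Variables (R : realType) (N : grspace R) (hN : is_gsheaf N).
Variables (U : set N) (n : nat) (dd : seq int) (V : set (gdom R n dd)).
Hypotheses (oU : open U) (oV : open V).
Variables (phi : gmap (grestr U) (grestr V)) (psi : gmap (grestr V) (grestr U)).
Hypotheses (hp : is_lrmap phi) (hq : is_lrmap psi)
  (e1 : geq (gcomp psi phi) (gid _)).

Let pp := lrmap_premap hp.
Let pq := lrmap_premap hq.

Definition param : gmap (grestr V) N := gcomp (gincl U) psi.

Lemma param_lrmap : is_lrmap param.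
Proof. by apply: comp_lrmap => //; exact: gincl_lrmap. Qed.

Let phiK (x : grestr U) : psi (phi x) = x := e1.1 x.

(** Pulling back along [psi] and then along [phi] is the identity on the chart, so nothing supported
    there is lost. *)
Lemma param_inj (A : set N) i (s : @gsec R N A i) : open A ->
  gpull param s = 0 -> rs (U `&` A) s = 0.
Proof.
move=> oA h.
have [_ /(_ _ i (gpull (gincl U) s)) e] := (geqP _ _).1 e1.
have opA : open ((set_val : set_type U -> N) @^-1` A) by exact: open_pim.
have opA' := pre_open pq opA.
have oiA := open_im oU opA.
have := e opA; rewrite /= [gpull psi _]h (pull0 pp) // gresE => e'.
have sA : set_val @` ((set_val : set_type U -> N) @^-1` A) `<=` A.
  by rewrite im_pim; exact: subIsetr.
have key : rs (set_val @` ((set_val : set_type U -> N) @^-1` A)) s = 0.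
  rewrite -e' rs_grestr; last by move=> x; rewrite /preimage /= phiK.
  rewrite (rs0 (M := N) hN) //; first exact: (open_im oU (pre_open pp opA')).
  by apply: im_sub => x; rewrite /preimage /= phiK.
have sUA : U `&` A `<=` set_val @` ((set_val : set_type U -> N) @^-1` A).
  by rewrite im_pim.
by rewrite -(rs_rs hN _ oA oiA _ sUA sA) ?key ?(rs0 hN) //; exact: openI.
Qed.

(** A bump function in the coordinates is pulled back to the chart and extended by zero. This
    extension glues because [KN], the image of a compact set in a Hausdorff space, is closed. *)
Lemma bump_chart (x : N) (W : set N) : hausdorff_space N ->
  U x -> open W -> W x ->
  exists (b : @gsec R N setT 0) (O K : set N), [/\ open O /\ O x, closed K,
    O `<=` K, K `<=` W & rs O b = gone O /\ rs (~` K) b = 0].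
Proof.
move=> hT Ux oW Wx; have lp := param_lrmap; have ppar := lrmap_premap lp.
have hG : is_gpre (grestr V) by apply: grestr_pre oV (@gdom_pre R n dd).
have hU : is_gpre (grestr U) by exact: grestr_pre.
pose xU : grestr U := exist _ x (mem_set Ux).
pose W' : set 'rV[R]_n := set_val @` (param @^-1` W).
have oW' : open W' by exact: (open_im oV (pre_open ppar oW)).
have W'c : W' (set_val (phi xU)).
  by exists (phi xU) => //; rewrite /preimage /= phiK.
have [f [K [N0 [sf cK KW' [oN0 N0c] [N0K hf]]]]] := bump_rV oW' W'c.
have KV : K `<=` V by move=> y /KW'[z _ <-]; exact: set_val_mem.
pose KN : set N := param @` (set_val @^-1` K).
have cKN : closed KN.
  apply: compact_closed => //; apply: continuous_compact.
    by apply: continuous_subspaceT; exact: (pre_cont ppar).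
  exact: compact_preim_val.
have KNW : KN `<=` W.
  by move=> _ [y Ky <-]; have [z Wz /val_inj_set <-] := KW' _ Ky.
pose A : set 'rV[R]_n := set_val @` (setT : set (grestr V)).
have sfA : smooth_on A f by apply: smooth_on_sub sf.
pose s : @gsec R (grestr V) setT 0 := gfunc dd sfA.
pose UU : set N := set_val @` (setT : set (grestr U)).
pose bU : @gsec R N UU 0 := gpull phi s.
have oUU : open UU by exact: open_im.
have UUE : UU = U.
  by rewrite /UU -[X in _ @` X]/(set_val @^-1` setT) im_pim setIT.
pose E1 : set (grestr V) := set_val @^-1` (~` K).
pose E2 : set (grestr V) := set_val @^-1` N0.
have oE1 : open E1.
  by apply: open_pim; apply: closed_openC; apply: compact_closed.
have oE2 : open E2 by exact: open_pim.
have s1 : rs E1 s = 0.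
  rewrite rs_grestr // -(gresE (im_sub (@subsetT _ E1))) /=.
  apply: gcoef_eq => m y /=.
  case: ifP => // /set_mem[z Kz zy]; case: ifP => // _.
  by rewrite -zy (hf _).2.
have s2 : rs E2 s = gone E2.
  rewrite rs_grestr // -(gresE (im_sub (@subsetT _ E2))) /=.
  apply: gcoef_eq => m y /=.
  case: ifP => yE; last by rewrite andbF.
  have /set_mem[z Nz zy] := yE.
  have -> : (y \in A) by apply: mem_set; exists z.
  by rewrite -zy (hf _).1 //; case: ifP.
have bE (E : set (grestr V)) : open E ->
    rs (set_val @` (phi @^-1` E)) bU = gpull phi (rs E s).
  by move=> oE; rewrite (prepull_rs pp) // rs_grestr.
have oE1' := open_im oU (pre_open pp oE1).
have oE2' := open_im oU (pre_open pp oE2).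
have KNU : KN `<=` U by move=> _ [y Ky <-]; exact: set_val_mem.
have sub1 : UU `&` ~` KN `<=` set_val @` (phi @^-1` E1).
  move=> _ [[u _ <-] uK]; exists u => // Ku; apply: uK.
  by exists (phi u) => //=; rewrite phiK.
have oI : open (UU `&` ~` KN) by apply: openI => //; exact: closed_openC.
have oC : open (~` KN) by exact: closed_openC.
have e0 : rs (UU `&` ~` KN) bU = 0.
  have sub2 : set_val @` (phi @^-1` E1) `<=` UU by exact: im_sub.
  rewrite -(rs_rs hN _ oUU oE1' oI sub1 sub2) bE // s1 (pull0 pp) //.
  by rewrite (rs0 (M := N) hN).
pose F (t : bool) : set N := if t then UU else ~` KN.
pose sF t : @gsec R N (F t) 0 := if t return @gsec R N (F t) 0 then bU else 0.
have [t|||b hb] := glue hN (s := sF) (V := setT).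
- by case: t.
- rewrite eqEsubset; split=> // y _.
  have [Ky|Ky] := pselect (KN y); last by exists false.
  by exists true => //=; rewrite UUE; exact: KNU.
- case=> [] [] //=.
  + by rewrite e0 (rs0 hN).
  + by rewrite setIC e0 (rs0 hN) // setIC.
exists b, (set_val @` (phi @^-1` E2)), KN; split=> //.
- split=> //; exists xU => //; exact: N0c.
- move=> _ [u Nu <-]; exists (phi u); last by rewrite /= phiK.
  exact: N0K.
split; last exact: (hb false).
have sub3 : set_val @` (phi @^-1` E2) `<=` UU by exact: im_sub.
rewrite -(rs_rs hN _ _ oUU oE2' sub3) // (hb true) bE // s2 (prepull1 pp) //.
Qed.

End Chart.

(** * Localisation of vector fields *)

Section Localize.
Variables (R : realType) (N : grspace R).
Hypothesis mN : gmanifold N.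

Let hN : is_gsheaf N := gman_sheaf mN.

Lemma bump_gmanifold (x : N) (W : set N) : open W -> W x ->
  exists (b : @gsec R N setT 0) (O K : set N), [/\ open O /\ O x, closed K,
    O `<=` K, K `<=` W & rs O b = gone O /\ rs (~` K) b = 0].
Proof.
move=> oW Wx; have [U [n [d [V [oU Ux _ oV [phi [psi [hp hq e1 _]]]]]]]] := gman_chart mN x.
exact: (bump_chart hN oU oV hp hq e1 (gman_hausdorff mN) Ux oW Wx).
Qed.

(** Multiplying [a] by a bump supported in [W] and extending by zero gives a global section with the
    same germ at [x]. *)
Lemma germ_ext (W : set N) i (a : gsec W i) x : open W -> W x ->
  exists (al : @gsec R N setT i) (O : set N),
    [/\ open O, O x, O `<=` W & rs O al = rs O a].
Proof.
move=> oW Wx; have [b [O [K [[oO Ox] cK OK KW [b1 b0]]]]] := bump_gmanifold oW Wx.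
have oC : open (~` K) by exact: closed_openC.
have OW := subset_trans OK KW.
pose F (t : bool) : set N := if t then W else ~` K.
pose sF t : @gsec R N (F t) i :=
  if t return @gsec R N (F t) i then gmul i (rs W b) a else 0.
have oI : open (W `&` ~` K) by exact: openI.
have e0 : rs (W `&` ~` K) (gmul i (rs W b) a) = 0.
  have sW := @subIsetl _ W (~` K); have sK := @subIsetr _ W (~` K).
  rewrite (rsM hN _ _ _ oW oI sW) (rs_rs hN b openT oW oI sW) //.
  by rewrite -(rs_rs hN b openT oC oI sK) // b0 (rs0 hN) // gmul0l.
have [t|||al hal] := glue hN (s := sF) (V := setT).
- by case: t.
- rewrite eqEsubset; split=> // y _.
  have [Ky|Ky] := pselect (K y); last by exists false.
  by exists true => //; exact: KW.
- case=> [] [] //=.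
  + by rewrite e0 (rs0 hN).
  + by rewrite setIC e0 (rs0 hN) // setIC.
exists al, O; split=> //.
rewrite -(rs_rs hN al _ oW oO OW) // (hal true) rsM // rs_rs // b1 gmul1l //.
Qed.

Variables (k : int) (Y : gfield N).
Hypothesis hY : is_gfield k Y.

Lemma gfieldB i j (a b : @gsec R N setT i) : Y j (a - b) = Y j a - Y j b.
Proof.
have -> : a - b = -1 *: b + a by rewrite scaleN1r addrC.
by rewrite (gfieldL hY) scaleN1r addrC.
Qed.

Lemma gfield0E i j : Y j (0 : @gsec R N setT i) = 0.
Proof. by have := gfieldB j (0 : @gsec R N setT i) 0; rewrite !subrr. Qed.

(** For a bump [b] supported in [V], [b al = 0] globally, so [0 = Y(b) al + b Y(al)]; near [x] the
    first term vanishes with [al], and [b] is [1]. *)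
Lemma gfield_local i (al : @gsec R N setT i) (V : set N) : open V ->
  rs V al = 0 -> rs V (Y (i + k) al) = 0.
Proof.
move=> oV al0; apply: (gsec_eq hN) => // x Vx.
have [b [O [K [[oO Ox] cK OK KV [b1 b0]]]]] := bump_gmanifold oV Vx.
have OV := subset_trans OK KV; exists O; split=> //.
have oC : open (~` K) by exact: closed_openC.
have bal : gmul (0 + i) b al = 0.
  apply: (gsec_eq hN) => // y _; have [Ky|Ky] := pselect (K y).
    exists V; split=> //; first exact: KV.
    by rewrite rsM // al0 gmul0r // (rs0 hN).
  by exists (~` K); split=> //; rewrite rsM // b0 gmul0l // (rs0 hN).
have := gfieldM hY (i + k) b al; rewrite bal gfield0E => /(congr1 (rs O)).
rewrite (rs0 hN) // rsD // rsZ // !rsM // b1.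
rewrite -[rs O al](rs_rs hN _ _ oV) // al0 (rs0 hN) // gmul0r // add0r.
rewrite gmul1l // /ksign andbF expr0 scale1r => e.
by rewrite rs_rs // -e (rs0 hN).
Qed.

(** A field is given on global sections, whereas a graded map needs pullbacks over every open set.
    The value of the field on [a] is pinned down by the global sections that agree with [a]
    somewhere. *)
Definition locf_spec (W : set N) i (a : gsec W i) (t : gsec W (i + k)) :=
  forall (V : set N) (al : @gsec R N setT i), open V -> V `<=` W ->
    rs V al = rs V a -> rs V t = rs V (Y (i + k) al).

Lemma locf_ex (W : set N) i (a : gsec W i) : open W ->
  exists t, locf_spec a t.
Proof.
move=> oW.
(* Gluing over all pairs of an open set and a global section that agrees with [a] on it avoids
   choosing extensions; compatibility is [gfield_local] applied to differences. *)
pose I := {p : set N * @gsec R N setT i |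
  [/\ open p.1, p.1 `<=` W & rs p.1 p.2 = rs p.1 a]}.
have [p|||t ht] := @glue _ _ hN I (fun p => (sval p).1) W (i + k)
  (fun p => rs _ (Y (i + k) (sval p).2)).
- by case: p => p [].
- rewrite eqEsubset; split=> [y Wy|y [[p []]] //=]; last by move=> _ + _ _; apply.
  have [al [O [oO Oy OW e]]] := germ_ext a oW Wy.
  by exists (exist _ (O, al) (And3 oO OW e)).
- move=> [[V1 a1] /= [oV1 VW1 e1]] [[V2 a2] /= [oV2 VW2 e2]].
  have sl := @subIsetl _ V1 V2; have sr := @subIsetr _ V1 V2.
  have oV : open (V1 `&` V2) by exact: openI.
  rewrite !rs_rs //; apply/eqP; rewrite -subr_eq0 -rsB // -gfieldB.
  apply/eqP/gfield_local => //; rewrite rsB //.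
  rewrite -(rs_rs hN a1 _ oV1 oV sl) // -(rs_rs hN a2 _ oV2 oV sr) // e1 e2.
  by rewrite !rs_rs // subrr.
exists t => V al oV VW e; exact: (ht (exist _ (V, al) (And3 oV VW e))).
Qed.

(** [0] is a junk value: for [W] open and [Y] a field on a graded manifold the specified section
    exists, by [locf_ex]. *)
Definition locf (W : set N) i (a : gsec W i) : gsec W (i + k) :=
  if pselect (exists t, locf_spec a t) is left h then projT1 (cid h) else 0.

Lemma locfP (W : set N) i (a : gsec W i) : open W -> locf_spec a (locf a).
Proof.
move=> /(locf_ex a) h; rewrite /locf; case: pselect => // h'.
exact: (projT2 (cid h')).
Qed.

Lemma locf_eq (W : set N) i (a : gsec W i) t : open W ->
  (forall x V (al : @gsec R N setT i), open V -> V x -> V `<=` W ->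
    rs V al = rs V a -> rs V t = rs V (Y (i + k) al)) -> locf a = t.
Proof.
move=> oW h; apply: (gsec_eq hN) => // x Wx.
have [al [O [oO Ox OW e]]] := germ_ext a oW Wx.
exists O; split=> //.
by rewrite (locfP (a := a) oW oO OW e) (h x O al).
Qed.

Lemma locfL (W : set N) i c (a b : gsec W i) : open W ->
  locf (c *: a + b) = c *: locf a + locf b.
Proof.
move=> oW; apply: (gsec_eq hN) => // x Wx.
have [a' [O1 [oO1 O1x O1W e1]]] := germ_ext a oW Wx.
have [b' [O2 [oO2 O2x O2W e2]]] := germ_ext b oW Wx.
have sl := @subIsetl _ O1 O2; have sr := @subIsetr _ O1 O2.
have oO : open (O1 `&` O2) by exact: openI.
have OW : O1 `&` O2 `<=` W by exact: subset_trans sl O1W.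
have {}e1 : rs (O1 `&` O2) a' = rs (O1 `&` O2) a.
  by rewrite -(rs_rs hN a' _ oO1) // e1 rs_rs.
have {}e2 : rs (O1 `&` O2) b' = rs (O1 `&` O2) b.
  by rewrite -(rs_rs hN b' _ oO2) // e2 rs_rs.
exists (O1 `&` O2); split=> //.
have e3 : rs (O1 `&` O2) (c *: a' + b') = rs (O1 `&` O2) (c *: a + b).
  by rewrite !rsL // e1 e2.
rewrite (locfP oW oO OW e3) (gfieldL hY) !rsL //.
by rewrite (locfP oW oO OW e1) (locfP oW oO OW e2).
Qed.

Lemma locfM (W : set N) i j (a : gsec W i) (b : gsec W j) q : open W ->
  q = i + j ->
  locf (gmul q a b) = gmul (q + k) (locf a) b +
    ksign R k i *: gmul (q + k) a (locf b).
Proof.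
move=> oW ->; apply: (gsec_eq hN) => // x Wx.
have [a' [O1 [oO1 O1x O1W e1]]] := germ_ext a oW Wx.
have [b' [O2 [oO2 O2x O2W e2]]] := germ_ext b oW Wx.
have sl := @subIsetl _ O1 O2; have sr := @subIsetr _ O1 O2.
have oO : open (O1 `&` O2) by exact: openI.
have OW : O1 `&` O2 `<=` W by exact: subset_trans sl O1W.
have {}e1 : rs (O1 `&` O2) a' = rs (O1 `&` O2) a.
  by rewrite -(rs_rs hN a' _ oO1) // e1 rs_rs.
have {}e2 : rs (O1 `&` O2) b' = rs (O1 `&` O2) b.
  by rewrite -(rs_rs hN b' _ oO2) // e2 rs_rs.
exists (O1 `&` O2); split=> //.
have e3 : rs (O1 `&` O2) (gmul (i + j) a' b') = rs (O1 `&` O2) (gmul (i + j) a b).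
  by rewrite !rsM // e1 e2.
rewrite (locfP oW oO OW e3) (gfieldM hY) !rsD // !rsZ // !rsM // e1 e2.
by rewrite (locfP oW oO OW e1) (locfP oW oO OW e2).
Qed.

Lemma locf_rs (V W : set N) i (a : gsec W i) : open V -> open W -> V `<=` W ->
  locf (rs V a) = rs V (locf a).
Proof.
move=> oV oW VW; apply: locf_eq => // x O al oO Ox OV e.
rewrite rs_rs //; apply: (locfP oW) => //; first exact: subset_trans VW.
by rewrite e rs_rs.
Qed.

Lemma locf_setT i (a : @gsec R N setT i) : locf a = Y (i + k) a.
Proof.
have := @locfP setT i a openT setT a openT (@subset_refl _ _) erefl.
by rewrite !(rs_id hN).
Qed.

End Localize.

(** If a global section agrees with [a] near a point, its pullback agrees with that of [a] on the
    preimage, so relatedness on global sections suffices. *)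
Lemma locf_rel (R : realType) (Q N : grspace R) (mQ : gmanifold Q)
    (mN : gmanifold N) (phi : gmap Q N) (k : int) (X : gfield Q) (Y : gfield N)
    (W : set N) i (a : gsec W i) :
  is_lrmap phi -> is_gfield k X -> is_gfield k Y -> grelated phi X Y -> open W ->
  locf k X (gpull phi a) = gpull phi (locf k Y a).
Proof.
move=> hp hX hY rel oW; have pp := lrmap_premap hp.
have hQ := gman_sheaf mQ; have oW' := pre_open pp oW.
apply: (gsec_eq hQ) => // x Wx.
have [al [O [oO Ox OW e]]] := germ_ext mN a oW Wx.
have oO' := pre_open pp oO.
have sub : phi @^-1` O `<=` phi @^-1` W by exact: preimage_subset.
exists (phi @^-1` O); split=> //.
have e' : rs (phi @^-1` O) (gpull phi al) = rs (phi @^-1` O) (gpull phi a).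
  by rewrite -!(prepull_rs pp) // e.
rewrite (locfP mQ hX oW' oO' sub e') rel -!(prepull_rs pp) //.
by rewrite (locfP mN hY oW oO OW e).
Qed.

(** * Maps to the graded line *)

Section Order.
Variables (R : realType) (n : nat) (dd : seq int) (W : set 'rV[R]_n) (y : 'rV[R]_n).

Definition msize (m : monomial dd) : nat := (\sum_a m a)%N.

Definition eq_upto N i (a b : gdom_sec dd W i) : Prop :=
  forall m, (msize m < N)%N -> a m y = b m y.

Lemma madm0 : madm ([ffun => 0%N] : monomial dd).
Proof. by apply/forallP => a; rewrite ffunE implybT. Qed.

Lemma mdeg0 : mdeg ([ffun => 0%N] : monomial dd) = 0.
Proof. by rewrite /mdeg big1 // => a _; rewrite ffunE. Qed.

Lemma ev_mul i j (s : gdom_sec dd W i) (t : gdom_sec dd W j) :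
  gdom_mul 0 s t [ffun => 0%N] y = s [ffun => 0%N] y * t [ffun => 0%N] y.
Proof.
rewrite gdom_mulE madm0 mdeg0 eqxx /=.
pose l0 : {dffun forall a, 'I_(([ffun=> 0%N] : monomial dd) a).+1} := [ffun a => ord0].
rewrite (bigD1 l0) //= big1 ?addr0 => [|l].
  have -> : [ffun a => l0 a : nat] = [ffun => 0%N].
    by apply/ffunP => a; rewrite [LHS]ffunE [RHS]ffunE [X in nat_of_ord X]ffunE.
  have -> : fsub [ffun => 0%N] [ffun => 0%N] = [ffun => 0%N] :> monomial dd.
    by apply/ffunP => a; rewrite !ffunE.
  rewrite /msign big1 ?mul1r // => a _; rewrite big1 // => b _.
  by rewrite !ffunE /ksign.
move=> /eqP[]; apply/ffunP => a; apply: val_inj.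
have h (u : 'I_(([ffun=> 0%N] : monomial dd) a).+1) : u = 0%N :> nat.
  by case: u => u /=; rewrite ffunE ltnS leqn0 => /eqP.
by rewrite /= !h.
Qed.

(** The summand with zero exponent in [s] vanishes; in every other one the exponent left for [a] and
    [b] has smaller size than [m], which gains one order. *)
Lemma eq_upto_mul N i j k (s : gdom_sec dd W i) (a b : gdom_sec dd W j) :
  s [ffun => 0%N] y = 0 -> eq_upto N a b ->
  eq_upto N.+1 (gdom_mul k s a) (gdom_mul k s b).
Proof.
move=> s0 ab m mN; rewrite !gdom_mulE; case: ifP => // _.
apply: eq_bigr => l _; set l1 := [ffun a => _].
have [->|l0] := eqVneq l1 [ffun => 0%N]; first by rewrite s0 !mul0r.
congr (_ * (_ * _)); apply: ab.
rewrite -ltnS; apply: leq_trans mN; rewrite ltnS /msize.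
have lm x : (l1 x <= m x)%N by rewrite ffunE -ltnS.
have [x lx] : exists x, (0 < l1 x)%N.
  apply/existsP; apply: contraR l0; rewrite negb_exists => /forallP h.
  by apply/eqP/ffunP => x; have := h x; rewrite lt0n negbK => /eqP ->; rewrite ffunE.
rewrite (bigD1 x) //= [X in (_ < X)%N](bigD1 x) //= -addSn leq_add //.
  have -> : fsub m l1 x = (m x - l1 x)%N by rewrite [LHS]ffunE.
  by have := lm x; move: lx; move: (l1 x) (m x) => u v; lia.
by apply: leq_sum => z _; rewrite [X in (X <= _)%N]ffunE leq_subr.
Qed.

End Order.

(** The constant [c] placed in an arbitrary degree: the product makes it zero unless [i = 0], with
    no transport between degrees. *)
Definition gconst (R : realType) (M : grspace R) (W : set M) i (c : R) : gsec W i :=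
  gmul i (c *: gone W) (gone W).
Arguments gconst {R M} W i c.

Lemma pull_gconst (R : realType) (M N : grspace R) (phi : gmap M N) (W : set N) i c :
  is_premap phi -> open W -> gpull phi (gconst W i c) = gconst (phi @^-1` W) i c.
Proof.
by move=> hp oW; rewrite /gconst (prepullM hp) // pullZ // !(prepull1 hp).
Qed.

Section LineLike.
Variables (R : realType) (n1 : nat) (dd1 : seq int).
Local Notation T := (gdom R n1 dd1).
Variables (i0 : int) (tau : @gsec R T setT i0).

(** Vanishing is formulated on pullbacks to graded domains, the form in which the induction on
    orders consumes it; it covers the function [t - c0] on the line as well as the coordinate of
    non-zero degree over the point. *)
Definition vanish_at (W : set T) i (s : gsec W i) (t0 : T) : Prop :=
  forall n dd (V : set (gdom R n dd)) (h : gmap (grestr V) T), open V ->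
    is_premap h -> forall y, h y = t0 ->
    (gpull h s : gdom_sec dd _ i) [ffun => 0%N] (set_val y) = 0.

(** The degree [l] of the remainder is left open, so that one statement serves the real line, where
    [l = 0], and the graded line, where dividing by the coordinate shifts the degree. *)
Definition hadamard_at (t0 : T) : Prop :=
  forall (W : set T) i (f : gsec W i), open W -> W t0 ->
  exists (W' : set T) c c0 l (r : gsec W' l), [/\ open W', W' t0, W' `<=` W,
    vanish_at (rs W' tau - gconst W' i0 c0) t0 &
    rs W' f = gconst W' i c + gmul i (rs W' tau - gconst W' i0 c0) r].

Hypothesis hT : forall t0, hadamard_at t0.

(** Equality in a graded domain can be tested on each coefficient at each point, and every exponent
    has finite size, so agreement to every order at every point is enough. *)
Lemma chart_map_eq n dd (V : set (gdom R n dd)) (h h' : gmap (grestr V) T) :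
  open V -> is_premap h -> is_premap h' -> h =1 h' ->
  gpull h tau = gpull h' tau -> geq h h'.
Proof.
case: h h' => f p [g q] oV ph ph' /= /funext fg; subst g => etau.
have hV : is_gpre (grestr V) by apply: grestr_pre oV (@gdom_pre R n dd).
have rs_coef (A A' : set (grestr V)) i (s : @gsec R (grestr V) A i) y m : A' `<=` A ->
    A' y -> (rs A' s : gdom_sec dd _ i) m (set_val y) = (s : gdom_sec dd _ i) m (set_val y).
  move=> AA Ay; rewrite -(gresE AA) /= mem_set //; by exists y.
(* [W] and the degree are generalised because the remainder [r] lives on a smaller open set and in
   another degree. The factor [sg] below has the same image under both pullbacks, with zero constant
   term at [y], so agreement on [r] below order [N] gives agreement on [s] below order [N.+1]. *)
have key N : forall (W : set T) i (s : gsec W i) y, open W -> W (f y) ->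
    eq_upto (set_val y) N (p W i s : gdom_sec dd _ i) (q W i s).
  elim: N => [//|N IH] W i s y oW Wy m mN.
  have [W' [c [c0 [l [r [oW' W'y sub van e]]]]]] := @hT (f y) W i s oW Wy.
  have sub' : f @^-1` W' `<=` f @^-1` W by exact: preimage_subset.
  rewrite -(rs_coef _ (f @^-1` W') _ (p W i s)) // -(rs_coef _ (f @^-1` W') _ (q W i s)) //.
  have ep := prepull_rs ph s oW oW' sub; have eq := prepull_rs ph' s oW oW' sub.
  rewrite /= in ep eq; rewrite -ep -eq e.
  have := pullD ph; rewrite /= => pD; have := pullD ph'; rewrite /= => qD.
  rewrite pD // qD // -[p W' i (gconst _ _ _)]/(gpull (GMap p) _).
  rewrite -[q W' i (gconst _ _ _)]/(gpull (GMap q) _) !pull_gconst //.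
  set sg := _ - _ in van *.
  have esg : p W' i0 sg = q W' i0 sg.
    rewrite -[LHS]/(gpull (GMap p) _) -[RHS]/(gpull (GMap q) _) /sg !pullB //.
    by rewrite !pull_gconst // (prepull_rs ph) // (prepull_rs ph') //= etau.
  have := prepullM ph; rewrite /= => pM; have := prepullM ph'; rewrite /= => qM.
  rewrite pM // qM //. 
  set F := (X in (X + _) m _ = _).
  rewrite -[LHS]/(F m _ + gdom_mul i (p W' i0 sg) (p W' l r) m _).
  rewrite -[RHS]/(F m _ + gdom_mul i (q W' i0 sg) (q W' l r) m _); congr (_ + _).
  rewrite esg; apply: (@eq_upto_mul _ _ _ _ _ N) mN.
    exact: (van n dd V (GMap q) oV ph' y).
  exact: IH.
apply/geqP; split=> // W i s oW; rewrite (rs_id hV) /=; last exact: (pre_open ph oW).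
apply: gcoef_eq => m x.
have [[y Wy <-]|Wx] := pselect ((set_val @` (f @^-1` W)) x).
  exact: (key (msize m).+1 W i s y oW Wy).
by rewrite !gcoef_out.
Qed.

End LineLike.

Lemma rs_grestr_coef (R : realType) n dd (V : set (gdom R n dd))
    (A A' : set (grestr V)) i (s : @gsec R (grestr V) A i) y m : A' `<=` A ->
  A' y -> (rs A' s : gdom_sec dd _ i) m (set_val y) =
    (s : gdom_sec dd _ i) m (set_val y).
Proof. by move=> AA Ay; rewrite -(gresE AA) /= mem_set //; exists y. Qed.

Lemma rs_gdom_coef (R : realType) n dd (A A' : set (gdom R n dd)) i
    (s : @gsec R (gdom R n dd) A i) y m : A' `<=` A ->
  A' y -> (rs A' s : gdom_sec dd _ i) m y = (s : gdom_sec dd _ i) m y.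
Proof. by move=> AA Ay; rewrite -(gresE AA) /= mem_set. Qed.

Section RealLine.
Variables (R : realType).
Local Notation T := (gdom R 1 [::]).
Variable tau : @gsec R T setT 0.
Hypothesis tauE : forall m x, (tau : gdom_sec [::] setT 0) m x = x 0 0.

Let mon0 (m : monomial [::]) : m = [ffun => 0%N].
Proof. by apply/ffunP => -[]. Qed.

Lemma gmul_lineE (W : set T) (s t : @gsec R T W 0) m x :
  (gmul 0 s t : gdom_sec [::] W 0) m x =
  (s : gdom_sec [::] W 0) m x * (t : gdom_sec [::] W 0) m x.
Proof. by rewrite !(mon0 m); exact: ev_mul. Qed.

Lemma gone_lineE (W : set T) m x : W x ->
  (gone W : gdom_sec [::] W 0) m x = 1.
Proof. by move=> Wx; rewrite /= (mon0 m) eqxx mem_set. Qed.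

(** If the constant coefficient [u] differed from the coordinate of [h y], then [x - u] would be
    invertible near [h y], and so would its pullback, whose constant coefficient at [y] is zero. *)
Lemma line_point n dd (V : set (gdom R n dd)) (h : gmap (grestr V) T) y :
  open V -> is_premap h ->
  (gpull h tau : gdom_sec dd _ 0) [ffun => 0%N] (set_val y) = (h y : 'rV_1) 0 0.
Proof.
move=> oV hp; set u := LHS; apply/eqP; apply: contraT => uy.
pose f : 'rV[R]_1 -> R^o := fun x => x 0 0 - u.
pose W : set T := [set x : 'rV[R]_1 | f x != 0].
have sf A : smooth_on A f.
  by apply: smooth_onD; [exact: smooth_on_coord|exact: smooth_on_cst].
have oW : open W.
  have cf : continuous f by move=> x; have [] := sf setT [::] x; rewrite ?interiorT.
  move/continuousP : cf => /(_ [set t | t != 0]); apply.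
  have -> : [set t : R^o | t != 0] = ~` [set 0].
    by apply/funext => t; apply/propext; split=> /eqP.
  exact/closed_openC/accessible_closed_set1/hausdorff_accessible/norm_hausdorff.
have Wy : W (h y) by rewrite /W /= /f subr_eq0 eq_sym.
have si : smooth_on W (fun x => (f x)^-1 : R^o).
  by apply: smooth_inv => // x /interior_subset.
pose r : @gsec R T W 0 := gfunc [::] si.
pose s : @gsec R T W 0 := rs W tau - u *: gone W.
have sr : gmul 0 s r = gone W.
  apply: gcoef_eq => m x; have [Wx|Wx] := pselect (W x); last by rewrite !gcoef_out.
  rewrite [LHS]gmul_lineE (gone_lineE m Wx) -[(s : gdom_sec _ _ _) m x]/
    ((rs W tau : gdom_sec [::] W 0) m x - u * (gone W : gdom_sec [::] W 0) m x).
  rewrite rs_gdom_coef // tauE gone_lineE // mulr1 /= (mon0 m) eqxx mem_set //=.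
  by rewrite -/(f x) mulfV.
have oW' := pre_open hp oW.
have s0 : (gpull h s : gdom_sec dd _ 0) [ffun => 0%N] (set_val y) = 0.
  have -> : gpull h s = rs (h @^-1` W) (gpull h tau) - u *: gone (h @^-1` W).
    by rewrite /s pullB // pullZ // (prepull1 hp) // (prepull_rs hp).
  transitivity ((rs (h @^-1` W) (gpull h tau) : gdom_sec dd _ 0) [ffun => 0%N] (set_val y)
    - u * (gone (h @^-1` W) : gdom_sec dd _ 0) [ffun => 0%N] (set_val y)) => //.
  rewrite rs_grestr_coef // -/u /= eqxx mem_set; last by exists y.
  by rewrite mulr1 subrr.
have := congr1 (fun t : @gsec R T W 0 =>
  (gpull h t : gdom_sec dd _ 0) [ffun => 0%N] (set_val y)) sr.
rewrite (prepullM hp) // (prepull1 hp) // [LHS]ev_mul s0 mul0r /= eqxx mem_set.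
  by move/eqP; rewrite eq_sym oner_eq0.
by exists y.
Qed.

Lemma line_hadamard (t0 : T) : hadamard_at tau t0.
Proof.
have t0P : exists c0, c0 = (t0 : 'rV_1) 0 0 by exists ((t0 : 'rV_1) 0 0).
have [c0 c0E] := t0P.
have van W : open W -> W t0 -> vanish_at (rs W tau - gconst W 0 c0) t0.
  move=> oW Wt n dd V h oV hp y hy; have oW' := pre_open hp oW.
  have -> : gpull h (rs W tau - gconst W 0 c0) =
      rs (h @^-1` W) (gpull h tau) - gconst (h @^-1` W) 0 c0.
    by rewrite pullB // pull_gconst // (prepull_rs hp).
  have Wy : (h @^-1` W) y by rewrite /preimage /= hy.
  transitivity ((rs (h @^-1` W) (gpull h tau) : gdom_sec dd _ 0) [ffun => 0%N] (set_val y)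
    - (gconst (h @^-1` W) 0 c0 : gdom_sec dd _ 0) [ffun => 0%N] (set_val y)) => //.
  rewrite rs_grestr_coef // line_point // hy -c0E [X in _ - X]ev_mul.
  rewrite -[X in X * _]/(c0 * (gone (h @^-1` W) : gdom_sec dd _ 0) [ffun => 0%N] (set_val y)).
  by rewrite /= eqxx mem_set; [rewrite !mulr1 subrr|exists y].
move=> W i f oW Wt.
(* Without variables of non-zero degree, all sections of degree [i != 0] vanish. *)
have [i0|i0] := eqVneq i 0; last first.
  exists W, 0, c0, 0, 0; split=> //; first exact: van.
  have mi (m : monomial [::]) : mdeg m != i by rewrite /mdeg big_ord0 eq_sym.
  by apply: gcoef_eq => m x; rewrite !gcoef_adm // (negPf (mi m)) andbF.
subst i.
pose F : 'rV[R]_1 -> R^o := (f : gdom_sec [::] W 0) [ffun => 0%N].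
have sF : smooth_on W F by exact: gcoef_smooth.
have [e /= e0 eW] : nbhs_ball (t0 : 'rV[R]_1) W by apply/nbhs_ballP; exact: open_nbhs_nbhs.
(* The successive derivatives of [F] along the only coordinate, read as functions of a real
   variable. *)
pose fn k (t : R) : R := partials (nseq k ord0) F (const_mx t).
have eW' t : `|t - c0| < e -> W (const_mx t : 'rV[R]_1).
  move=> te; apply: eW; split=> // a b; rewrite !ord1 mxE /ball /= -c0E distrC //.
have dfn k t : `|t - c0| < e -> is_derive t 1 (fn k) (fn k.+1 t).
  move=> /eW' Wt'; have Wi : W° (const_mx t : 'rV[R]_1) by rewrite (interior_id _).1.
  have [_ /(_ ord0) dF] := sF (nseq k ord0) _ Wi.
  rewrite /fn; set x := const_mx t in dF Wi *; set G := partials _ _ in dF.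
  have pS g l : partials (nseq l.+1 ord0) g = 'D_(delta_mx 0 ord0) (partials (nseq l ord0) g).
    by elim: l g => // l IH g; exact: IH.
  have lin a : const_mx (a + t) = a *: delta_mx 0 ord0 + x :> 'rV[R]_1.
    by apply/rowP => b; rewrite !mxE ord1 !eqxx mulr1.
  rewrite [X in is_derive _ _ _ X](_ : _ = 'D_(delta_mx 0 ord0) G x); last by rewrite pS.
  have e1 : 'D_(delta_mx 0 ord0) G x = 'D_1 (fun s : R => G (const_mx s) : R^o) t.
    rewrite /derive; set g1 := fun h => h^-1 *: _; set g2 := fun h => h^-1 *: _.
    by suff -> : g1 = g2 by []; apply/funext => a; rewrite /g1 /g2 /= [_%:A]mulr1 lin.
  apply: DeriveDef; last by rewrite e1.
  move: dF; rewrite /derivable; set g1 := fun h => h^-1 *: _; set g2 := fun h => h^-1 *: _.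
  by suff -> : g1 = g2 by []; apply/funext => a; rewrite /g1 /g2 /= [_%:A]mulr1 lin.
pose r0 (x : 'rV[R]_1) : R^o := hadamard_quo fn c0 0 (x 0 0).
pose W' : set T := [set x : 'rV[R]_1 | `|x 0 0 - c0| < e].
have oW' : open W'.
  have cc : continuous (fun x : 'rV[R]_1 => `|x 0 0 - c0| : R).
    have sd : smooth_on setT (fun x : 'rV[R]_1 => x 0 0 - c0 : R^o).
      by apply: smooth_onD; [exact: smooth_on_coord|exact: smooth_on_cst].
    have cd : continuous (fun x : 'rV[R]_1 => x 0 0 - c0 : R^o).
      by move=> x; have [] := sd [::] x; rewrite ?interiorT.
    by move=> x; exact: continuous_comp (cd x) (@norm_continuous R R^o _).
  by move/continuousP : cc => /(_ _ (lray_open e)); apply.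
have W't : W' t0 by rewrite /W' /= c0E subrr normr0.
have W'W : W' `<=` W.
  move=> x /eW'; suff -> : const_mx ((x : 'rV[R]_1) 0 0) = x by [].
  by apply/rowP => a; rewrite mxE ord1.
have sr : smooth_on W' r0.
  have dr k (x : 'rV[R]_1) : W'° x ->
      is_derive (x 0 0) 1 (hadamard_quo fn c0 k) (hadamard_quo fn c0 k.+1 (x 0 0)).
    by move=> /interior_subset xe; apply: (is_derive_quo e0 dfn).
  exact: (smooth_comp (r := hadamard_quo fn c0) (@smooth_on_coord R 1 W' 0) dr 0).
exists W', (F t0), c0, 0, (gfunc [::] sr); split=> //; first exact: van.
apply: gcoef_eq => m x; have [Wx|Wx] := pselect (W' x); last by rewrite !gcoef_out.
rewrite rs_gdom_coef // (mon0 m).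
transitivity ((gconst W' 0 (F t0) : gdom_sec [::] W' 0) [ffun => 0%N] x +
  (gmul 0 (rs W' tau - gconst W' 0 c0) (gfunc [::] sr) : gdom_sec [::] W' 0)
    [ffun => 0%N] x) => //.
have gc c : (gconst W' 0 c : gdom_sec [::] W' 0) [ffun => 0%N] x = c.
  rewrite [LHS]gmul_lineE gone_lineE // mulr1.
  by rewrite -[LHS]/(c * (gone W' : gdom_sec [::] W' 0) [ffun => 0%N] x) gone_lineE ?mulr1.
have er : (gfunc [::] sr : gdom_sec [::] W' 0) [ffun => 0%N] x = r0 x.
  by rewrite /= eqxx mem_set.
rewrite gc [X in _ + X]gmul_lineE er.
transitivity (F t0 + ((rs W' tau : gdom_sec [::] W' 0) [ffun => 0%N] x -
  (gconst W' 0 c0 : gdom_sec [::] W' 0) [ffun => 0%N] x) * r0 x) => //.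
rewrite gc rs_gdom_coef // tauE.
have := hadamard_quo0 fn c0 ((x : 'rV[R]_1) 0 0).
have cE (z : 'rV[R]_1) : const_mx (z 0 0) = z by apply/rowP => a; rewrite mxE ord1.
by rewrite /fn /r0 /= c0E !cE.
Qed.

End RealLine.

Section GradedLine.
Variables (R : realType) (e : int).
Hypothesis e0 : e != 0.
Local Notation T := (gdom R 0 [:: e]).
Variable tau : @gsec R T setT e.
Hypothesis tauE : forall m x,
  (tau : gdom_sec [:: e] setT e) m x = (m == [ffun => 1%N])%:R.

Lemma sum_dffun1 (V : nmodType) (m : {ffun 'I_1 -> nat}) (F : {ffun 'I_1 -> nat} -> V) :
  \sum_(l : {dffun forall a, 'I_(m a).+1}) F [ffun a => l a : nat] =
  \sum_(q < (m ord0).+1) F [ffun => q : nat].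
Proof.
have e1 : m = fcons (m ord0) [ffun => 0%N].
  by apply/ffunP => a; rewrite !ord1 fcons0.
rewrite [in LHS]e1 sum_dffun_cons; apply: eq_bigr => q _.
have ql (l : {ffun 'I_0 -> nat}) : fcons q l = [ffun => q : nat].
  by apply/ffunP => a; rewrite (ord1 a) fcons0 ffunE.
under eq_bigr do rewrite ql.
pose l0 : {dffun forall b, 'I_(([ffun => 0%N] : {ffun 'I_0 -> nat}) b).+1} :=
  [ffun a => ord0].
rewrite (big_pred1 l0) //.
by move=> l; rewrite -[RHS]/(l == _); apply/esym/eqP/ffunP => -[].
Qed.

Lemma gmul_gradedE (W : set T) i j k (s : @gsec R T W i) (t : @gsec R T W j) m x :
  (gmul k s t : gdom_sec [:: e] W k) m x =
  if madm m && (mdeg m == k) then \sum_(q < (m ord0).+1)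
    (s : gdom_sec [:: e] W i) [ffun => q : nat] x *
    (t : gdom_sec [:: e] W j) [ffun => (m ord0 - q)%N] x else 0.
Proof.
rewrite [LHS]gdom_mulE; case: ifP => // _.
rewrite (sum_dffun1 m (fun l1 : monomial [:: e] => msign R l1 (fsub m l1) *
  (s l1 x * t (fsub m l1) x))); apply: eq_bigr => q _.
have -> : fsub m [ffun => q : nat] = [ffun => (m ord0 - q)%N] :> monomial [:: e].
  by apply/ffunP => a; rewrite (ord1 a) !ffunE.
rewrite /msign big_ord1 big_pred0 ?mul1r //.
Qed.

Let msucc (m : monomial [:: e]) : monomial [:: e] := [ffun a => (m a).+1].

(** Over the point a section is a power series in one variable with scalar coefficients: [c] is its
    constant term and [r], of degree [i - e], its shift by one exponent, so the expansion holds on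
    all of [W] with [c0 = 0]. *)
Lemma graded_hadamard (t0 : T) : hadamard_at tau t0.
Proof.
have pt (x : 'rV[R]_0) : x = t0 by apply/rowP => -[].
move=> W i f oW Wt.
pose c := (f : gdom_sec [:: e] W i) [ffun => 0%N] t0.
have rP : (fun m => (f : gdom_sec [:: e] W i) (msucc m)) \in gdom_pred W (i - e).
  apply/asboolP; split=> [m|m x|m hm]; [exact: gcoef_smooth|exact: gcoef_out|].
  apply/funext => x; apply: gcoef_adm; apply: contra hm => /andP[ma /eqP md].
  apply/andP; split.
    apply/forallP => a; have := forallP ma a; rewrite ffunE.
    by case: (odd _) => //= /ltnW.
  apply/eqP; rewrite -md /mdeg !big_ord1 ffunE /= mulrS; ring.
pose r : @gsec R T W (i - e) := GDomSec rP.
exists W, c, 0, (i - e), r; split=> //.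
  move=> n dd V h oV hp y hy; apply: gcoef_adm.
  by rewrite mdeg0 eq_sym (negPf e0) andbF.
apply: gcoef_eq => m x; have [Wx|Wx] := pselect (W x); last by rewrite !gcoef_out.
rewrite rs_gdom_coef // (pt x).
transitivity ((gconst W i c : gdom_sec [:: e] W i) m t0 +
  (gmul i (rs W tau - gconst W e 0) r : gdom_sec [:: e] W i) m t0) => //.
rewrite !gmul_gradedE.
have [hm|hm] := boolP (madm m && (mdeg m == i)); last by rewrite addr0 gcoef_adm.
have cE c' q : ((c' *: gone W : @gsec R T W 0) : gdom_sec [:: e] W 0) [ffun => q] t0 =
    c' * (q == 0%N)%:R.
  rewrite -[LHS]/(c' * (gone W : gdom_sec [:: e] W 0) [ffun => q] t0) /= mem_set // andbT.
  congr (_ * _%:R); congr nat_of_bool.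
  apply/eqP/eqP => [/ffunP/(_ ord0)|->]; by rewrite ?ffunE.
have tE q : ((rs W tau - gconst W e 0 : @gsec R T W e) : gdom_sec [:: e] W e)
    [ffun => q] t0 = (q == 1%N)%:R.
  transitivity ((rs W tau : gdom_sec [:: e] W e) [ffun => q] t0 -
    (gconst W e 0 : gdom_sec [:: e] W e) [ffun => q] t0) => //.
  rewrite rs_gdom_coef // tauE gmul_gradedE.
  have -> : ([ffun => q] == [ffun => 1%N] :> monomial [:: e]) = (q == 1%N).
    apply/eqP/eqP => [/ffunP/(_ ord0)|->]; by rewrite ?ffunE.
  case: ifP => _; rewrite ?subr0 // big1 ?subr0 // => l _.
  by rewrite cE !mul0r.
have oE q : (gone W : gdom_sec [:: e] W 0) [ffun => q] t0 = (q == 0%N)%:R.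
  rewrite /= mem_set // andbT; congr (_%:R); congr nat_of_bool.
  apply/eqP/eqP => [/ffunP/(_ ord0)|->]; by rewrite ?ffunE.
under eq_bigr do rewrite cE oE.
under [X in _ + X]eq_bigr do rewrite tE.
have mE : m = [ffun => m ord0] by apply/ffunP => a; rewrite ord1 ffunE.
case m0E : (m ord0) => [|p].
  rewrite !big_ord1 /= mul0r addr0 !mulr1 /c.
  by rewrite mE m0E.
rewrite big_ord_recl big1 => [|q _]; last by rewrite /= mulr0 mul0r.
rewrite /= mulr0 !add0r (bigD1 (inord 1)) //= big1 ?addr0 => [|q].
  rewrite inordK // eqxx mul1r subSS subn0 /r /=.
  by congr (_ _ _); apply/ffunP => a; rewrite ffunE ffunE ord1 m0E.
rewrite -val_eqE /= inordK // => /negPf ->; by rewrite mul0r.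
Qed.

End GradedLine.

Section MapsToLine.
Variables (R : realType).

(** The type of the line depends on the test [k == 0]; with the test replaced by a variable [b],
    case analysis reduces it to the two models. *)
Lemma line_cases (b : bool) (k : int)
    (tau : @gsec R (gdom R b (if b then [::] else [:: - k])) setT (- k)) :
  (k == 0) = b ->
  (forall m x, (tau : gdom_sec _ _ (- k)) m x =
    if b then \sum_i x 0 i else (m == [ffun => 1%N])%:R) ->
  (forall t0, hadamard_at tau t0) /\
  forall n dd (V : set (gdom R n dd))
    (h : gmap (grestr V) (gdom R b (if b then [::] else [:: - k]))),
    open V -> is_premap h ->
    (forall h', is_premap h' -> gpull h tau = gpull h' tau -> h =1 h') /\
    (gpull h tau = 0 -> forall y, (h y : 'rV_b) = 0).
Proof.
case: b tau => tau kb tauE.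
  move/eqP: kb tau tauE => -> tau tauE.
  have tauE' m x : (tau : gdom_sec [::] setT 0) m x = x 0 0 by rewrite tauE big_ord1.
  split=> [t0|n dd V h oV ph]; first exact: (line_hadamard tauE').
  have hE := line_point tauE' _ oV ph.
  split=> [h' ph' eh y|h0 y]; apply/rowP => a; rewrite (ord1 a) -hE.
    by rewrite -(line_point tauE' y oV ph') eh.
  by rewrite h0 mxE.
have k0 : - k != 0 by rewrite oppr_eq0 kb.
split=> [t0|n dd V h oV ph]; first exact: (graded_hadamard k0 tauE).
by split=> [h' ph' eh y|h0 y]; apply/rowP => -[].
Qed.

Let coordE (k : int) := @line_cases (k == 0) k (gline_coord R k) erefl
  (fun m x => erefl).

Variables (Q : grspace R) (mQ : gmanifold Q) (k : int).

Let hQ : is_gsheaf Q := gman_sheaf mQ.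

(** Chart parametrisations turn both maps into maps out of graded domains, where the order argument
    applies; [param_inj] brings the equality back to [Q]. *)
Lemma gline_map_eq (g g' : gmap Q (gline R k)) : is_lrmap g -> is_lrmap g' ->
  @gpull R _ _ g setT _ (gline_coord R k) =
  @gpull R _ _ g' setT _ (gline_coord R k) -> geq g g'.
Proof.
move=> hg hg' e; have pg := lrmap_premap hg; have pg' := lrmap_premap hg'.
have chart x : exists (U : set Q) n dd (V : set (gdom R n dd))
    (psi : gmap (grestr V) (grestr U)), [/\ open U /\ U x, open V, is_premap (param psi),
    (exists y, param psi y = x) &
    forall (A : set Q) i (s : gsec A i), open A -> gpull (param psi) s = 0 ->
      rs (U `&` A) s = 0].
  have [U [n [d [V [oU Ux _ oV [phi [psi [hp hq e1 _]]]]]]]] := gman_chart mQ x.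
  exists U, n, d, V, psi; split=> //.
  - exact: (lrmap_premap (param_lrmap hQ oU hq)).
  - exists (phi (exist _ x (mem_set Ux))) => /=.
    by rewrite [psi _](e1.1 (exist _ x (mem_set Ux))).
  - by move=> A i s; exact: (param_inj hQ oU hp hq e1).
have loc x : exists (U : set Q) n dd (V : set (gdom R n dd))
    (psi : gmap (grestr V) (grestr U)), [/\ open U, U x,
    g x = g' x, is_premap (param psi) & geq (gcomp g (param psi)) (gcomp g' (param psi)) /\
    forall (A : set Q) i (s : gsec A i), open A -> gpull (param psi) s = 0 ->
      rs (U `&` A) s = 0].
  have [U [n [dd [V [psi [[oU Ux] oV pp [y yx] inj]]]]]] := chart x.
  have ph := comp_premap pp pg; have ph' := comp_premap pp pg'.
  have eh : @gpull R _ _ (gcomp g (param psi)) setT _ (gline_coord R k) =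
      @gpull R _ _ (gcomp g' (param psi)) setT _ (gline_coord R k).
    by rewrite /= e.
  have [had cases] := coordE k.
  have [/(_ _ ph' eh) hh _] := cases n dd V (gcomp g (param psi)) oV ph.
  exists U, n, dd, V, psi; split=> //; first by rewrite -yx; exact: hh.
  split=> //; exact: (chart_map_eq had oV ph ph' hh eh).
have gg : g =1 g' by move=> x; have [U [n [dd [V [psi [_ _ ->]]]]]] := loc x.
apply/geqP; split=> // W i a oW.
have oA := pre_open pg oW; have oA' := pre_open pg' oW.
have AE := eq_pre W gg.
apply: (gsec_eq hQ) => // x Ax.
have [U [n [dd [V [psi [oU Ux _ pp [/geqP[_ eh] inj]]]]]]] := loc x.
exists (U `&` g' @^-1` W); split=> //; first exact: openI.
apply/eqP; rewrite -subr_eq0 -rsB //; last exact: openI.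
apply/eqP/inj => //; rewrite (pullB pp) // (prepull_rs pp) ?AE //.
by have := eh W i a oW => /= ->; rewrite subrr.
Qed.

Lemma gline_val0 (g : gmap Q (gline R k)) : is_lrmap g ->
  @gpull R _ _ g setT _ (gline_coord R k) = 0 -> forall q, g q = 0 :> 'rV_(k == 0).
Proof.
move=> hg g0 x; have pg := lrmap_premap hg.
have [U [n [d [V [oU Ux _ oV [phi [psi [hp hq e1 _]]]]]]]] := gman_chart mQ x.
have pp := lrmap_premap (param_lrmap hQ oU hq).
have [_ cases] := coordE k.
have [_ h0] := cases n d V (gcomp g (param psi)) oV (comp_premap pp pg).
have e := e1.1 (exist _ x (mem_set Ux)).
have h00 : @gpull R _ _ (gcomp g (param psi)) setT _ (gline_coord R k) = 0.
  rewrite -[LHS]/(gpull (param psi) (@gpull R _ _ g setT _ (gline_coord R k))) g0.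
  exact: (pull0 pp (- k) openT).
have <- := h0 h00 (phi (exist _ x (mem_set Ux))).
by rewrite /= [psi _]e.
Qed.

End MapsToLine.

(** * Tangent maps and the flow *)

Lemma gfield0_is_gfield (R : realType) (M : grspace R) (k : int) :
  is_gsheaf M -> is_gfield k (gfield0 M).
Proof.
move=> hM; split=> //; rewrite /gfield0 => *.
  by rewrite scaler0 addr0.
by rewrite gmul0l // gmul0r // scaler0 addr0.
Qed.

Lemma grelated_comp (R : realType) (L M N : grspace R) (psi : gmap M N)
    (phi : gmap L M) X Y Z :
  grelated phi X Y -> grelated psi Y Z -> grelated (gcomp psi phi) X Z.
Proof.
move=> h1 h2 i j a; transitivity (@gpull R _ _ phi setT j
  (Y i j (@gpull R _ _ psi setT i a))); first exact: h1.
by rewrite h2.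
Qed.

Section Tangent.
Variables (R : realType) (Q N : grspace R).
Hypotheses (mQ : gmanifold Q) (mN : gmanifold N).
Variables (k w : int) (om : @gsec R Q setT w).

Let hQ : is_gsheaf Q := gman_sheaf mQ.
Let hN : is_gsheaf N := gman_sheaf mN.
Let tQ : is_gsheaf (thick Q (k + w)) := thick_sheaf (k + w) hQ.

Definition tproj : gmap (thick Q (k + w)) Q :=
  @GMap R (thick Q (k + w)) Q id (fun W i a => (a, 0)).

(* [phi + eta om Y]. *)
Definition tmap (phi : gmap Q N) (Y : gfield N) : gmap (thick Q (k + w)) N :=
  @GMap R (thick Q (k + w)) N phi (fun W i a => (gpull phi a,
    gmul (i + (k + w)) (rs (phi @^-1` W) om) (gpull phi (locf k Y a)))).

(** Setting [eta = 0] is a morphism of algebras and so preserves units; locality of a map out of a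
    thickening is thereby reduced to that of its [eta]-free part. *)
Lemma thick_germ (x : Q) (U : set Q) i (s : @gsec R (thick Q (k + w)) U i) :
  @germ_unit R (thick Q (k + w)) x U i s -> @germ_unit R Q x U i s.1.
Proof.
move=> [V [VU [t [oV Vx e]]]]; exists V, VU, t.1; split=> //.
exact: (congr1 fst e).
Qed.

Lemma tproj_lrmap : is_lrmap tproj.
Proof.
apply: premap_lrmap; first split.
- by move=> x; exact: cvg_id.
- by move=> W i c a b oW; congr pair; apply/esym; rewrite -[LHS]/(c *: 0 + 0) scaler0 addr0.
- move=> W i j q a b oW; congr pair => /=.
  by rewrite gmul0l // gmul0r // scaler0 addr0.
- by [].
- by move=> V W i a oW oV VW; rewrite rs_thick //= (rs0 hQ).
by move=> W i a x oW Wx /thick_germ.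
Qed.

Section Phi.
Variables (phi : gmap Q N) (Y : gfield N).
Hypotheses (hp : is_lrmap phi) (hY : is_gfield k Y).

Let pp : is_premap phi := lrmap_premap hp.

Lemma locf_one (W : set N) : open W -> locf k Y (gone W) = 0.
Proof.
move=> oW; have := locfM mN hY (gone W) (gone W) oW (esym (addr0 0)).
rewrite gmul1l // gmul1r // gmul1l // /ksign andbF expr0 scale1r => /eqP.
by rewrite -subr_eq subrr => /eqP <-.
Qed.

(** Multiplicativity is the Leibniz rule: moving [eta] and then [om] past a factor of degree [i]
    yields the signs of [k + w] and of [w] against [i], whose product is the sign of [k] in the rule
    for [Y]. *)
Lemma tmap_premap : is_premap (tmap phi Y).
Proof.
have lin (W : set N) i c (a b : gsec W i) : open W ->
    gpull (tmap phi Y) (c *: a + b) = c *: gpull (tmap phi Y) a + gpull (tmap phi Y) b.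
  move=> oW; have oW' := pre_open pp oW; congr pair; first exact: (prepullL pp).
  by rewrite locfL // (prepullL pp) // gmulD_r // gmulZ_r.
have lin0 (W : set N) i : open W -> gpull (tmap phi Y) (0 : gsec W i) = 0.
  move=> oW; have := lin W i 1 0 0 oW; rewrite !scale1r addr0 => /eqP.
  by rewrite -subr_eq subrr => /eqP <-.
split=> //.
- exact: (pre_cont pp).
- move=> W i j q a b oW; have oW' := pre_open pp oW.
  (* Products in a degree other than [i + j] vanish on both sides. *)
  have [qij|qij] := eqVneq q (i + j); last first.
    by rewrite (gmul_deg hN) // lin0 // (gmul_deg tQ).
  congr pair; first exact: (prepullM pp).
  rewrite (locfM mN hY a b oW qij) pullD // pullZ // !(prepullM pp) //.
  rewrite gmulD_r // gmulZ_r // ksignDl -scalerA; congr (_ + _ *: _).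
    by apply: gmulA' => //; lia.
  rewrite (@gmulA' _ _ hQ _ _ _ _ _ (w + i)) //; last by lia.
  rewrite (gmulC hQ _ (rs _ om)) // gmulZ_l //; congr (_ *: _).
  by apply/esym/gmulA' => //; lia.
- move=> W oW; have oW' := pre_open pp oW; congr pair; first exact: (prepull1 pp).
  by rewrite locf_one // (pull0 pp) // gmul0r.
- move=> V W i a oW oV VW; have oW' := pre_open pp oW; have oV' := pre_open pp oV.
  have VW' : phi @^-1` V `<=` phi @^-1` W by exact: preimage_subset.
  rewrite rs_thick //; congr pair; first exact: (prepull_rs pp).
  rewrite /= (locf_rs mN hY) // (prepull_rs pp) // rsM // rs_rs //.
Qed.

Lemma tmap_lrmap : is_lrmap (tmap phi Y).
Proof.
apply: premap_lrmap; first exact: tmap_premap.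
by move=> W i a x oW Wx /thick_germ; exact: (gpull_local hp).
Qed.

End Phi.

Lemma tmap_geq (phi psi : gmap Q N) (Y : gfield N) :
  is_lrmap phi -> geq phi psi -> geq (tmap phi Y) (tmap psi Y).
Proof.
move=> hp /geqP[h1 h2]; apply/geqP; split=> // W i a oW.
have oW1 := pre_open (lrmap_premap hp) oW.
have e := eq_pre W h1.
have oW2 : open (psi @^-1` W) by rewrite -e.
have sub : psi @^-1` W `<=` phi @^-1` W by rewrite e.
rewrite rs_thick //; congr pair; first exact: h2.
by rewrite rsM // h2 // rs_rs.
Qed.

Lemma tmap0 (phi : gmap Q N) : is_lrmap phi ->
  geq (tmap phi (gfield0 N)) (gcomp phi tproj).
Proof.
move=> hp; apply/geqP; split=> // W i a oW.
have oW1 := pre_open (lrmap_premap hp) oW.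
rewrite (rs_id tQ) //; congr pair.
have -> : locf k (gfield0 N) a = 0.
  apply: (locf_eq mN (gfield0_is_gfield k hN)) => // x V al oV Vx VW _.
  by rewrite !(rs0 hN).
by rewrite (pull0 (lrmap_premap hp)) // gmul0r.
Qed.

Lemma tmap_coord (L : grspace R) (phi : gmap Q N) (Y : gfield N) (f : gmap N L) i
    (a : @gsec R L setT i) : is_gfield k Y ->
  @gpull R _ _ (gcomp f (tmap phi Y)) setT i a =
  (@gpull R _ _ phi setT i (@gpull R _ _ f setT i a),
   gmul (i + (k + w)) om
     (@gpull R _ _ phi setT (i + k) (Y i (i + k) (@gpull R _ _ f setT i a)))).
Proof.
move=> hY; congr pair; rewrite (rs_id hQ); last exact: openT.
by rewrite -[in RHS](locf_setT mN hY).
Qed.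

End Tangent.

(** The pullback along [f] exchanges the localised fields [Y'] and [Y], so the [eta] parts of both
    sides coincide. *)
Lemma tmap_comp (R : realType) (Q N L : grspace R) (mQ : gmanifold Q)
    (mN : gmanifold N) (mL : gmanifold L) (k w : int) (om : @gsec R Q setT w)
    (phi : gmap Q N) (f : gmap N L) (Y : gfield N) (Y' : gfield L) :
  is_lrmap phi -> is_lrmap f -> is_gfield k Y -> is_gfield k Y' ->
  grelated f Y Y' ->
  geq (gcomp f (tmap k om phi Y)) (tmap k om (gcomp f phi) Y').
Proof.
move=> hp hf hY hY' rel; apply/geqP; split=> // W i a oW.
have pc := lrmap_premap (comp_lrmap hp hf).
have oW1 := pre_open pc oW.
have tQ := thick_sheaf (k + w) (gman_sheaf mQ).
rewrite (rs_id tQ) //; congr pair.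
by rewrite (locf_rel mN mL a hf hY hY' rel oW).
Qed.

(** Both maps mediate the same pair of components, and [S] is an admissible test object. *)
Lemma gprod_uniq (R : realType) (M N : grspace R) (P : gprod M N) (S : grspace R)
    (u v : gmap S P) : gmanifold S -> is_lrmap u -> is_lrmap v ->
  geq (gcomp (pfst P) u) (gcomp (pfst P) v) ->
  geq (gcomp (psnd P) u) (gcomp (psnd P) v) -> geq u v.
Proof.
move=> mS hu hv e1 e2; have [mP [l1 _] [l2 _] univ] := pobjP P.
have hS := gman_sheaf mS.
have c1 := comp_lrmap hv l1; have c2 := comp_lrmap hv l2.
have [h [[lh _] _ _ uniq]] := univ S _ _ mS (lrmap_gsmooth c1) (lrmap_gsmooth c2).
have uh := uniq u (lrmap_gsmooth hu) e1 e2.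
have vh := uniq v (lrmap_gsmooth hv) (geqR hS c1) (geqR hS c2).
by apply: geqT uh _ => //; apply: geqS vh.
Qed.

Lemma gprod_pair (R : realType) (M N : grspace R) (P : gprod M N) (S : grspace R)
    (f : gmap S M) (g : gmap S N) : gmanifold S -> is_lrmap f -> is_lrmap g ->
  exists h : gmap S P, [/\ is_lrmap h, geq (gcomp (pfst P) h) f &
    geq (gcomp (psnd P) h) g].
Proof.
move=> mS lf lg; have [_ _ _ univ] := pobjP P.
have [h [[lh _] e1 e2 _]] := univ S f g mS (lrmap_gsmooth lf) (lrmap_gsmooth lg).
by exists h.
Qed.

Lemma pair_continuous (A B C : topologicalType) (f : A -> B) (g : A -> C) :
  continuous f -> continuous g -> continuous (fun x => (f x, g x)).
Proof. by move=> cf cg x; apply: cvg_pair; [exact: cf|exact: cg]. Qed.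

Section FlowDomains.
Variables (R : realType) (M : grspace R) (k : int).
Let T := gline R k.
Variables (P : gprod M T) (P2 : gprod P T) (D : set (M * T)).
Hypothesis hD : flow_domain D.

Lemma gflow_dom_open : open (gflow_dom P D).
Proof.
have [mP [l1 _] [l2 _] _] := pobjP P.
move: hD; rewrite /flow_domain; case: ifP => _ => [[oD _]|DT]; last first.
  by rewrite /gflow_dom DT; exact: openT.
exact: (open_pre (pair_continuous (gfun_cont l1) (gfun_cont l2)) oD).
Qed.

Variable theta : gmap (grestr (gflow_dom P D)) M.
Hypothesis ctheta : continuous theta.

(** [theta] is continuous for the topology induced on the flow domain, so the condition on its value
    is first turned into an open condition on [P]. *)
Lemma gflow_dom2_open : open (@gflow_dom2 R M k P P2 D theta).
Proof.
have [mP [l1 _] [l2 _] _] := pobjP P; have [mP2 [k1 _] [k2 _] _] := pobjP P2.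
have oG := gflow_dom_open.
move: hD; rewrite /flow_domain; case: ifP => _ => [[oD _]|DT]; last first.
  rewrite [X in open X](_ : _ = setT); first exact: openT.
  rewrite eqEsubset; split=> // z _.
  have h : gflow_dom P D (pfst P2 z) by rewrite /gflow_dom DT.
  have DA x : D x by rewrite DT.
  by exists (exist _ (pfst P2 z) (mem_set h)).
rewrite openE => z [w [wz Dw Dz]].
have [[A B] /= [nA nB] AB] : nbhs (theta w, psnd P2 z) D by exact: open_nbhs_nbhs.
have [C0 [[C oC <-] Cw] CA] := ctheta nA.
have nC : \near z, (C `&` gflow_dom P D) (pfst P2 z).
  apply: (gfun_cont k1); apply: open_nbhs_nbhs; split; first exact: openI.
  by rewrite -wz; split=> //; exact: set_val_mem.
have nB' : \near z, B (psnd P2 z) by exact: (gfun_cont k2 nB).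
have nD : \near z, D (pfst P (pfst P2 z),
    (psnd P (pfst P2 z) + psnd P2 z : 'rV[R]_(k == 0))).
  have c1 : continuous (pfst P \o pfst P2).
    by move=> x; apply: continuous_comp; [exact: (gfun_cont k1)|exact: (gfun_cont l1)].
  have c2 : continuous (fun z : P2 => psnd P (pfst P2 z) + psnd P2 z : 'rV[R]_(k == 0)).
    have ca : continuous (psnd P \o pfst P2 : P2 -> 'rV[R]_(k == 0)).
      by move=> x; apply: continuous_comp; [exact: (gfun_cont k1)|exact: (gfun_cont l2)].
    have cb : continuous (psnd P2 : P2 -> 'rV[R]_(k == 0)) by exact: (gfun_cont k2).
    by move=> x; exact: (continuousD (ca x) (cb x)).
  apply: (pair_continuous c1 c2); exact: open_nbhs_nbhs.
near=> x.
have [Cx Gx] : (C `&` gflow_dom P D) (pfst P2 x) by near: x.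
exists (exist _ (pfst P2 x) (mem_set Gx)); split=> //; last by near: x.
apply: AB; split=> /=; first exact: (CA (exist _ (pfst P2 x) (mem_set Gx)) Cx).
by near: x.
Unshelve. all: by end_near. Qed.

End FlowDomains.

Lemma gpullT_geq (R : realType) (M N : grspace R) (f g : gmap M N) i
    (a : @gsec R N setT i) : is_gsheaf M -> geq f g ->
  @gpull R _ _ f setT i a = @gpull R _ _ g setT i a.
Proof.
move=> hM /geqP[_ h]; have := h setT i a openT.
by rewrite (rs_id hM); last exact: openT.
Qed.

(** The field sends the coordinate to [1] in degree [- k + k], which equals [0] only by a proof;
    [gconst] expresses this without transport. *)
Lemma coord_field_pull (R : realType) (Q : grspace R) (k : int)
    (dt : gfield (gline R k)) (h : gmap Q (gline R k)) :
  is_gsheaf Q -> is_premap h -> is_coord_field dt ->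
  @gpull R _ _ h setT _ (dt (- k) (- k + k) (gline_coord R k)) = gconst setT (- k + k) 1.
Proof.
move=> hQ ph [_ dt1].
have gen j : j = 0 ->
    @gpull R _ _ h setT _ (dt (- k) j (gline_coord R k)) = gconst setT j 1.
  move=> ->; rewrite dt1 /gconst scale1r gmul1l; [exact: (prepull1 ph openT)|by []|].
  exact: openT.
by apply: gen; rewrite addNr.
Qed.

(** * The group law at an infinitesimal first time *)

Section Invariance.
Variables (R : realType) (M : grspace R) (k : int) (X : gfield M).
Let T := gline R k.
Variables (P : gprod M T) (P2 : gprod P T) (TT : gprod T T) (D : set (M * T)).
Variable theta : gmap (grestr (gflow_dom P D)) M.
Local Notation N := (grestr (gflow_dom P D)).
Hypotheses (mM : gmanifold M) (hX : is_gfield k X).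
Hypotheses (flow : is_gflow P2 TT theta) (gen : is_generator theta X).
Variables (X1 : gfield P) (E : gfield N).
Hypotheses (hX1 : is_gfield_lift X (gfield0 T) X1) (hE : is_gfield_restr X1 E).

Let mP : gmanifold P. Proof. by have [] := pobjP P. Qed.
Let l1 : is_lrmap (pfst P). Proof. by have [_ []] := pobjP P. Qed.
Let l2 : is_lrmap (psnd P). Proof. by have [_ _ []] := pobjP P. Qed.
Let mP2 : gmanifold P2. Proof. by have [] := pobjP P2. Qed.
Let k1 : is_lrmap (pfst P2). Proof. by have [_ []] := pobjP P2. Qed.
Let k2 : is_lrmap (psnd P2). Proof. by have [_ _ []] := pobjP P2. Qed.
Let hM : is_gsheaf M := gman_sheaf mM.
Let hP : is_gsheaf P := gman_sheaf mP.
Let hP2 : is_gsheaf P2 := gman_sheaf mP2.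
Let oN : open (gflow_dom P D) := gflow_dom_open P (gflow_domP flow).
Let mN : gmanifold N := grestr_gmanifold oN mP.
Let hN : is_gsheaf N := gman_sheaf mN.
Let lth : is_lrmap theta. Proof. by have [] := gflow_smooth flow. Qed.
Let oN2 : open (gflow_dom2 (P2 := P2) theta) :=
  gflow_dom2_open P2 (gflow_domP flow) (gfun_cont lth).
Let iota : gmap N P := gincl (gflow_dom P D).
Let li : is_lrmap iota := gincl_lrmap oN hP.
Let p1 : gmap N M := gcomp (pfst P) iota.
Let p2 : gmap N T := gcomp (psnd P) iota.
Let lp1 : is_lrmap p1 := comp_lrmap li l1.
Let lp2 : is_lrmap p2 := comp_lrmap li l2.

Variables (Q : grspace R) (mQ : gmanifold Q) (pi : gmap Q N) (lpi : is_lrmap pi).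
Variables (w : int) (om : @gsec R Q setT w).
Hypothesis (odd_kw : odd (absz (k + w))).

Let hQ : is_gsheaf Q := gman_sheaf mQ.
Let S := thick Q (k + w).
Let mS : gmanifold S := thick_gmanifold odd_kw mQ.
Let hS : is_gsheaf S := gman_sheaf mS.
Let proj : gmap S Q := tproj Q k w.
Let lproj : is_lrmap proj := tproj_lrmap mQ k w.

Lemma om_related i (a : @gsec R M setT i) :
  gmul (i + (k + w)) om (@gpull R _ _ pi setT _ (E (i + k) (@gpull R _ _ theta setT i a))) =
  gmul (i + (k + w)) om
    (@gpull R _ _ pi setT _ (@gpull R _ _ theta setT _ (X (i + k) a))).
Proof.
have [_ [dt [Z [Z' [hdt [gZ Z1 Z2] [gZ' ZZ'] Zth]]]]] := gen.
have [gX1 X11 X12] := hX1; have [gE EX1] := hE.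
have [z [e [[b [o [[lb _] [lo _] o0 zob]]] [[le _] p1e p2e] the]]] := gflow0 flow.
have [a' [b' [c' [s [p [[[la _] ea] [[lb' _] eb1 eb2] [[[ls _] es1 es2] [[lp _] pT]]
  [[lc _] ec1 ec2] bc]]]]]] := gflowD flow.
set i2 := gincl (@gflow_dom2 R M k P P2 D theta) in ea eb2 ec1 ec2.
have Zp1 : grelated p1 Z' (gfield0 M) by exact: grelated_comp ZZ' Z1.
have Zp2 : grelated p2 Z' dt by exact: grelated_comp ZZ' Z2.
have Ep1 : grelated p1 E X by exact: grelated_comp EX1 X11.
have Ep2 : grelated p2 E (gfield0 T) by exact: grelated_comp EX1 X12.
have h0 := gfield0_is_gfield k hM.
(* [rho] is [(m, 0)], with [m] the first component of [pi]; [theta] composed with it is [m]. *)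
pose rho : gmap Q N := gcomp e (gcomp p1 pi).
have lp1pi : is_lrmap (gcomp p1 pi) by exact: comp_lrmap.
have lrho : is_lrmap rho by exact: comp_lrmap.
have p1rho : geq (gcomp p1 rho) (gcomp p1 pi).
  apply: (@geqCl R Q M M (gcomp p1 e) (gid M) (gcomp p1 pi)) => //.
  exact: comp_lrmap.
have thrho : geq (gcomp theta rho) (gcomp p1 pi).
  apply: (@geqCl R Q M M (gcomp theta e) (gid M) (gcomp p1 pi)) => //.
  exact: comp_lrmap.
(* [A] is [(m, eps)]: the coordinate field displaces [rho] in the time direction only, leaving [m]
   fixed ([p1A]) and turning the time [0] into [eps] ([tA]). *)
pose A := tmap k om rho Z'; have lA : is_lrmap A := tmap_lrmap mQ mN om lrho gZ'.
have lp1r : is_lrmap (gcomp p1 rho) by exact: comp_lrmap.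
have p1A : geq (gcomp p1 A) (gcomp (gcomp p1 pi) proj).
  apply: (@geqT _ _ _ _ (tmap k om (gcomp p1 rho) (gfield0 M))) => //.
  - exact: comp_lrmap.
  - exact: (tmap_comp mQ mN mM om lrho lp1 gZ' h0 Zp1).
  apply: (@geqT _ _ _ _ (tmap k om (gcomp p1 pi) (gfield0 M))) => //.
  - exact: (tmap_lrmap mQ mM om lp1r h0).
  - exact: (tmap_geq mQ k om _ lp1r p1rho).
  exact: (tmap0 mQ mM k om lp1pi).
set t := gline_coord R k in o0 pT *.
have lb0 : is_lrmap (gcomp o b) by exact: comp_lrmap.
have lp2e : is_lrmap (gcomp p2 e) by exact: comp_lrmap.
have p2eob : geq (gcomp p2 e) (gcomp o b).
  by apply: geqT p2e zob.
have ob0 : @gpull R _ _ (gcomp o b) setT _ t = 0.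
  rewrite -[LHS]/(@gpull R _ _ b setT _ (@gpull R _ _ o setT _ t)) o0.
  exact: (pull0 (lrmap_premap lb) _ openT).
have p2e0 : @gpull R _ _ (gcomp p2 e) setT _ t = 0.
  by rewrite (gpullT_geq t hM p2eob).
have p2e_pt m : (p2 (e m) : 'rV[R]_(k == 0)) = 0 := gline_val0 mM lp2e p2e0 m.
have lp2pi : is_lrmap (gcomp p2 pi) by exact: comp_lrmap.
have one_eq (h : gmap Q T) : is_lrmap h ->
    @gpull R _ _ h setT _ (dt (- k) (- k + k) t) = gconst setT (- k + k) 1.
  by move=> lh; exact: (coord_field_pull hQ (lrmap_premap lh) hdt).
pose one := @gconst R Q setT (- k + k) 1.
have tA : @gpull R _ _ (gcomp p2 A) setT _ t = (0, gmul (- k + (k + w)) om one).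
  rewrite (tmap_coord mQ mN om rho p2 t gZ'); congr pair.
    rewrite -[LHS]/(@gpull R _ _ (gcomp p1 pi) setT _ (@gpull R _ _ (gcomp p2 e) setT _ t)).
    by rewrite p2e0 (pull0 (lrmap_premap lp1pi) _ openT).
  congr gmul; rewrite Zp2.
  exact: (one_eq (gcomp p2 rho) (comp_lrmap lrho lp2)).
(* The two displacements of [pi] to be compared: [B] along the lift of [X], [C] along the coordinate
   field. *)
pose B := tmap k om pi E; have lB : is_lrmap B := tmap_lrmap mQ mN om lpi gE.
pose C := tmap k om pi Z'; have lC : is_lrmap C := tmap_lrmap mQ mN om lpi gZ'.
have tB : @gpull R _ _ (gcomp p2 B) setT _ t = (@gpull R _ _ (gcomp p2 pi) setT _ t, 0).
  rewrite (tmap_coord mQ mN om pi p2 t gE); congr pair.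
  rewrite Ep2 /gfield0 (pull0 (lrmap_premap lp2) _ openT).
  by rewrite (pull0 (lrmap_premap lpi) _ openT) (gmul0r hQ).
have tC : @gpull R _ _ (gcomp p2 C) setT _ t =
    (@gpull R _ _ (gcomp p2 pi) setT _ t, gmul (- k + (k + w)) om one).
  rewrite (tmap_coord mQ mN om pi p2 t gZ'); congr pair.
  by congr gmul; rewrite Zp2; exact: (one_eq (gcomp p2 pi) lp2pi).
have lp2pp : is_lrmap (gcomp (gcomp p2 pi) proj) by exact: comp_lrmap.
(* [Psi] is [((m, eps), t)], with [t] the second component of [pi]. *)
have [Psi [lPsi Psi1 Psi2]] := @gprod_pair _ _ _ P2 S (gcomp iota A)
  (gcomp (gcomp p2 pi) proj) mS (comp_lrmap lA li) lp2pp.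
(* The domain of the group law is a condition on underlying points, where [eps] is invisible: it
   reduces to [(m, 0)] and [(m, t)] lying in [D]. *)
have in2 q : @gflow_dom2 R M k P P2 D theta (Psi q).
  have e1 : pfst P2 (Psi q) = iota (A q) := Psi1.1 q.
  have e2 : psnd P2 (Psi q) = p2 (pi q) := Psi2.1 q.
  have e3 : theta (A q) = p1 (pi q) := thrho.1 q.
  have e4 : pfst P (iota (A q)) = p1 (pi q) := p1A.1 q.
  have e5 : (psnd P (iota (A q)) : 'rV[R]_(k == 0)) = 0 := p2e_pt _.
  have Dq : D (p1 (pi q), p2 (pi q)) := set_val_mem (pi q).
  exists (A q); split=> //; first by rewrite e2 e3.
  by rewrite e1 e2 e4 e5 add0r.
have lPsi' := glift_lrmap oN2 hP2 in2 hS lPsi.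
have ePsi : geq (gcomp i2 (glift in2)) Psi := glift_incl oN2 in2 hS lPsi.
set Psi' := glift in2 in lPsi' ePsi.
have li2 : is_lrmap i2 := gincl_lrmap oN2 hP2.
have laP : is_lrmap (gcomp a' Psi') by exact: comp_lrmap.
have lbP : is_lrmap (gcomp b' Psi') by exact: comp_lrmap.
have lcP : is_lrmap (gcomp c' Psi') by exact: comp_lrmap.
have k1Psi : geq (gcomp (pfst P2) (gcomp i2 Psi')) (gcomp iota A).
  apply: (@geqT _ _ _ _ (gcomp (pfst P2) Psi)) Psi1 => //.
    by do ?apply: comp_lrmap.
  exact: geqCr.
have k2Psi : geq (gcomp (psnd P2) (gcomp i2 Psi')) (gcomp (gcomp p2 pi) proj).
  apply: (@geqT _ _ _ _ (gcomp (psnd P2) Psi)) Psi2 => //.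
    by do ?apply: comp_lrmap.
  exact: geqCr.
have aA : geq (gcomp a' Psi') A.
  apply: (geq_mono oN hP) => //.
  apply: (@geqT _ _ _ _ (gcomp (pfst P2) (gcomp i2 Psi'))) k1Psi => //.
    by do ?apply: comp_lrmap.
  apply: (@geqCl _ _ _ _ (gcomp iota a') (gcomp (pfst P2) i2) Psi') => //.
  exact: comp_lrmap.
have thA : geq (gcomp theta A) (tmap k om (gcomp p1 pi) X).
  apply: (@geqT _ _ _ _ (tmap k om (gcomp theta rho) X)) => //.
  - exact: comp_lrmap.
  - exact: (tmap_comp mQ mN mM om lrho lth gZ' hX Zth).
  exact: (tmap_geq mQ k om X (comp_lrmap lrho lth) thrho).
(* The left argument of the group law has the components [theta (m, eps)], known from [thA], and
   [t], on which the lift of [X] acts as zero. *)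
have bB : geq (gcomp b' Psi') B.
  apply: (geq_mono oN hP) => //.
  have lib : is_lrmap (gcomp iota (gcomp b' Psi')) by exact: comp_lrmap.
  have liB : is_lrmap (gcomp iota B) by exact: comp_lrmap.
  have lpib : is_lrmap (gcomp (pfst P) (gcomp iota (gcomp b' Psi'))) by exact: comp_lrmap.
  have lpiB : is_lrmap (gcomp p1 B) by exact: comp_lrmap.
  have lp2b : is_lrmap (gcomp (psnd P) (gcomp iota (gcomp b' Psi'))) by exact: comp_lrmap.
  have lp2B : is_lrmap (gcomp p2 B) by exact: comp_lrmap.
  apply: (gprod_uniq mS) => //.
    apply: (@geqT _ _ _ _ (tmap k om (gcomp p1 pi) X)) => //; last first.
      by apply: geqS => //; exact: (tmap_comp mQ mN mM om lpi lp1 gE hX Ep1).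
    apply: geqT thA => //.
    apply: (@geqT _ _ _ _ (gcomp theta (gcomp a' Psi'))) => //; last exact: geqCr.
    apply: (@geqCl _ _ _ _ (gcomp p1 b') (gcomp theta a') Psi') => //.
    exact: comp_lrmap.
  apply: (@geqT _ _ _ _ (gcomp (gcomp p2 pi) proj)) => //.
    apply: geqT k2Psi => //.
    apply: (@geqCl _ _ _ _ (gcomp p2 b') (gcomp (psnd P2) i2) Psi') => //.
    exact: comp_lrmap.
  apply: gline_map_eq => //; exact/esym/tB.
(* The right argument has the components [m], which the coordinate field does not move, and
   [eps + t], recognised by its coordinate through [gline_map_eq]. *)
have cC : geq (gcomp c' Psi') C.
  apply: (geq_mono oN hP) => //.
  have lic : is_lrmap (gcomp iota (gcomp c' Psi')) by exact: comp_lrmap.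
  have liC : is_lrmap (gcomp iota C) by exact: comp_lrmap.
  have lp1c : is_lrmap (gcomp (pfst P) (gcomp iota (gcomp c' Psi'))) by exact: comp_lrmap.
  have lp1C : is_lrmap (gcomp p1 C) by exact: comp_lrmap.
  have lp2c : is_lrmap (gcomp p2 c') by exact: comp_lrmap.
  have lp2cP : is_lrmap (gcomp p2 (gcomp c' Psi')) by exact: comp_lrmap.
  have lp2C : is_lrmap (gcomp p2 C) by exact: comp_lrmap.
  have lp1i : is_lrmap (gcomp (gcomp p1 pi) proj) by exact: comp_lrmap.
  have lpp : is_lrmap (gcomp (pfst P) (gcomp (pfst P2) (gcomp i2 Psi'))).
    by do ?apply: comp_lrmap.
  have lp1c' : is_lrmap (gcomp p1 c') by exact: comp_lrmap.
  apply: (gprod_uniq mS) => //.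
    apply: (@geqT _ _ _ _ (gcomp (gcomp p1 pi) proj)) => //.
      apply: geqT p1A => //.
      apply: (@geqT _ _ _ _ (gcomp (pfst P) (gcomp (pfst P2) (gcomp i2 Psi')))) => //.
        exact: (@geqCl _ _ _ _ (gcomp p1 c') (gcomp (pfst P) (gcomp (pfst P2) i2)) Psi').
      exact: (@geqCr _ _ _ _ (pfst P) (gcomp (pfst P2) (gcomp i2 Psi')) (gcomp iota A)).
    apply: geqS => //.
    apply: (@geqT _ _ _ _ (tmap k om (gcomp p1 pi) (gfield0 M))) => //.
      exact: (tmap_comp mQ mN mM om lpi lp1 gZ' h0 Zp1).
    exact: (tmap0 mQ mM k om lp1pi).
  apply: gline_map_eq => //.
  rewrite -[RHS]/(@gpull R _ _ (gcomp p2 C) setT _ t) tC.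
  rewrite -[LHS]/(@gpull R _ _ (gcomp (gcomp p2 c') Psi') setT _ t).
  have e1 : geq (gcomp (gcomp p2 c') Psi') (gcomp (gcomp p (gcomp s i2)) Psi').
    exact: geqCl.
  rewrite (gpullT_geq t hS e1).
  rewrite -[LHS]/(@gpull R _ _ (gcomp i2 Psi') setT _ (@gpull R _ _ s setT _
    (@gpull R _ _ p setT _ t))) pT.
  have ls' := lrmap_premap ls; have liP := lrmap_premap (comp_lrmap lPsi' li2).
  rewrite (pullD ls' _ _ openT) (pullD liP _ _ openT).
  have f1 : @gpull R _ _ s setT _ (@gpull R _ _ (pfst TT) setT _ t) =
    @gpull R _ _ (gcomp (psnd P) (pfst P2)) setT _ t := gpullT_geq t hP2 es1.
  have f2 : @gpull R _ _ s setT _ (@gpull R _ _ (psnd TT) setT _ t) =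
    @gpull R _ _ (psnd P2) setT _ t := gpullT_geq t hP2 es2.
  rewrite f1 f2.
  have g1 : @gpull R _ _ (gcomp i2 Psi') setT _
      (@gpull R _ _ (gcomp (psnd P) (pfst P2)) setT _ t) =
      @gpull R _ _ (gcomp p2 A) setT _ t.
    exact: (gpullT_geq (@gpull R _ _ (psnd P) setT _ t) hS k1Psi).
  have g2 : @gpull R _ _ (gcomp i2 Psi') setT _ (@gpull R _ _ (psnd P2) setT _ t) =
      @gpull R _ _ (gcomp (gcomp p2 pi) proj) setT _ t := gpullT_geq t hS k2Psi.
  rewrite g1 g2 tA; congr pair; first exact: add0r.
  exact: addr0.
have bcPsi : geq (gcomp theta (gcomp b' Psi')) (gcomp theta (gcomp c' Psi')).
  by apply: (@geqCl _ _ _ _ (gcomp theta b') (gcomp theta c') Psi') => //; exact: comp_lrmap.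
have lthB : is_lrmap (gcomp theta B) by exact: comp_lrmap.
have lthb : is_lrmap (gcomp theta (gcomp b' Psi')) by exact: comp_lrmap.
have thBC : geq (gcomp theta B) (gcomp theta C).
  apply: (@geqT _ _ _ _ (gcomp theta (gcomp b' Psi'))) => //.
    by apply: geqS => //; exact: geqCr.
  by apply: geqT bcPsi _ => //; exact: geqCr.
(* The fields sit in the [eta] parts; the generator condition then rewrites the right-hand one. *)
have := gpullT_geq a hS thBC.
rewrite (tmap_coord mQ mN om pi theta a gE) (tmap_coord mQ mN om pi theta a gZ').
by case=> ->; rewrite Zth.
Qed.

End Invariance.

(** The unit occurs as a product in a degree that equals [0] only by a proof; with [z] and [q] as
    variables the equations can be substituted. *)
Lemma gmul_one_inj (R : realType) (M : grspace R) (U : set M) (z q i : int)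
    (s t : @gsec R M U i) : is_gsheaf M -> open U -> z = 0 -> q = i ->
  gmul q (gmul z (gone U) (gone U)) s = gmul q (gmul z (gone U) (gone U)) t -> s = t.
Proof. by move=> hM oU -> ->; rewrite !gmul1l. Qed.

Theorem proposition4p3 (R : realType) (M : grspace R) (k : int) (X : gfield M)
    (P : gprod M (gline R k)) (P2 : gprod P (gline R k))
    (TT : gprod (gline R k) (gline R k))
    (D : set (M * gline R k)) (theta : gmap (grestr (gflow_dom P D)) M) :
  gmanifold M ->
  is_gfield k X ->
  gbracket k k X X = gfield0 M ->
  is_flow_of P2 TT X theta ->
  forall (X1 : gfield P) (X1D : gfield (grestr (gflow_dom P D))),
    is_gfield_lift X (gfield0 (gline R k)) X1 ->
    is_gfield_restr X1 X1D ->
    grelated theta X1D X.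
Proof.
move=> mM hX _ [flow gen _] X1 E hX1 hE i j a.
have oN := gflow_dom_open P (gflow_domP flow).
have mP : gmanifold P by have [] := pobjP P.
have mN := grestr_gmanifold oN mP; have hN := gman_sheaf mN.
have [lth _] := gflow_smooth flow; have [gE _] := hE.
(* In every other degree both sides vanish, since both fields have degree [k]. *)
have [->|jik] := eqVneq j (i + k); last first.
  rewrite (gfield_deg gE _ jik) (gfield_deg hX _ jik).
  by rewrite (pull0 (lrmap_premap lth) _ openT).
have [ko|ke] := boolP (odd (absz k)).
  have ko' : odd (absz (k + 0)) by rewrite addr0.
  (* Here [om] is [1], of degree [w = 0], so that [eps] is [eta] itself; it is written as a product
     to fit [gmul_one_inj]. *)
  have := om_related mM hX flow gen hX1 hE mN (gid_lrmap hN)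
    (gmul 0 (gone setT) (gone setT)) ko' a.
  by apply: gmul_one_inj => //; rewrite addr0.
set N := grestr (gflow_dom P D) in mN hN E hE gE a *.
(* Here [om] is the variable [eta'] of degree [- 1], that is the pair of [0] and [1]. The shift
   [0 + 1] has the shape [k + w] found in [tproj], and [1] is written as a product in order to live
   in degree [- 1 + (0 + 1)]. *)
pose om : @gsec R (thick N (0 + 1)) setT (- 1) :=
  (0, gmul (- 1 + (0 + 1)) (gone setT) (gone setT)).
have ko' : odd (absz (k + (- 1))) by lia.
have o1 : odd (absz (0 + 1 : int)) by [].
have := om_related mM hX flow gen hX1 hE (thick_gmanifold o1 mN)
  (tproj_lrmap mN 0 1) om ko' a.
have oR := open_im oN (@openT (grestr (gflow_dom P D))).
(* The [eta'] part of [eta'] times a section pulled back from [N] is that section, so [om] can be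
   cancelled. *)
move=> /(congr1 snd) /=; rewrite !(gmul0l (gman_sheaf mP)) // !scaler0 !addr0.
by apply: (gmul_one_inj (gman_sheaf mP) oR); ring.
Qed.
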